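(* Let $X$ be a Banach space with the Radon-Nikodým property, let $Y$ be a Banach space and let $G\in L(X,Y)$ be a norm-one operator. Then the following assertions are equivalent: (i) $G$ is lush. (ii) $G$ is a spear operator. (iii) $G$ has the alternative Daugavet property. (iv) $|y^*(Gx)|=1$ for every $y^*\in\operatorname{ext}(B_{Y^*})$ and every denting point $x$ of $B_X$. (v) $B_X=\overline{\operatorname{conv}}\{x\in B_X: Gx\in\operatorname{Spear}(Y)\}$ or, equivalently, $$B_X=\overline{\operatorname{conv}}\{x\in B_X: |y^*(Gx)|=1\ \ \forall y^*\in\operatorname{ext}(B_{Y^*})\}=\overline{\operatorname{conv}}\Bigl(\bigcap_{y^*\in\operatorname{ext}(B_{Y^*})}\mathbb{T}\,\{x\in S_X:\operatorname{Re} y^*(Gx)=1\}\Bigr).$$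
   Context: Scalars are $\mathbb{K}=\mathbb{R}$ or $\mathbb{C}$; $\mathbb{T}=\{\omega\in\mathbb{K}:|\omega|=1\}$; $B_X$, $S_X$ are the closed unit ball and unit sphere; $\operatorname{ext}$ denotes the set of extreme points; $\operatorname{aconv}(F)=\operatorname{conv}(\mathbb{T}F)$. $\operatorname{Spear}(Z)$ is the set of spear vectors of a Banach space $Z$: those $z\in S_Z$ with $\sup_{\omega\in\mathbb{T}}\|z+\omega x\|=1+\|x\|$ for every $x\in Z$. $G\in L(X,Y)$ is a spear operator if $\sup_{\omega\in\mathbb{T}}\|G+\omega T\|=1+\|T\|$ for every $T\in L(X,Y)$; it has the alternative Daugavet property if this holds for every rank-one $T\in L(X,Y)$. A norm-one $G\in L(X,Y)$ is lush if for every $x_0\in B_X$, $\varepsilon>0$ and $y\in S_Y$ there is $F\subset B_X$ with $\operatorname{conv}(F)\subset\{x\in B_X:\|Gx+y\|>2-\varepsilon\}$ and $\operatorname{dist}(x_0,\operatorname{aconv}(F))<\varepsilon$. A point $x\in B_X$ is denting if it belongs to slices of $B_X$ of arbitrarily small diameter. *)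

(* Defs.v *)
From HB Require Import structures.
From mathcomp Require Import all_boot all_order all_algebra.
From mathcomp Require Import complex.
From mathcomp Require Import all_classical all_reals all_analysis.

Set Implicit Arguments.
Unset Strict Implicit.
Unset Printing Implicit Defensive.

Import Order.TTheory GRing.Theory Num.Theory.
Import numFieldNormedType.Exports.

Local Open Scope classical_set_scope.
Local Open Scope complex_scope.
Local Open Scope ring_scope.

(* A term of [real_or_complex R K] says that K is R or R[i].  The norm of a    *)
(* [normedModType K] takes its values in K; [rnorm] below is this norm in R.   *)
Variant real_or_complex (R : realType) : numFieldType -> Type :=
  | RealScalars : real_or_complex R R
  | ComplexScalars : real_or_complex R R[i].

Definition scalar_re (R : realType) (K : numFieldType)
    (k : real_or_complex R K) : K -> R :=
  match k in real_or_complex _ K' return K' -> R with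
  | RealScalars => fun a => a
  | ComplexScalars => fun a => complex.Re a
  end.

Definition scalar_of_real (R : realType) (K : numFieldType)
    (k : real_or_complex R K) : R -> K :=
  match k in real_or_complex _ K' return R -> K' with
  | RealScalars => fun r => r
  | ComplexScalars => fun r => r%:C
  end.

Definition unit_scalars (K : numFieldType) : set K := [set w | `|w| = 1].
Arguments unit_scalars K : clear implicits.

Definition conv (K : numFieldType) (V : lmodType K) (A : set V) : set V :=
  [set x | exists (n : nat) (a : 'I_n -> K) (v : 'I_n -> V),
     [/\ forall i, 0 <= a i, \sum_(i < n) a i = 1, forall i, A (v i)
       & x = \sum_(i < n) a i *: v i]].

Definition aconv (K : numFieldType) (V : lmodType K) (A : set V) : set V :=
  conv [set w *: x | w in unit_scalars K & x in A].

Definition closed_conv (K : numFieldType) (V : normedModType K) (A : set V) :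
  set V := closure (conv A).

Definition extreme_points (K : numFieldType) (V : lmodType K) (A : set V) :
    set V :=
  [set x | A x /\
     forall (y z : V) (t : K), A y -> A z -> 0 < t < 1 ->
       x = t *: y + (1 - t) *: z -> y = x /\ z = x].

Section NormedSpaces.
Variables (R : realType) (K : numFieldType) (k : real_or_complex R K).

Definition rnorm (V : normedModType K) (x : V) : R := scalar_re k `|x|.

Definition unit_ball (V : normedModType K) : set V := [set x | rnorm x <= 1].

Definition unit_sphere (V : normedModType K) : set V := [set x | rnorm x = 1].

Arguments unit_ball V : clear implicits.
Arguments unit_sphere V : clear implicits.

(* In \bar R, so that the distance to the empty set is +oo. *)
Definition dist_to (V : normedModType K) (x : V) (A : set V) : \bar R :=
  ereal_inf [set (rnorm (x - z))%:E | z in A].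

Definition diameter (V : normedModType K) (A : set V) : R :=
  sup [set rnorm (x - y) | x in A & y in A].

Definition bounded_operator (V W : normedModType K) : set (V -> W) :=
  [set f | linear f /\ continuous f].

Definition opnorm (V W : normedModType K) (f : V -> W) : R :=
  sup [set rnorm (f x) | x in unit_ball V].

Definition dual_ball (V : normedModType K) : set (V -> K^o) :=
  [set f | bounded_operator f /\ opnorm f <= 1].
Arguments dual_ball V : clear implicits.

Definition slice (V : normedModType K) (A : set V) (f : V -> K^o) (a : R) :
    set V :=
  [set x | A x /\
     sup [set scalar_re k (f z) | z in A] - a < scalar_re k (f x)].

Definition denting_point (V : normedModType K) (x : V) : Prop :=
  unit_ball V x /\
  forall e : R, 0 < e ->
    exists (f : V -> K^o) (a : R),
      [/\ bounded_operator f, 0 < a, slice (unit_ball V) f a x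
        & diameter (slice (unit_ball V) f a) < e].

Definition spear_vector (V : normedModType K) (z : V) : Prop :=
  unit_sphere V z /\
  forall x : V,
    sup [set rnorm (z + w *: x) | w in unit_scalars K] = 1 + rnorm x.

Section Operators.
Variables V W : normedModType K.

Definition spear_operator (G : V -> W) : Prop :=
  forall T : V -> W, bounded_operator T ->
    sup [set opnorm (G + w *: T) | w in unit_scalars K] = 1 + opnorm T.

Definition rank_one (T : V -> W) : Prop :=
  exists y : W, y != 0 /\ range T = [set a *: y | a in [set: K]].

Definition alternative_daugavet (G : V -> W) : Prop :=
  forall T : V -> W, bounded_operator T -> rank_one T ->
    sup [set opnorm (G + w *: T) | w in unit_scalars K] = 1 + opnorm T.

Definition lush (G : V -> W) : Prop :=
  forall (x0 : V) (e : R) (y : W), unit_ball V x0 -> 0 < e -> unit_sphere W y ->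
    exists F : set V,
      [/\ F `<=` unit_ball V,
          conv F `<=` [set x | unit_ball V x /\ 2 - e < rnorm (G x + y)]
        & (dist_to x0 (aconv F) < e%:E)%E].

End Operators.

End NormedSpaces.

Arguments unit_ball {R K} k V _.
Arguments unit_sphere {R K} k V _.
Arguments dual_ball {R K} k V _.

(* The Radon-Nikodym property: every vector measure of bounded variation that  *)
(* is absolutely continuous with respect to a finite measure mu is             *)
(* E |-> \int_E g dmu (Bochner integral) for some g in L^1(mu, V).             *)
Section RadonNikodym.
Variables (R : realType) (K : numFieldType) (k : real_or_complex R K).
Variable V : normedModType K.
Context (d : measure_display) (T : measurableType d).
Variable mu : {finite_measure set T -> \bar R}.

Definition vector_measure (F : set T -> V) : Prop :=
  forall E : (set T)^nat, (forall n, measurable (E n)) -> trivIset setT E ->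
    \sum_(0 <= i < n) F (E i) @[n --> \oo] --> F (\bigcup_n E n).

Definition bounded_variation (F : set T -> V) : Prop :=
  exists M : R, forall (n : nat) (E : 'I_n -> set T),
    (forall i, measurable (E i)) -> trivIset setT E ->
    \sum_(i < n) rnorm k (F (E i)) <= M.

Definition vector_dominates (F : set T -> V) : Prop :=
  forall E : set T, measurable E -> mu E = 0%E -> F E = 0.

(* A simple function is given by a list of pairs (A, v) with A measurable;     *)
(* it stands for the sum of the functions v 1_A, and the sets A may overlap.   *)
Definition simple_data (s : seq (set T * V)) : Prop :=
  forall p, p \in s -> measurable p.1.

Definition simple_val (s : seq (set T * V)) (t : T) : V :=
  \sum_(p <- s) (\1_(p.1) t : K) *: p.2.

Definition simple_integral (s : seq (set T * V)) (E : set T) : V :=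
  \sum_(p <- s) scalar_of_real k (fine (mu (p.1 `&` E))) *: p.2.

(* The limit is required everywhere, not just almost everywhere: each class in *)
(* L^1(mu, V) has such a representative, and then the norms of g and of g      *)
(* minus a simple function are measurable.                                     *)
Definition strongly_measurable (g : T -> V) : Prop :=
  exists s : nat -> seq (set T * V),
    (forall n, simple_data (s n)) /\
    forall t, simple_val (s n) t @[n --> \oo] --> g t.

Definition bochner_approx (g : T -> V) (s : nat -> seq (set T * V)) : Prop :=
  (forall n, simple_data (s n)) /\
  (\int[mu]_t (rnorm k (g t - simple_val (s n) t))%:E @[n --> \oo] --> 0)%E.

Definition bochner_integrable (g : T -> V) : Prop :=
  strongly_measurable g /\ exists s, bochner_approx g s.

Definition bochner_integral (g : T -> V) (E : set T) (v : V) : Prop :=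
  exists s, bochner_approx g s /\
    simple_integral (s n) E @[n --> \oo] --> v.

End RadonNikodym.

Definition radon_nikodym_property (R : realType) (K : numFieldType)
    (k : real_or_complex R K) (V : normedModType K) : Prop :=
  forall (d : measure_display) (T : measurableType d)
    (mu : {finite_measure set T -> \bar R}) (F : set T -> V),
    vector_measure F -> bounded_variation k F -> vector_dominates mu F ->
    exists g : T -> V, bochner_integrable k mu g /\
      forall E : set T, measurable E -> bochner_integral k mu g E (F E).

(* Main.v *)
(* With P the alternative Daugavet property, the argument runs lush => spear => *)
(* P => (iv) => (v) => lush, where only (iv) => (v) uses the Radon-Nikodym      *)
(* property.  Lush => spear is a Hahn-Banach separation, and P => (iv) tests P  *)
(* on operators f (x) y with f defining a small slice around the denting point  *)
(* x: this makes G x a spear vector, and z is a spear vector iff |f z| = 1 for  *)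
(* all extreme points f of the dual ball.  Extreme functionals are obtained     *)
(* without the weak-star topology, as minimal sublinear functionals.            *)
(* For (iv) => (v), the ball is the closed convex hull of its denting points as *)
(* soon as each of its slices contains slices of arbitrarily small diameter.    *)
(* If a slice contains none, each of its points away from the bounding          *)
(* hyperplane is a limit of means of points of the ball at distance at least    *)
(* eps.  Iterating gives a bounded dyadic tree, a perturbed martingale on       *)
(* [0, 1[, whose jumps have size at least eps on a set of measure at least 1/4. *)
(* It defines a vector measure, absolutely continuous and of bounded variation; *)
(* a Bochner density would be close in mean to a function constant on cells,    *)
(* which forces the mean jumps to be small.                                     *)
Require Import Defs.
From HB Require Import structures.
From mathcomp Require Import all_boot all_order all_algebra.
From mathcomp Require Import complex ring lra.
From mathcomp Require Import all_classical all_reals all_analysis.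
From mathcomp Require Import measurable_realfun.
Import Order.TTheory GRing.Theory Num.Theory.
Import numFieldNormedType.Exports.
Local Open Scope classical_set_scope.
Local Open Scope ring_scope.

Set Implicit Arguments.
Unset Strict Implicit.
Unset Printing Implicit Defensive.

(* [conv] also names a convex combination in mathcomp-analysis. *)
Local Notation conv := Defs.conv.

(** * Real and complex scalars *)

(** Two facts carry the equivalences. A vector z of norm at most 1 is a spear vector exactly when
    every extreme functional of the dual ball has modulus 1 at z ([spear_extreme], [extreme_spear]),
    so the forms of (v) describe the same points x. And the alternative Daugavet property makes G
    map denting points to spear vectors ([daugavet_denting_spear]): for T = (f / M) y with f cutting
    off a tiny slice, a point nearly norming G + w T can be rotated into that slice, hence lies near
    the denting point z, and |G z + w y| is nearly 1 + |y|.

    Lushness gives the spear property ([lush_spear_operator]) because a single functional f has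
    values near 1 on G(F) and |f (T v)| near the norm of T for some v in F. Conversely, if the ball
    is the closed hull of points x with |f (G x)| = 1 for all extreme f, then for y in the sphere
    and an extreme f norming y, the face re f (G x) = 1 of the ball witnesses lushness
    ([extreme_hull_lush]).

    The remaining link is [radon_nikodym_denting_hull]. By Hahn-Banach it suffices that every slice
    contains a denting point, which is the limit of nested slices of shrinking diameter
    ([denting_in_slice]). Where small slices are lacking, a tree with separated nodes grows
    ([bush_tree]). Its levels are step functions on [0, 1[ whose integrals converge to a vector
    measure dominated by Lebesgue measure. A density would make consecutive levels close in mean
    ([radon_nikodym_tree]), while the tree keeps them apart. *)

Section Scalars.
Local Open Scope complex_scope.
Variables (R : realType) (K : numFieldType) (k : real_or_complex R K).

Lemma scalar_of_real_is_zmod : zmod_morphism (scalar_of_real k).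
Proof. by case: K / k => x y //=; rewrite rmorphB. Qed.

Lemma scalar_of_real_is_monoid : monoid_morphism (scalar_of_real k).
Proof. by case: K / k => //; split=> // x y /=; rewrite rmorphM. Qed.

HB.instance Definition _ :=
  GRing.isZmodMorphism.Build R K (scalar_of_real k) scalar_of_real_is_zmod.
HB.instance Definition _ :=
  GRing.isMonoidMorphism.Build R K (scalar_of_real k) scalar_of_real_is_monoid.

Lemma scalar_re_is_zmod : zmod_morphism (scalar_re k).
Proof. by case: K / k => x y //=; case: x; case: y. Qed.

HB.instance Definition _ :=
  GRing.isZmodMorphism.Build K R (scalar_re k) scalar_re_is_zmod.

Local Notation rs := (scalar_of_real k).
Local Notation re := (scalar_re k).
Local Notation rabs a := (scalar_re k `|(a : K)|).

Lemma scalar_reK r : re (rs r) = r.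
Proof. by case: K / k. Qed.

Lemma scalar_reZ r a : re (rs r * a) = r * re a.
Proof. by case: K / k a => //= -[a b] /=; rewrite mul0r subr0. Qed.

Lemma scalar_of_reK a : 0 <= a -> rs (re a) = a.
Proof. by case: K / k a => //= -[a b]; rewrite lecE /= => /andP[/eqP -> _]. Qed.

Lemma scalar_of_real_le r s : (rs r <= rs s) = (r <= s).
Proof. by case: K / k => //=; rewrite lecR. Qed.

Lemma scalar_of_real_lt r s : (rs r < rs s) = (r < s).
Proof. by case: K / k => //=; rewrite ltcR. Qed.

Lemma scalar_of_real_ge0 r : (0 <= rs r) = (0 <= r).
Proof. by rewrite -(rmorph0 rs) scalar_of_real_le. Qed.

Lemma scalar_of_real_gt0 r : (0 < rs r) = (0 < r).
Proof. by rewrite -(rmorph0 rs) scalar_of_real_lt. Qed.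

Lemma scalar_re_ge0 a : 0 <= a -> 0 <= re a.
Proof. by move=> a0; rewrite -scalar_of_real_ge0 scalar_of_reK. Qed.

Lemma scalar_re_gt0 a : 0 < a -> 0 < re a.
Proof. by move=> a0; rewrite -scalar_of_real_gt0 scalar_of_reK // ltW. Qed.

Lemma scalar_of_real_norm r : `|rs r| = rs `|r|.
Proof.
case: K / k => //; apply: etrans (normc_def _) _.
by rewrite /= expr0n addr0 sqrtr_sqr.
Qed.

Lemma rabs_real r : rabs (rs r) = `|r|.
Proof. by rewrite scalar_of_real_norm scalar_reK. Qed.

Lemma rabsK a : rs (rabs a) = `|a|.
Proof. by rewrite scalar_of_reK. Qed.

Lemma rabsM a b : rabs (a * b) = rabs a * rabs b.
Proof. by rewrite normrM -(rabsK a) scalar_reZ rabsK. Qed.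

Lemma rabs_unit w : unit_scalars K w -> rabs w = 1.
Proof. by rewrite /unit_scalars /= => ->; rewrite -(rmorph1 rs) scalar_reK. Qed.

Lemma rabs_eq1 w : rabs w = 1 -> `|w| = 1.
Proof. by move=> h; rewrite -rabsK h rmorph1. Qed.

Lemma rabs_ge0 a : 0 <= rabs a.
Proof. exact: scalar_re_ge0. Qed.

Lemma scalar_re_le a : re a <= rabs a.
Proof.
case: K / k a => [a|[a b]]; first exact: ler_norm.
have -> : `|a +i* b| = (Num.sqrt (a ^+ 2 + b ^+ 2))%:C by exact: normc_def.
by rewrite /= (le_trans (ler_norm a)) // -sqrtr_sqr ler_wsqrtr // lerDl sqr_ge0.
Qed.

Lemma rabsD a b : rabs (a + b) <= rabs a + rabs b.
Proof.
by rewrite -scalar_of_real_le rmorphD /= !rabsK ler_normD.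
Qed.

Lemma unit_scalarV w : unit_scalars K w -> unit_scalars K w^-1.
Proof. by rewrite /unit_scalars /= normfV => ->; rewrite invr1. Qed.

Lemma unit_scalar1 : unit_scalars K 1.
Proof. by rewrite /unit_scalars /= normr1. Qed.

Lemma unit_scalar_neq0 w : unit_scalars K w -> w != 0.
Proof. by rewrite /unit_scalars /= -normr_gt0 => ->. Qed.

(** The rotation that passes from bounds on real parts to bounds on moduli. *)
Lemma unit_scalar_align (a : K) :
  exists2 w, unit_scalars K w & w * a = `|a|.
Proof.
have [->|a0] := eqVneq a 0.
  by exists 1; [exact: unit_scalar1 | rewrite mulr0 normr0].
exists (`|a| / a); last by rewrite mulfVK.
by rewrite /unit_scalars /= normrM normfV normr_id divff // normr_eq0.
Qed.

Section Norm.
Variable V : normedModType K.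
Implicit Types x y : V.
Local Notation rn := (@rnorm R K k V).

Lemma rnormK x : rs (rn x) = `|x|.
Proof. by rewrite scalar_of_reK. Qed.

Lemma rnorm_ge0 x : 0 <= rn x.
Proof. exact: scalar_re_ge0. Qed.

Lemma rnorm0 : rn 0 = 0.
Proof. by rewrite /rnorm normr0 raddf0. Qed.

Lemma rnorm0_eq0 x : rn x = 0 -> x = 0.
Proof.
by move=> h; apply/eqP; rewrite -normr_eq0 -rnormK h rmorph0.
Qed.

Lemma rnorm_gt0 x : (0 < rn x) = (x != 0).
Proof. by rewrite -scalar_of_real_gt0 rnormK normr_gt0. Qed.

Lemma rnormD x y : rn (x + y) <= rn x + rn y.
Proof. by rewrite -scalar_of_real_le rmorphD /= !rnormK ler_normD. Qed.

Lemma rnormN x : rn (- x) = rn x.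
Proof. by rewrite /rnorm normrN. Qed.

Lemma rnormB x y : rn (x - y) <= rn x + rn y.
Proof. by rewrite -(rnormN y) rnormD. Qed.

Lemma rdistC x y : rn (x - y) = rn (y - x).
Proof. by rewrite -rnormN opprB. Qed.

Lemma rdist_triangle z x y : rn (x - y) <= rn (x - z) + rn (z - y).
Proof. by rewrite (le_trans _ (rnormD _ _)) // addrA subrK. Qed.

Lemma rnormZ (a : K) x : rn (a *: x) = rabs a * rn x.
Proof. by rewrite /rnorm normrZ -(rabsK a) scalar_reZ rabsK. Qed.

Lemma rnorm_realZ r x : rn (rs r *: x) = `|r| * rn x.
Proof. by rewrite rnormZ rabs_real. Qed.

Lemma rnorm_unitZ w x : unit_scalars K w -> rn (w *: x) = rn x.
Proof. by move=> /rabs_unit w1; rewrite rnormZ w1 mul1r. Qed.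

Lemma rnorm_sum (I : Type) (s : seq I) (P : pred I) (F : I -> V) :
  rn (\sum_(i <- s | P i) F i) <= \sum_(i <- s | P i) rn (F i).
Proof.
elim/big_ind2: _ => [|x a y b ha hb|//]; first by rewrite rnorm0.
by rewrite (le_trans (rnormD _ _)) // lerD.
Qed.

Lemma rnorm_normalize x : x != 0 -> rn (rs (rn x)^-1 *: x) = 1.
Proof.
rewrite -rnorm_gt0 => x0.
by rewrite rnorm_realZ gtr0_norm ?invr_gt0 // mulVf // gt_eqF.
Qed.

Lemma cvg_rnorm (T : Type) (F : set_system T) {FF : Filter F} (u : T -> V) l :
  (forall e : R, 0 < e -> \forall t \near F, rn (u t - l) < e) <->
  u @ F --> l.
Proof.
split=> [h|h e e0].
  apply/cvgrPdist_lt => e e0; near=> t.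
  rewrite distrC -rnormK -(scalar_of_reK (ltW e0)) scalar_of_real_lt.
  near: t; apply: h; exact: scalar_re_gt0.
move/cvgrPdist_lt: h => /(_ (rs e)); rewrite scalar_of_real_gt0 => /(_ e0).
by apply: filterS => t; rewrite distrC -rnormK scalar_of_real_lt.
Unshelve. all: by end_near. Qed.

Lemma closure_rnorm (A : set V) x :
  closure A x <-> forall e : R, 0 < e -> exists2 y, A y & rn (x - y) < e.
Proof.
split=> [h e e0|h B].
  have /h[y [Ay]] : nbhs x (ball x (rs e)).
    by apply: nbhsx_ballx; rewrite scalar_of_real_gt0.
  by rewrite -ball_normE /ball_ /= -rnormK scalar_of_real_lt => ?; exists y.
rewrite -nbhs_ballE => -[e /= e0 eB].
have [y Ay xy] := h _ (scalar_re_gt0 e0).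
exists y; split=> //; apply: eB; rewrite -ball_normE /ball_ /= -rnormK.
by rewrite -(scalar_of_reK (ltW e0)) scalar_of_real_lt.
Qed.

End Norm.

Lemma rnorm_scalar (a : K) : rnorm k (a : K^o) = rabs a.
Proof. by []. Qed.

End Scalars.

(** * Sublinear functionals *)

Section RealFunctionals.
Variables (R : realType) (K : numFieldType) (k : real_or_complex R K).
Variable V : lmodType K.
Implicit Types (p q phi psi : V -> R) (u v x z : V) (r s t c : R).
Local Notation rs := (scalar_of_real k).

(** Only homogeneity over the reals is asked, so that the Hahn-Banach arguments are the same over
    both fields; [linear_of_re] then recovers a functional linear over K. *)
Definition real_linear phi :=
  (forall u v, phi (u + v) = phi u + phi v) /\
  (forall r v, phi (rs r *: v) = r * phi v).

Definition sublinear p :=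
  (forall u v, p (u + v) <= p u + p v) /\
  (forall r v, 0 <= r -> p (rs r *: v) = r * p v).

Definition dominated phi p := forall v, phi v <= p v.

(* A sublinear q <= p is the support function of {phi | phi <= q}; this says  *)
(* that the latter is a face of {phi | phi <= p}.                             *)
Definition facial p q :=
  forall phi psi t, real_linear phi -> real_linear psi ->
    dominated phi p -> dominated psi p -> 0 < t < 1 ->
    dominated (fun v => t * phi v + (1 - t) * psi v) q ->
    dominated phi q /\ dominated psi q.

Lemma facial_refl p : facial p p. Proof. by []. Qed.

Lemma real_linear0 phi : real_linear phi -> phi 0 = 0.
Proof. by case=> _ /(_ 0 0); rewrite scaler0 mul0r. Qed.

Lemma real_linearN phi v : real_linear phi -> phi (- v) = - phi v.
Proof. by case=> _ /(_ (-1) v); rewrite rmorphN1 scaleN1r mulN1r. Qed.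

Lemma real_linearB phi u v : real_linear phi -> phi (u - v) = phi u - phi v.
Proof. by move=> l; rewrite l.1 real_linearN. Qed.

Lemma sublinear0 p : sublinear p -> p 0 = 0.
Proof. by case=> _ /(_ 0 0 (lexx _)); rewrite scaler0 mul0r. Qed.

Lemma sublinear_opp p v : sublinear p -> - p (- v) <= p v.
Proof.
by move=> sp; rewrite -subr_ge0 opprK -(sublinear0 sp) -(subrr v); apply: sp.1.
Qed.

(** The reverse inequality is the given one for the inverse of r. *)
Lemma sublinear_intro p : p 0 = 0 -> (forall u v, p (u + v) <= p u + p v) ->
  (forall r v, 0 < r -> p (rs r *: v) <= r * p v) -> sublinear p.
Proof.
move=> p0 pD pZ; split=> // r v; rewrite le_eqVlt => /predU1P[<-|r0].
  by rewrite rmorph0 scale0r mul0r.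
apply/eqP; rewrite eq_le pZ //=.
have := pZ r^-1 (rs r *: v); rewrite invr_gt0 => /(_ r0).
rewrite scalerA -rmorphM mulVf ?gt_eqF // rmorph1 scale1r.
by rewrite -(ler_pM2l r0) mulrA divff ?gt_eqF // mul1r.
Qed.

Lemma inf_le (E : set R) c : (exists m, lbound E m) -> E c -> inf E <= c.
Proof. by move=> E0 Ec; apply: ge_inf. Qed.

Section Cone.
Variables (q : V -> R) (Z : set (V * R)).
Hypothesis sq : sublinear q.
Hypothesis Z0 : Z (0, 0).
Hypothesis ZD : forall z z' c c', Z (z, c) -> Z (z', c') -> Z (z + z', c + c').
Hypothesis ZZ : forall r z c, 0 < r -> Z (z, c) -> Z (rs r *: z, r * c).
Hypothesis Zq : forall z c, Z (z, c) -> c <= q z.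

(** A real-linear functional lies below [cone_inf] exactly when it lies below q and is at least c at
    z for every (z, c) in Z: prescribed lower bounds are turned into a sublinear majorant. *)
Definition cone_inf v := inf [set q (v + zc.1) - zc.2 | zc in Z].

Let lb v : lbound [set q (v + zc.1) - zc.2 | zc in Z] (- q (- v)).
Proof.
move=> _ [[z c] Zzc <-] /=.
have := Zq Zzc; have := sq.1 (v + z) (- v); rewrite addrAC subrr add0r.
lra.
Qed.

Lemma cone_inf_le v z c : Z (z, c) -> cone_inf v <= q (v + z) - c.
Proof. by move=> Zzc; apply: inf_le; [exists (- q (- v)) | exists (z, c)]. Qed.

Lemma le_cone_inf v m : (forall z c, Z (z, c) -> (m : R) <= q (v + z) - c) ->
  m <= cone_inf v.
Proof.
move=> h; apply: lb_le_inf; first by exists (q (v + 0) - 0), (0, 0).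
by move=> _ [[z c] /h ? <-].
Qed.

Lemma cone_inf_dominated : dominated cone_inf q.
Proof. by move=> v; have := cone_inf_le v Z0; rewrite addr0 subr0. Qed.

Lemma cone_inf_opp z c : Z (z, c) -> cone_inf (- z) <= - c.
Proof.
by move=> /(cone_inf_le (- z)); rewrite addNr (sublinear0 sq) sub0r.
Qed.

Lemma cone_inf_sublinear : sublinear cone_inf.
Proof.
apply: sublinear_intro => [|u v|r v r0].
- apply/eqP; rewrite eq_le; apply/andP; split.
    by have := cone_inf_dominated 0; rewrite (sublinear0 sq).
  by apply: le_cone_inf => z c /Zq; rewrite add0r subr_ge0.
- rewrite -lerBlDr; apply: le_cone_inf => z c Zzc.
  rewrite lerBlDr [leRHS]addrC -lerBlDr; apply: le_cone_inf => z' c' Zzc'.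
  rewrite lerBlDr; apply: le_trans (cone_inf_le _ (ZD Zzc Zzc')) _.
  have := sq.1 (u + z) (v + z'); rewrite addrACA; lra.
- rewrite mulrC -ler_pdivrMr //; apply: le_cone_inf => z c Zzc.
  rewrite ler_pdivrMr //; apply: le_trans (cone_inf_le _ (ZZ r0 Zzc)) _.
  by rewrite -scalerDr sq.2 ?(ltW r0) // -mulrBr mulrC.
Qed.

End Cone.

Section FaceStep.
Variables (p q : V -> R) (x : V).
Hypothesis sq : sublinear q.

(** The cone generated by (x, q x); a functional below the resulting [cone_inf] must take the value
    q x at x. *)
Definition ray : set (V * R) :=
  [set zc | exists2 s, 0 <= s & zc = (rs s *: x, s * q x)].

Let ray0 : ray (0, 0).
Proof. by exists 0 => //; rewrite rmorph0 scale0r mul0r. Qed.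

Let rayD z z' c c' : ray (z, c) -> ray (z', c') -> ray (z + z', c + c').
Proof.
move=> [s s0 [-> ->]] [s' s'0 [-> ->]]; exists (s + s'); first exact: addr_ge0.
by rewrite rmorphD scalerDl mulrDl.
Qed.

Let rayZ r z c : 0 < r -> ray (z, c) -> ray (rs r *: z, r * c).
Proof.
move=> r0 [s s0 [-> ->]]; exists (r * s); first by rewrite mulr_ge0 // ltW.
by rewrite rmorphM scalerA mulrA.
Qed.

Let rayq z c : ray (z, c) -> c <= q z.
Proof. by move=> [s s0 [-> ->]]; rewrite sq.2. Qed.

Definition face_step := cone_inf q ray.

Lemma face_step_sublinear : sublinear face_step.
Proof. exact: cone_inf_sublinear. Qed.

Lemma face_step_dominated : dominated face_step q.
Proof. exact: cone_inf_dominated. Qed.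

Lemma face_step_opp : face_step (- x) <= - q x.
Proof.
apply: cone_inf_opp => //; exists 1 => //.
by rewrite rmorph1 scale1r mul1r.
Qed.

(** Both functionals are at most q x at x, while their convex combination is at least q x there;
    hence both attain q x. *)
Lemma face_step_facial : facial p q -> facial p face_step.
Proof.
move=> fpq phi psi t lphi lpsi phip psip t01 h.
have [phiq psiq] : dominated phi q /\ dominated psi q.
  apply: (fpq phi psi t) => // v; apply: le_trans (face_step_dominated v).
  exact: h.
have := le_trans (h (- x)) face_step_opp; rewrite !real_linearN // => hx.
have /andP[t0 t1] := t01; have := phiq x; have := psiq x => psix phix.
have {hx} [ephi epsi] : phi x = q x /\ psi x = q x by split; nra.
suff aux f : real_linear f -> dominated f q -> f x = q x ->
    dominated f face_step by split; apply: aux.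
move=> lf fq fx v; apply: le_cone_inf => // z c [s s0 [-> ->]].
by have := fq (v + rs s *: x); rewrite lf.1 lf.2 fx; lra.
Qed.

End FaceStep.

(* The minimal sublinear functionals are the linear ones; as faces of faces   *)
(* are faces, a minimal facial functional is an extreme linear functional.    *)
Theorem extreme_dominated p q : sublinear q -> facial p q ->
  exists phi, [/\ real_linear phi, dominated phi q & facial p phi].
Proof.
move=> sq fpq.
pose T := {f : V -> R | [/\ sublinear f, dominated f q & facial p f]}.
have q0 : [/\ sublinear q, dominated q q & facial p q] by split=> // v.
(* The order is reversed: a maximal element for [le] is a pointwise minimal functional. *)
pose le (f g : T) := `[< dominated (sval g) (sval f) >].
have [|||[f [sf fq pf]] fmin] := @ZL_preorder T (exist _ q q0) le.
- by move=> f; apply/asboolP => v.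
- move=> f g h /asboolP fg /asboolP gh; apply/asboolP => v.
  exact: le_trans (gh v) (fg v).
- move=> A Atot.
  have [->|/set0P[f0 Af0]] := eqVneq A set0; first by exists (exist _ q q0).
  (* The pointwise infimum bounds the chain. It is subadditive because, of two members of the chain,
     the smaller one serves for both arguments. *)
  pose m v := inf [set sval f v | f in A].
  have m_le f v : A f -> m v <= sval f v.
    move=> Af; apply: inf_le; last by exists f.
    exists (- q (- v)) => _ [[g [sg gq pg]] Ag <-] /=.
    apply: le_trans (sublinear_opp v sg); rewrite lerN2; exact: gq.
  have le_m c v : (forall f, A f -> c <= sval f v) -> c <= m v.
    move=> h; apply: lb_le_inf; first by exists (sval f0 v), f0.
    by move=> _ [f Af <-]; apply: h.
  have sm : sublinear m.
    apply: sublinear_intro => [|u v|r v r0].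
    + apply/eqP; rewrite eq_le; apply/andP; split.
        by apply: le_trans (m_le _ _ Af0) _; case: (svalP f0) => /sublinear0 ->.
      by apply: le_m => f _; case: (svalP f) => /sublinear0 ->.
    + rewrite -lerBlDr; apply: (le_m) => f Af; rewrite lerBlDr [leRHS]addrC -lerBlDr.
      apply: le_m => g Ag; rewrite lerBlDr [leRHS]addrC.
      have [/asboolP gf|/asboolP fg] := Atot f g Af Ag.
        apply: le_trans (m_le _ _ Ag) _; case: (svalP g) => -[gD _] _ _.
        by apply: le_trans (gD _ _) _; rewrite lerD2r; apply: gf.
      apply: le_trans (m_le _ _ Af) _; case: (svalP f) => -[fD _] _ _.
      by apply: le_trans (fD _ _) _; rewrite lerD2l; apply: fg.
    + rewrite mulrC -ler_pdivrMr //; apply: le_m => f Af; rewrite ler_pdivrMr //.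
      apply: le_trans (m_le _ _ Af) _; case: (svalP f) => -[_ ->] //.
        by rewrite mulrC.
      exact: ltW.
  have mq : dominated m q.
    move=> v; apply: le_trans (m_le _ _ Af0) _.
    by case: (svalP f0) => _ + _; apply.
  have pm : facial p m.
    move=> phi psi t lphi lpsi phip psip t01 h.
    have aux f : A f -> dominated phi (sval f) /\ dominated psi (sval f).
      move=> Af; case: (svalP f) => _ _ /(_ phi psi t); apply=> // v.
      exact: le_trans (h v) (m_le _ _ Af).
    by split=> v; apply: le_m => f /aux[h1 h2]; [apply: h1 | apply: h2].
  exists (exist _ m (And3 sm mq pm)) => f Af; apply/asboolP => v.
  exact: m_le.
(* Minimality of f, compared with [face_step f x], gives f (- x) <= - f x; an odd sublinear
   functional is linear. *)
have fopp x : f (- x) = - f x.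
  apply/eqP; rewrite eq_le; apply/andP; split; last first.
    by rewrite lerNl; apply: sublinear_opp.
  apply: le_trans (face_step_opp x sf).
  have H : [/\ sublinear (face_step f x), dominated (face_step f x) q &
      facial p (face_step f x)].
    split; [exact: face_step_sublinear| |exact: face_step_facial].
    by move=> v; apply: le_trans (fq v); apply: face_step_dominated.
  have fH : le (exist _ f (And3 sf fq pf)) (exist _ _ H).
    by apply/asboolP => v; apply: face_step_dominated.
  by have /asboolP h := fmin _ fH; apply: h.
exists f; split=> //; split=> [u v|r v].
  apply/eqP; rewrite eq_le sf.1 /= -[leRHS]opprK -fopp opprD.
  by rewrite lerNr (le_trans (sf.1 _ _)) // !fopp opprD.
have [r0|r0] := leP 0 r; first exact: sf.2.
rewrite -[r in LHS]opprK rmorphN scaleNr fopp sf.2 ?mulNr ?opprK //.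
by rewrite oppr_ge0 ltW.
Qed.

Corollary exists_dominated q : sublinear q ->
  exists2 phi, real_linear phi & dominated phi q.
Proof.
by move=> sq; have [phi [? ? _]] := extreme_dominated sq (@facial_refl q);
  exists phi.
Qed.

(** The functionals attaining p x at x form the face cut out by [face_step], and an extreme
    functional of this face is extreme for p. *)
Lemma dominated_attains p x : sublinear p ->
  exists phi, [/\ real_linear phi, dominated phi p, phi x = p x & facial p phi].
Proof.
move=> sp.
have [phi [lphi phip fphi]] := extreme_dominated (face_step_sublinear x sp)
  (face_step_facial (x := x) sp (@facial_refl p)).
have phip' : dominated phi p.
  by move=> v; apply: le_trans (phip v) (face_step_dominated _ sp _).
exists phi; split=> //; apply/eqP; rewrite eq_le phip' /= -lerN2.
by rewrite -real_linearN // (le_trans (phip _)) // face_step_opp.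
Qed.

End RealFunctionals.

(** * Dual balls *)

Lemma linear_add (K : numFieldType) (V W : lmodType K) (f : V -> W) :
  linear f -> forall u v, f (u + v) = f u + f v.
Proof. by move=> lf u v; have := lf 1 u v; rewrite !scale1r. Qed.

Lemma linear_zero (K : numFieldType) (V W : lmodType K) (f : V -> W) :
  linear f -> f 0 = 0.
Proof.
move=> lf; have := linear_add lf 0 0; rewrite addr0.
by move=> /eqP; rewrite -subr_eq subrr => /eqP <-.
Qed.

Lemma linear_scale (K : numFieldType) (V W : lmodType K) (f : V -> W) :
  linear f -> forall a v, f (a *: v) = a *: f v.
Proof. by move=> lf a v; have := lf a v 0; rewrite (linear_zero lf) !addr0. Qed.

Lemma linear_opp (K : numFieldType) (V W : lmodType K) (f : V -> W) :
  linear f -> forall v, f (- v) = - f v.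
Proof. by move=> lf v; rewrite -scaleN1r (linear_scale lf) scaleN1r. Qed.

Lemma linear_sub (K : numFieldType) (V W : lmodType K) (f : V -> W) :
  linear f -> forall u v, f (u - v) = f u - f v.
Proof. by move=> lf u v; rewrite (linear_add lf) (linear_opp lf). Qed.

Section Duality.
Local Open Scope complex_scope.
Variables (R : realType) (K : numFieldType) (k : real_or_complex R K).
Local Notation rs := (scalar_of_real k).
Local Notation re := (scalar_re k).
Local Notation rabs a := (scalar_re k `|(a : K)|).
Local Notation rn := (rnorm k).

Lemma re_linear (V : lmodType K) (f : V -> K^o) :
  linear f -> real_linear k (fun v => re (f v)).
Proof.
move=> lf; split=> [u v|r v]; first by rewrite (linear_add lf) raddfD.
by rewrite (linear_scale lf) /GRing.scale /= scalar_reZ.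
Qed.

(** Over the complex numbers, f v = phi v - i phi (i v). *)
Lemma linear_of_re (V : lmodType K) (phi : V -> R) : real_linear k phi ->
  exists2 f : V -> K^o, linear f & forall v, re (f v) = phi v.
Proof.
case: K / k V phi => [|] V phi [pD pZ].
  by exists phi => // a u v; rewrite pD pZ.
exists (fun v => phi v +i* (- phi ('i%C *: v))) => // a u v.
have iZ (b : R[i]) w : phi (b *: w) = complex.Re b * phi w + complex.Im b * phi ('i%C *: w).
  rewrite [in LHS](complexE b) scalerDl pD -!pZ; congr (_ + phi _).
  by rewrite mulrC -scalerA.
rewrite scalerDr !pD scalerA (iZ a u) (iZ ('i%C * a) u).
case: a => a b; rewrite /GRing.scale /=; congr (_ +i* _); simpc; rewrite /=.
- ring.
- ring.
Qed.

Lemma re_inj (V : lmodType K) (f g : V -> K^o) : linear f -> linear g ->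
  (forall v, re (f v) = re (g v)) -> f = g.
Proof.
move=> lf lg h; apply/funext => v; apply/eqP; rewrite -subr_eq0 -normr_eq0.
have [w w1 wE] := unit_scalar_align (f v - g v : K).
have := h (w *: v); rewrite (linear_scale lf) (linear_scale lg) => /eqP.
rewrite -subr_eq0 -raddfB -scalerBr /GRing.scale /= wE => /eqP h0.
by rewrite -(rabsK k) h0 rmorph0.
Qed.

Lemma rabs_le (V : normedModType K) (f : V -> K^o) (L : R) : linear f ->
  (forall v, re (f v) <= L * rn v) -> forall v, rabs (f v) <= L * rn v.
Proof.
move=> lf h v; have [w w1 wE] := unit_scalar_align (f v : K).
by have := h (w *: v); rewrite (linear_scale lf) rnorm_unitZ // /GRing.scale /= wE.
Qed.

Lemma re_eq_rabs (a : K) : re a = rabs a -> a = `|a|.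
Proof.
move=> h; suff : 0 <= a by move=> a0; rewrite ger0_norm.
move: a h; case: K / k => [a /= -> //|[a b]].
have -> : `|a +i* b| = (Num.sqrt (a ^+ 2 + b ^+ 2))%:C by exact: normc_def.
move=> /= aE; have a0 : 0 <= a by rewrite aE sqrtr_ge0.
move: aE => /(congr1 (fun x => x ^+ 2)); rewrite sqr_sqrtr; last first.
  by rewrite addr_ge0 ?sqr_ge0.
move=> /eqP; rewrite -subr_eq0 opprD addrA subrr sub0r oppr_eq0 sqrf_eq0.
by move=> /eqP ->; rewrite lecE /= eqxx.
Qed.

Section Operators.
Variables V W : normedModType K.
Implicit Types f g : V -> W.

Lemma bounded_operatorP f : bounded_operator f <->
  linear f /\ exists2 L : R, 0 <= L & forall v, rn (f v) <= L * rn v.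
Proof.
split=> -[lf].
  move=> cf; split=> //; have /(cvg_rnorm k) := cf 0 => /(_ 1 ltr01).
  rewrite -nbhs_ballE => -[d /= d0 dB].
  (* A nonzero v is rescaled to half the radius d, whence the factor 2. *)
  exists (2 / re d); first by rewrite divr_ge0 // ltW // scalar_re_gt0.
  have rd0 := scalar_re_gt0 k d0.
  move=> v; have [->|v0] := eqVneq v 0.
    by rewrite (linear_zero lf) !rnorm0 mulr0.
  have nv : 0 < rn v by rewrite rnorm_gt0.
  have := dB (rs (re d / (2 * rn v)) *: v).
  rewrite -ball_normE /ball_ /= sub0r normrN => h.
  have : `|rs (re d / (2 * rn v)) *: v| < d.
    rewrite -(rnormK k) rnorm_realZ ger0_norm; last first.
      by rewrite divr_ge0 ?mulr_ge0 // ltW.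
    rewrite -[ltRHS](scalar_of_reK k (ltW d0)) scalar_of_real_lt.
    rewrite invfM mulrA mulfVK ?gt_eqF // ltr_pdivrMr //; lra.
  move=> /h; rewrite (linear_scale lf) (linear_zero lf) subr0 rnorm_realZ.
  rewrite ger0_norm; last by rewrite divr_ge0 ?mulr_ge0 // ltW.
  rewrite mulrAC ltr_pdivrMr ?mulr_gt0 // mul1r => {}h.
  rewrite -(ler_pM2l rd0) (le_trans (ltW h)) // le_eqVlt; apply/orP; left.
  by apply/eqP; field; rewrite gt_eqF.
move=> [L L0 h]; split=> // x; apply: (cvg_rnorm k f (f x)).1 => e e0.
near=> y; rewrite -(linear_sub lf).
apply: le_lt_trans (h _) _.
have : rn (y - x) < e / (L + 1).
  near: y; apply: ((cvg_rnorm k (fun y : V => y) x).2 cvg_id).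
  by rewrite divr_gt0 // ltr_wpDl.
rewrite ltr_pdivlMr ?ltr_wpDl // => h1; apply: le_lt_trans h1.
have := rnorm_ge0 k (y - x); nra.
Unshelve. all: by end_near. Qed.

Lemma opnorm_has_sup f : bounded_operator f ->
  has_sup [set rn (f x) | x in unit_ball k V].
Proof.
move=> /bounded_operatorP[lf [L L0 h]]; split.
  by exists (rn (f 0)), 0 => //; rewrite /unit_ball /= rnorm0.
exists L => _ [x x1 <-]; apply: le_trans (h x) _.
by rewrite -[leRHS]mulr1 ler_wpM2l.
Qed.

Lemma opnorm_ball f x : bounded_operator f -> unit_ball k V x ->
  rn (f x) <= opnorm k f.
Proof. by move=> /opnorm_has_sup bf x1; apply: sup_upper_bound => //; exists x. Qed.

Lemma opnorm_ge0 f : bounded_operator f -> 0 <= opnorm k f.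
Proof.
move=> bf; apply: le_trans (rnorm_ge0 k (f 0)) (opnorm_ball bf _).
by rewrite /unit_ball /= rnorm0.
Qed.

Lemma opnorm_bound f x : bounded_operator f -> rn (f x) <= opnorm k f * rn x.
Proof.
move=> bf; have lf := bf.1; have [->|x0] := eqVneq x 0.
  by rewrite (linear_zero lf) !rnorm0 mulr0.
have nx : 0 < rn x by rewrite rnorm_gt0.
have := opnorm_ball (x := rs (rn x)^-1 *: x) bf.
rewrite /unit_ball /= rnorm_normalize // => /(_ (lexx _)).
rewrite (linear_scale lf) rnorm_realZ gtr0_norm ?invr_gt0 //.
by rewrite mulrC ler_pdivrMr.
Qed.

Lemma opnorm_le f c : (forall x, unit_ball k V x -> rn (f x) <= c) ->
  opnorm k f <= c.
Proof.
move=> h; apply: ge_sup => [|_ [x x1 <-]]; last exact: h.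
by exists (rn (f 0)), 0 => //; rewrite /unit_ball /= rnorm0.
Qed.

Lemma opnorm_near f (e : R) : bounded_operator f -> 0 < e ->
  exists2 x, unit_ball k V x & opnorm k f - e < rn (f x).
Proof.
move=> /opnorm_has_sup bf e0; have [_ [x x1 <-] h] := sup_adherent e0 bf.
by exists x.
Qed.

Lemma bounded_operatorDZ f g a : bounded_operator f -> bounded_operator g ->
  bounded_operator (f + a *: g).
Proof.
move=> bf bg; apply/bounded_operatorP; split.
  move=> b u v; rewrite !fctE bf.1 bg.1 !scalerDr !scalerA addrACA.
  by rewrite (mulrC b a).
exists (opnorm k f + rabs a * opnorm k g) => [|v].
  by rewrite addr_ge0 ?mulr_ge0 ?opnorm_ge0 // rabs_ge0.
rewrite !fctE (le_trans (rnormD _ _ _)) // mulrDl lerD ?opnorm_bound //.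
by rewrite rnormZ -mulrA ler_wpM2l ?rabs_ge0 // opnorm_bound.
Qed.

End Operators.

Section DualBall.
Variable V : normedModType K.
Implicit Types (f g : V -> K^o) (x : V).

Lemma dual_ballP f :
  dual_ball k V f <-> linear f /\ forall v, rabs (f v) <= rn v.
Proof.
split=> [[bf f1]|[lf h]].
  split=> [|v]; first exact: bf.1.
  rewrite -rnorm_scalar (le_trans (opnorm_bound _ bf)) // -[leRHS]mul1r.
  by rewrite ler_wpM2r // rnorm_ge0.
split; last by apply: opnorm_le => x x1; apply: le_trans (h x) x1.
apply/bounded_operatorP; split=> //; exists 1 => // v.
by rewrite mul1r; apply: h.
Qed.

Lemma dual_ball_re f :
  dual_ball k V f <-> linear f /\ forall v, re (f v) <= rn v.
Proof.
split=> [/dual_ballP[lf h]|[lf h]].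
  by split=> // v; apply: le_trans (scalar_re_le _ _) (h v).
apply/dual_ballP; split=> // v; rewrite -[leRHS]mul1r.
by apply: (rabs_le lf) => {}v; rewrite mul1r.
Qed.

Lemma rnorm_sublinear : sublinear k (@rnorm R K k V).
Proof.
split=> [u v|r v r0]; first exact: rnormD.
by rewrite rnorm_realZ ger0_norm.
Qed.

(** Substitute for the Krein-Milman theorem: [dominated_attains] gives a real functional phi
    supporting the norm at x and extreme below the norm. If f = t g + (1 - t) h in the dual ball,
    then re g and re h lie below phi, and a linear functional below a linear one equals it. *)
Lemma extreme_attains x :
  exists2 f, extreme_points (dual_ball k V) f & re (f x) = rn x.
Proof.
have [phi [lphi phin phix fphi]] := dominated_attains x rnorm_sublinear.
have [f lf fE] := linear_of_re lphi.
exists f; last by rewrite fE.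
split; first by apply/dual_ball_re; split=> // v; rewrite fE.
move=> g h t /dual_ball_re[lg gn] /dual_ball_re[lh hn] /andP[t0 t1] fgh.
have tE : rs (re t) = t by rewrite scalar_of_reK // ltW.
have t01 : 0 < re t < 1.
  by rewrite -(scalar_of_real_gt0 k) -(scalar_of_real_lt k) tE rmorph1 t0.
have [v|gphi hphi] :=
    fphi _ _ _ (re_linear lg) (re_linear lh) gn hn t01.
  rewrite -fE fgh !fctE raddfD /= /GRing.scale /= -tE -(rmorph1 rs) -rmorphB.
  by rewrite !scalar_reZ scalar_reK.
have eqf (e : V -> K^o) : linear e -> dominated (fun v => re (e v)) phi -> e = f.
  move=> le ephi; apply: re_inj => // v; apply/eqP.
  rewrite eq_le fE ephi /= -lerN2 -(real_linearN _ lphi).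
  by rewrite -(real_linearN _ (re_linear le)) ephi.
by split; apply: eqf.
Qed.

(* The infimum over t >= 0 and w in W of |v + t w| - t r is a sublinear       *)
(* functional taking values <= - r on - W.                                    *)
Lemma separation (W : set V) (r : R) : 0 <= r ->
  (forall u v (t : R), W u -> W v -> 0 <= t <= 1 ->
     W (rs t *: u + rs (1 - t) *: v)) ->
  (forall w, W w -> r <= rn w) ->
  exists f, dual_ball k V f /\ forall w, W w -> r <= re (f w).
Proof.
move=> r0 Wc Wr.
pose Z : set (V * R) := [set zc | zc = (0, 0) \/
  exists (t : R) w, [/\ 0 < t, W w & zc = (rs t *: w, t * r)]].
have Z0 : Z (0, 0) by left.
have ZD z z' c c' : Z (z, c) -> Z (z', c') -> Z (z + z', c + c').
  move=> [[-> ->]|[t [w [t0 Ww [-> ->]]]]]; first by rewrite !add0r.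
  move=> [[-> ->]|[s [u [s0 Wu [-> ->]]]]].
    by rewrite !addr0; right; exists t, w.
  (* The vector t w + s u is t + s times a convex combination of w and u. *)
  right; exists (t + s), (rs (t / (t + s)) *: w + rs (1 - t / (t + s)) *: u).
  have ts0 : 0 < t + s by rewrite addr_gt0.
  split=> //; last first.
    rewrite scalerDr !scalerA -!rmorphM -mulrDl; congr (_, _).
    by congr (rs _ *: _ + rs _ *: _); field; rewrite gt_eqF.
  apply: Wc => //; rewrite divr_ge0 ?ltW //= ltr_pdivrMr // mul1r.
  by rewrite ltrDl.
have ZZ s z c : 0 < s -> Z (z, c) -> Z (rs s *: z, s * c).
  move=> s0 [[-> ->]|[t [w [t0 Ww [-> ->]]]]].
    by left; rewrite scaler0 mulr0.
  by right; exists (s * t), w; rewrite mulr_gt0 // scalerA rmorphM mulrA.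
have Zq z c : Z (z, c) -> c <= rn z.
  move=> [[-> ->]|[t [w [t0 Ww [-> ->]]]]]; first by rewrite rnorm0.
  by rewrite rnorm_realZ gtr0_norm // ler_pM2l // Wr.
have sn := rnorm_sublinear.
have [phi lphi phiq] := exists_dominated (cone_inf_sublinear sn Z0 ZD ZZ Zq).
have [f lf fE] := linear_of_re lphi.
exists f; split.
  apply/dual_ball_re; split=> // v; rewrite fE.
  exact: le_trans (phiq v) (cone_inf_dominated sn Z0 Zq v).
move=> w Ww; rewrite fE -lerN2 -(real_linearN _ lphi).
apply: le_trans (phiq _) _; apply: (cone_inf_opp sn Zq).
by right; exists 1, w; rewrite rmorph1 scale1r mul1r.
Qed.

End DualBall.
End Duality.

(** * Spear vectors and extreme functionals *)

Lemma sup_near (R : realType) (E : set R) (c : R) : (forall y, E y -> y <= c) ->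
  (forall e, 0 < e -> exists2 y, E y & c - e < y) -> sup E = c.
Proof.
move=> Ec near; have [y0 Ey0 _] := near 1 ltr01.
apply/eqP; rewrite eq_le ge_sup //=; last by exists y0.
apply/ler_addgt0Pr => e /near[y Ey cy].
rewrite -lerBlDr (le_trans (ltW cy)) // sup_upper_bound //.
by split; [exists y0 | exists c].
Qed.

Section Spear.
Local Open Scope complex_scope.
Variables (R : realType) (K : numFieldType) (k : real_or_complex R K).
Local Notation rs := (scalar_of_real k).
Local Notation re := (scalar_re k).
Local Notation rabs a := (scalar_re k `|(a : K)|).
Local Notation rn := (rnorm k).

(** Rounding towards zero on the grid of step 1 / N: the modulus must not grow, so that points
    rounded from the circle stay in the unit disc. *)
Lemma real_truncation (N : nat) (a : R) : (0 < N)%N -> `|a| <= 1 ->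
  exists2 b : bool * 'I_N.+1, `|(-1) ^+ b.1 * (b.2%:R / N%:R)| <= `|a| &
    `|a - (-1) ^+ b.1 * (b.2%:R / N%:R)| <= N%:R^-1.
Proof.
move=> N0 a1; have N0' : 0 < N%:R :> R by rewrite ltr0n.
have aN : 0 <= `|a| * N%:R by rewrite mulr_ge0.
have /andP[lo hi] := truncn_itv aN.
have tN : (Num.truncn (`|a| * N%:R) < N.+1)%N.
  rewrite ltnS -(ler_nat R) (le_trans lo) // -[leRHS]mul1r.
  by rewrite ler_wpM2r // ltW.
exists (a < 0, Ordinal tN) => /=.
  rewrite normrM normrX normrN1 expr1n mul1r ger0_norm ?divr_ge0 //.
  by rewrite ler_pdivrMr.
rewrite [X in `|X - _|]numEsign -mulrBr normrM normrX normrN1 expr1n mul1r.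
rewrite ger0_norm; last by rewrite subr_ge0 ler_pdivrMr.
rewrite lerBlDr -(ler_pM2r N0') mulrDl mulVf ?gt_eqF // mulfVK ?gt_eqF //.
by rewrite -[1](mulr1n) addrC natr1 ltW.
Qed.

(** The net has to lie in the closed unit disc only, so a finite square grid suffices in the complex
    case. *)
Lemma unit_scalars_net (e : R) : 0 < e ->
  exists (I : finType) (w : I -> K), (forall i, rabs (w i) <= 1) /\
    forall w0, unit_scalars K w0 -> exists i, rabs (w0 - w i) <= e.
Proof.
move=> e0; case: K / k => [|].
  exists bool, (fun b => if b then 1 else -1); split=> [[]|w0] /=.
  - by rewrite normr1.
  - by rewrite normrN1.
  rewrite /unit_scalars /= => w01; exists (0 <= w0).
  have [w0p|w0n] := leP 0 w0.
    by move: w01; rewrite ger0_norm // => ->; rewrite subrr normr0 ltW.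
  move: w01; rewrite ltr0_norm // opprK => w01.
  by rewrite -[w0]opprK w01 addrC subrr normr0 ltW.
have absE (a b : R) :
    scalar_re (ComplexScalars R) `|a +i* b : R[i]| = Num.sqrt (a ^+ 2 + b ^+ 2).
  have -> : `|a +i* b| = (Num.sqrt (a ^+ 2 + b ^+ 2))%:C by exact: normc_def.
  by [].
pose N := (Num.truncn (2 / e)).+1.
have N0 : (0 < N)%N by [].
have N0' : 0 < N%:R :> R by rewrite ltr0n.
have Ne : 2 * N%:R^-1 <= e.
  rewrite ler_pdivrMr // mulrC -ler_pdivrMr // ltW //.
  exact: truncnS_gt.
pose v (b : bool * 'I_N.+1) : R := (-1) ^+ b.1 * (b.2%:R / N%:R).
(* Grid points outside the disc are sent to 0; those rounded from the circle are unaffected. *)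
pose w (i : (bool * 'I_N.+1) * (bool * 'I_N.+1)) : R[i] :=
  if scalar_re (ComplexScalars R) `|v i.1 +i* v i.2| <= 1
  then v i.1 +i* v i.2 else 0.
exists _, w; split=> [i|[a b]].
  by rewrite /w; case: ifP => // _; rewrite normr0.
rewrite /unit_scalars /= => /(congr1 (scalar_re (ComplexScalars R))).
rewrite absE /= => ab1.
have ab : a ^+ 2 + b ^+ 2 = 1.
  rewrite -[LHS]sqr_sqrtr ?ab1 ?expr1n //.
  by rewrite addr_ge0 ?sqr_ge0.
have le1 (c d : R) : c ^+ 2 + d ^+ 2 = 1 -> `|c| <= 1.
  move=> cd; rewrite -(@ler_pXn2r _ 2) ?nnegrE // expr1n -normrX.
  by rewrite ger0_norm ?sqr_ge0 // -cd lerDl sqr_ge0.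
have [i1 i1a i1n] := real_truncation N0 (le1 _ _ ab).
have [i2 i2b i2n] := real_truncation N0 (le1 b a (etrans (addrC _ _) ab)).
exists (i1, i2).
have sq (c d : R) : `|c| <= `|d| -> c ^+ 2 <= d ^+ 2.
  by move=> cd; rewrite -[leLHS]real_normK ?num_real // -[leRHS]real_normK
    ?num_real // lerXn2r ?nnegrE.
have -> : w (i1, i2) = v i1 +i* v i2.
  rewrite /w ifT // -[(i1, i2).1]/i1 -[(i1, i2).2]/i2 absE -[leRHS]sqrtr1.
  by rewrite ler_wsqrtr // -ab; apply: lerD; apply: sq.
change (scalar_re (ComplexScalars R) `|(a - v i1) +i* (b - v i2) : R[i]| <= e).
rewrite absE (le_trans _ Ne) //.
rewrite -[leRHS]ger0_norm ?mulr_ge0 ?invr_ge0 // -sqrtr_sqr ler_wsqrtr //.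
have h (c : R) : `|c| <= N%:R^-1 -> c ^+ 2 <= N%:R^-1 ^+ 2.
  by move=> cN; apply: sq; rewrite (le_trans cN) // ler_norm.
have := h _ i1n; have := h _ i2n; rewrite /v; have := sqr_ge0 (N%:R^-1 : R).
lra.
Qed.

Variable V : normedModType K.
Implicit Types (f g : V -> K^o) (x y z : V).

(** The last hypothesis says that the norms of A and B add up to at most 1. With t the norm of A, f
    is the convex combination of A / t and B / (1 - t) with weights t and 1 - t, both in the dual
    ball, so extremality gives A / t = re f. For t = 0 or t = 1 one of A, B vanishes. *)
Lemma extreme_split f (A B : V -> R) :
  extreme_points (dual_ball k V) f -> real_linear k A -> real_linear k B ->
  (forall y, A y + B y = re (f y)) ->
  (forall y y', A y + B y' <= Num.max (rn y) (rn y')) ->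
  exists t : R, 0 <= t /\ forall y, A y = t * re (f y).
Proof.
move=> [df fext] lA lB AB ABn.
have ball0 : unit_ball k V 0 by rewrite /unit_ball /= rnorm0.
pose E := [set A y | y in unit_ball k V]; pose t := sup E.
have A1 y : unit_ball k V y -> A y <= 1.
  move=> y1; have := ABn y 0; rewrite (real_linear0 lB) addr0 rnorm0.
  by move=> /le_trans; apply; rewrite ge_max y1 ler01.
have supE : has_sup E.
  by split; [exists (A 0), 0 | exists 1 => _ [y /A1 ? <-]].
have At y : unit_ball k V y -> A y <= t.
  by move=> y1; apply: sup_upper_bound => //; exists y.
have t0 : 0 <= t by rewrite -(real_linear0 lA) At.
have Bt y : unit_ball k V y -> B y <= 1 - t.
  move=> y1; rewrite lerBrDl -lerBrDr; apply: ge_sup; first by case: supE.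
  move=> _ [y' y'1 <-]; rewrite lerBrDr (le_trans (ABn _ _)) //.
  by rewrite ge_max; apply/andP.
have t1 : t <= 1 by rewrite -subr_ge0 -(real_linear0 lB) Bt.
have scale (C : V -> R) c : real_linear k C ->
    (forall y, unit_ball k V y -> C y <= c) -> forall y, C y <= c * rn y.
  move=> lC h y; have [->|y0] := eqVneq y 0.
    by rewrite rnorm0 mulr0 (real_linear0 lC).
  have ny : 0 < rn y by rewrite rnorm_gt0.
  have := h (rs (rn y)^-1 *: y); rewrite /unit_ball /= rnorm_normalize //.
  by move=> /(_ (lexx _)); rewrite lC.2 mulrC ler_pdivrMr.
have zero (C : V -> R) : real_linear k C ->
    (forall y, unit_ball k V y -> C y <= 0) -> forall y, C y = 0.
  move=> lC /(scale _ _ lC) h y; apply/eqP; rewrite eq_le.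
  have := h y; have := h (- y); rewrite (real_linearN _ lC) !mul0r oppr_le0.
  by move=> -> ->.
exists t; split=> // y.
have [t0'|t0'] := eqVneq t 0.
  by rewrite t0' mul0r; apply: zero => // {}y /At; rewrite t0'.
have [t1'|t1'] := eqVneq t 1.
  rewrite t1' mul1r -AB (zero _ lB) ?addr0 // => {}y /Bt.
  by rewrite t1' subrr.
have {}t0 : 0 < t by rewrite lt_neqAle eq_sym t0'.
have {}t1 : 0 < 1 - t by rewrite subr_gt0 lt_neqAle t1'.
have mk (C : V -> R) c : 0 < c -> real_linear k C ->
    (forall y, unit_ball k V y -> C y <= c) ->
    exists2 g, dual_ball k V g & forall y, re (g y) = c^-1 * C y.
  move=> c0 lC Cc.
  have lcC : real_linear k (fun y => c^-1 * C y).
    by split=> [u v|r v]; rewrite ?lC.1 ?lC.2 ?mulrDr // mulrCA.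
  have [g lg gE] := linear_of_re lcC.
  exists g => //; apply/dual_ball_re; split=> // v; rewrite gE.
  by rewrite mulrC ler_pdivrMr // mulrC scale.
have [g dg gE] := mk A t t0 lA At.
have [h dh hE] := mk B (1 - t) t1 lB Bt.
have [] := fext g h (rs t) dg dh.
- by rewrite scalar_of_real_gt0 t0 -(rmorph1 rs) scalar_of_real_lt -subr_gt0.
- have lg := (dual_ballP k g).1 dg; have lh := (dual_ballP k h).1 dh.
  have lf := (dual_ballP k f).1 df.
  apply: (@re_inj _ _ k) => [|a u v|v]; first exact: lf.1.
    rewrite !fctE lg.1 lh.1 !scalerDr addrACA !scalerA.
    by rewrite (mulrC (rs t)) (mulrC (1 - rs t)).
  rewrite !fctE raddfD /= -(rmorph1 rs) -rmorphB /GRing.scale /=.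
  by rewrite !scalar_reZ gE hE !mulVKf ?gt_eqF.
by move=> gf _; rewrite -gf gE mulVKf ?gt_eqF.
Qed.

Lemma spear_near z x (e : R) : spear_vector k z -> 0 < e ->
  exists2 w, unit_scalars K w & 1 + rn x - e < rn (z + w *: x).
Proof.
move=> [z1 zs] e0.
have supE : has_sup [set rn (z + w *: x) | w in unit_scalars K].
  split; first by exists (rn (z + 1 *: x)), 1 => //; exact: unit_scalar1.
  exists (1 + rn x) => _ [w w1 <-]; rewrite (le_trans (rnormD _ _ _)) //.
  by rewrite rnorm_unitZ // lerD2r z1.
have [_ [w w1 <-] h] := sup_adherent e0 supE.
by exists w => //; rewrite -zs.
Qed.

(* Distribute f over a finite net (w i) of the unit circle: f extends to a    *)
(* functional F on V^I dominated by the maximum norm with F (i |-> w i z)     *)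
(* close to 1, and extremality makes every component of F a multiple of f.    *)
Theorem spear_extreme z f : spear_vector k z ->
  extreme_points (dual_ball k V) f -> `|f z| = 1.
Proof.
move=> sz fext; have := fext.1 => /dual_ballP[lf fn].
apply: (@rabs_eq1 _ _ k); apply/eqP; rewrite eq_le.
rewrite (le_trans (fn z)) /=; last by rewrite (sz.1 : rn z = 1).
apply/ler_addgt0Pr => e' e'0; rewrite -lerBlDr.
(* Half of the error pays for nearly attaining the spear supremum, half for replacing a scalar by a
   point of the net. *)
pose e := e' / 2; have e0 : 0 < e by rewrite divr_gt0.
have [I [w [w1 wnet]]] := unit_scalars_net e0.
pose q (x : I -> V) := \big[Num.max/0]_i rn (x i).
have qle (x : I -> V) c : 0 <= c -> (forall i, rn (x i) <= c) -> q x <= c.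
  by move=> c0 h; apply/bigmax_leP; split.
have leq_q (x : I -> V) i : rn (x i) <= q x by exact: le_bigmax.
have q_ge0 (x : I -> V) : 0 <= q x by exact: bigmax_ge_id.
have sq : sublinear k (q : (I -> V) -> R).
  apply: sublinear_intro => [|u v|r v r0].
  - by apply/eqP; rewrite eq_le q_ge0 qle // => i; rewrite rnorm0.
  - rewrite qle ?addr_ge0 // => i.
    by rewrite (le_trans (rnormD _ _ _)) // lerD.
  - rewrite qle ?mulr_ge0 ?(ltW r0) // => i.
    by rewrite [X in rn X]/(rs r *: v i) rnorm_realZ gtr0_norm // ler_pM2l.
(* Lower bounds imposed on F: re f on constant families, and 1 - e' at the family of the w i z. *)
pose Z : set ((I -> V) * R) := [set zc | exists y (s : R), 0 <= s /\
  zc = ((fun i => y + rs s *: (w i *: z)), re (f y) + s * (1 - e'))].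
have Z0 : Z (0, 0).
  exists 0, 0; split=> //; rewrite (linear_zero lf) !raddf0 mul0r addr0.
  by congr (_, _); apply/funext => i; rewrite scale0r addr0.
have ZD (y z' : I -> V) (c c' : R) : Z (y, c) -> Z (z', c') -> Z (y + z', c + c').
  move=> [u [s [s0 [-> ->]]]] [v [t [t0 [-> ->]]]].
  exists (u + v), (s + t); split; first exact: addr_ge0.
  rewrite (linear_add lf) !raddfD /=; congr (_, _); last by ring.
  by apply/funext => i; rewrite !fctE scalerDl addrACA.
have ZZ (r : R) (y : I -> V) (c : R) : 0 < r -> Z (y, c) -> Z (rs r *: y, r * c).
  move=> r0 [u [s [s0 [-> ->]]]]; exists (rs r *: u), (r * s).
  split; first by rewrite mulr_ge0 // ltW.
  rewrite (linear_scale lf) /GRing.scale /= scalar_reZ mulrDr mulrA.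
  congr (_, _); apply/funext => i.
  change (rs r *: (u + rs s *: (w i *: z)) =
    rs r *: u + rs (r * s) *: (w i *: z)).
  by rewrite scalerDr (scalerA (rs r)) rmorphM.
(* Here the spear property enters: |z + w0 u / s| is nearly 1 + |u| / s for some unit w0.
   Multiplying by s / w0 makes |u + s z / w0| large, and some net point is close to 1 / w0. *)
have Zq (y : I -> V) (c : R) : Z (y, c) -> c <= q y.
  move=> [u [s [s0 [-> ->]]]].
  have fu : re (f u) <= rn u by rewrite (le_trans (scalar_re_le _ _)).
  move: s0; rewrite le_eqVlt => /predU1P[<-|s0].
    (* For s = 0 only some index is needed; any unit scalar shows that the net is nonempty. *)
    have [w0 w01 _] := spear_near 0 sz ltr01.
    have [i _] := wnet _ w01.
    rewrite mul0r addr0 (le_trans fu) //; apply: le_trans (leq_q _ i).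
    by rewrite rmorph0 scale0r addr0.
  have [w0 w01 hw0] := spear_near (rs s^-1 *: u) sz e0.
  have [i wi] := wnet _ (unit_scalarV w01).
  apply: le_trans (leq_q _ i).
  have h1 : s + rn u - s * e <= rn (u + rs s *: (w0^-1 *: z)).
    have -> : u + rs s *: (w0^-1 *: z) =
        (rs s * w0^-1) *: (z + w0 *: (rs s^-1 *: u)).
      rewrite scalerDr addrC !scalerA; congr (_ + _).
      rewrite mulfVK ?unit_scalar_neq0 // -rmorphM.
      by rewrite divff ?gt_eqF // rmorph1 scale1r.
    rewrite rnormZ rabsM rabs_real gtr0_norm // (rabs_unit _ (unit_scalarV w01)).
    move: hw0; rewrite rnorm_realZ gtr0_norm ?invr_gt0 // mulr1 => /ltW.
    by rewrite -(ler_pM2l s0) mulrBr mulrDr mulr1 mulVKf ?gt_eqF.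
  have h2 : rn (u + rs s *: (w0^-1 *: z)) <=
      rn (u + rs s *: (w i *: z)) + s * e.
    have -> : u + rs s *: (w0^-1 *: z) =
        u + rs s *: (w i *: z) + rs s *: ((w0^-1 - w i) *: z).
      by rewrite -addrA -scalerDr scalerBl addrCA subrr addr0.
    rewrite (le_trans (rnormD _ _ _)) // lerD2l rnorm_realZ gtr0_norm //.
    by rewrite ler_pM2l // rnormZ (sz.1 : rn z = 1) mulr1.
  have -> : s * (1 - e') = s - s * e - s * e by rewrite /e; field.
  lra.
have [F lF Fq] := exists_dominated (cone_inf_sublinear sq Z0 ZD ZZ Zq).
have Fn (y : I -> V) : F y <= q y by exact: le_trans (Fq y) (cone_inf_dominated sq Z0 Zq y).
have FZ (y : I -> V) (c : R) : Z (y, c) -> c <= F y.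
  move=> Zyc; rewrite -lerN2 -(real_linearN _ lF).
  exact: le_trans (Fq _) (cone_inf_opp sq Zq Zyc).
have Fdiag y : F (fun=> y) = re (f y).
  have h u : re (f u) <= F (fun=> u).
    apply: FZ; exists u, 0; rewrite lexx mul0r addr0; split=> //.
    by congr (_, _); apply/funext => i; rewrite rmorph0 scale0r addr0.
  apply/eqP; rewrite eq_le h andbT -lerN2 -raddfN -(linear_opp lf).
  by rewrite -(real_linearN _ lF) (le_trans (h _)).
have Fe : 1 - e' <= F (fun i => w i *: z).
  apply: FZ; exists 0, 1; split=> //.
  rewrite (linear_zero lf) raddf0 mul1r add0r; congr (_, _).
  by apply/funext => i; rewrite rmorph1 scale1r add0r.
pose single i y : I -> V := fun j => if j == i then y else 0.
have singleD i u v : single i (u + v) = single i u + single i v.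
  by apply/funext => j; rewrite fctE /single; case: eqP; rewrite ?addr0.
have singleZ i r v : single i (rs r *: v) = rs r *: single i v.
  by apply/funext => j; rewrite fctE /single; case: eqP; rewrite ?scaler0.
have Fsum (x : I -> V) : F x = \sum_i F (single i (x i)).
  rewrite -(big_morph F lF.1 (real_linear0 lF)).
  congr (F _); apply/funext => j; rewrite fct_sumE (bigD1 j) //=.
  rewrite /single eqxx big1 ?addr0 // => i /negPf; rewrite eq_sym => -> //.
(* One component of F against the sum of the others: domination by the maximum norm is what
   [extreme_split] asks for. *)
have tP i : exists t : R, 0 <= t /\ forall y, F (single i y) = t * re (f y).
  apply: (extreme_split (B := fun y => re (f y) - F (single i y)) fext).
  - by split=> [u v|r v]; rewrite ?singleD ?singleZ ?lF.1 ?lF.2.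
  - have rf := re_linear k lf.
    split=> [u v|r v]; rewrite ?singleD ?singleZ ?lF.1 ?lF.2 ?rf.1 ?rf.2.
      by rewrite opprD addrACA.
    by rewrite mulrBr.
  - by move=> y; rewrite addrC subrK.
  move=> y y'; rewrite -Fdiag -(real_linearB _ _ lF) -lF.1.
  apply: le_trans (Fn _) _; apply: qle => [|j].
    by rewrite le_max rnorm_ge0.
  rewrite !fctE /single le_max; case: eqP => _.
    by rewrite subrr addr0 lexx.
  by rewrite add0r subr0 lexx orbT.
have [t tE] := choice tP.
have [u [u1 uE]] : exists u, unit_scalars K u /\ re (f (u *: z)) = rabs (f z).
  have [u u1 uE] := unit_scalar_align (f z : K).
  by exists u; split=> //; rewrite (linear_scale lf) /GRing.scale /= uE.
(* The weights t i are summed only after multiplication by |f z|, which might be 0. *)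
have tsum : rabs (f z) = \sum_i t i * rabs (f z).
  rewrite -{1}uE -Fdiag Fsum; apply: eq_bigr => i _.
  by rewrite (tE i).2 uE.
apply: le_trans Fe _; rewrite Fsum tsum; apply: ler_sum => i _.
rewrite (tE i).2 ler_wpM2l ?(tE i).1 // (le_trans (scalar_re_le _ _)) //.
rewrite (linear_scale lf) /GRing.scale /= rabsM -[leRHS]mul1r.
by rewrite ler_wpM2r // rabs_ge0.
Qed.

(** Take an extreme f norming x and rotate x by the scalar f z: the value of f at z + (f z) x has
    modulus |f z| (1 + |x|). Taking x = 0 gives |z| >= 1. *)
Theorem extreme_spear z : rn z <= 1 ->
  (forall f, extreme_points (dual_ball k V) f -> `|f z| = 1) ->
  spear_vector k z.
Proof.
move=> z1 h.
have far x : exists2 w, unit_scalars K w & 1 + rn x <= rn (z + w *: x).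
  have [f fext fx] := extreme_attains k x.
  have /dual_ballP[lf fn] := fext.1.
  exists (f z); first exact: h.
  have fxE : f x = rs (rn x).
    rewrite -fx; have : re (f x : K) = rabs (f x).
      by apply/eqP; rewrite eq_le scalar_re_le fx fn.
    by move=> /re_eq_rabs ->; rewrite scalar_of_reK.
  apply: le_trans (fn _); rewrite (linear_add lf) (linear_scale lf) fxE.
  rewrite /GRing.scale /= -[X in `|X + _|]mulr1 -mulrDr rabsM.
  rewrite (rabs_unit k (h _ fext)) mul1r -(rmorph1 rs) -rmorphD rabs_real.
  exact: ler_norm.
have {z1} z1 : rn z = 1.
  apply/eqP; rewrite eq_le z1 /=; have [w _] := far 0.
  by rewrite scaler0 addr0 rnorm0 addr0.
split=> // x; apply: sup_near => [_ [w w1 <-]|e e0].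
  by rewrite (le_trans (rnormD _ _ _)) // z1 rnorm_unitZ.
have [w w1 wx] := far x; exists (rn (z + w *: x)); first by exists w.
by rewrite (lt_le_trans _ wx) // gtrBl.
Qed.

End Spear.

(** * Lush, spear and alternative Daugavet operators *)

Section ConvexHulls.
Variables (R : realType) (K : numFieldType) (k : real_or_complex R K).
Local Notation rs := (scalar_of_real k).
Local Notation re := (scalar_re k).
Local Notation rabs a := (scalar_re k `|(a : K)|).
Local Notation rn := (rnorm k).

Lemma sub_conv (V : lmodType K) (A : set V) : A `<=` conv A.
Proof.
move=> x Ax; exists 1, (fun=> 1), (fun=> x); split=> //.
  by rewrite big_ord1.
by rewrite big_ord1 scale1r.
Qed.

Lemma conv_convex (V : lmodType K) (A : set V) u v (t : R) :
  conv A u -> conv A v -> 0 <= t <= 1 ->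
  conv A (rs t *: u + rs (1 - t) *: v).
Proof.
move=> [n [a [x [a0 a1 Ax ->]]]] [m [b [y [b0 b1 Ay ->]]]] /andP[t0 t1].
exists (n + m)%N,
  (fun i => match fintype.split i with
            | inl j => rs t * a j | inr j => rs (1 - t) * b j end),
  (fun i => match fintype.split i with inl j => x j | inr j => y j end).
have lK j : fintype.split (lshift m j : 'I_(n + m)) = inl j.
  exact: (unsplitK (inl j)).
have rK j : fintype.split (rshift n j : 'I_(n + m)) = inr j.
  exact: (unsplitK (inr j)).
split.
- move=> i; case: (fintype.split i) => j; rewrite mulr_ge0 //.
    by rewrite scalar_of_real_ge0.
  by rewrite scalar_of_real_ge0 subr_ge0.
- rewrite big_split_ord /=.
  under eq_bigr do rewrite lK.
  under [X in _ + X]eq_bigr do rewrite rK.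
  by rewrite -!mulr_sumr a1 b1 !mulr1 -rmorphD addrC subrK rmorph1.
- by move=> i; case: (fintype.split i).
- rewrite big_split_ord /= !scaler_sumr; congr (_ + _).
    by apply: eq_bigr => i _; rewrite lK scalerA.
  by apply: eq_bigr => i _; rewrite rK scalerA.
Qed.

(** Jensen's inequality; the weights are nonnegative elements of K, hence real. *)
Lemma conv_bound (V : lmodType K) (A : set V) (phi : V -> R) (c : R) :
  (forall u v, phi (u + v) <= phi u + phi v) ->
  (forall r v, 0 <= r -> phi (rs r *: v) <= r * phi v) ->
  (forall x, A x -> phi x <= c) -> forall x, conv A x -> phi x <= c.
Proof.
move=> phiD phiZ h _ [n [a [x [a0 a1 Ax ->]]]].
have phi0 : phi 0 <= 0 by rewrite -{1}(scaler0 _ (rs 0)) (le_trans (phiZ _ _ _)) ?mul0r.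
apply: (@le_trans _ _ (\sum_(i < n) re (a i) * c)); last first.
  by rewrite -mulr_suml -raddf_sum a1 -(rmorph1 rs) /= scalar_reK mul1r.
apply: (@le_trans _ _ (\sum_(i < n) phi (a i *: x i))).
  apply: (big_ind2 (fun u (s : R) => phi u <= s)) => // u s v t us vt.
  by rewrite (le_trans (phiD _ _)) // lerD.
apply: ler_sum => i _; rewrite -{1}(scalar_of_reK k (a0 i)).
by rewrite (le_trans (phiZ _ _ _)) ?scalar_re_ge0 // ler_wpM2l ?scalar_re_ge0 // h.
Qed.

Lemma closed_conv_ball (V : normedModType K) (A : set V) :
  A `<=` unit_ball k V -> closed_conv A `<=` unit_ball k V.
Proof.
move=> AB x /(closure_rnorm k) h; rewrite /unit_ball /=.
apply/ler_addgt0Pr => e /h[y cy xy].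
have y1 : rn y <= 1.
  apply: (conv_bound _ _ _ cy) => [u v|r v r0|z /AB //]; first exact: rnormD.
  by rewrite rnorm_realZ ger0_norm.
have := rnormD k (x - y) y; rewrite subrK; lra.
Qed.

Lemma aconv_bound (V : lmodType K) (A : set V) (f : V -> K^o) (c : R) :
  linear f -> (forall x, A x -> rabs (f x) <= c) ->
  forall x, aconv A x -> rabs (f x) <= c.
Proof.
move=> lf h; apply: conv_bound => [u v|r v r0|_ [w w1 [x Ax <-]]].
- by rewrite (linear_add lf) rabsD.
- by rewrite (linear_scale lf) /GRing.scale /= rabsM rabs_real ger0_norm.
by rewrite (linear_scale lf) /GRing.scale /= rabsM (rabs_unit k w1) mul1r h.
Qed.

End ConvexHulls.

(** * Lush operators are spear operators *)

Section SpearOperators.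
Variables (R : realType) (K : numFieldType) (k : real_or_complex R K).
Local Notation rs := (scalar_of_real k).
Local Notation re := (scalar_re k).
Local Notation rabs a := (scalar_re k `|(a : K)|).
Local Notation rn := (rnorm k).
Variables (X Y : normedModType K) (G : X -> Y).
Hypothesis bG : bounded_operator G.
Hypothesis nG : opnorm k G = 1.

Lemma contraction x : rn (G x) <= rn x.
Proof. by have := opnorm_bound k x bG; rewrite nG mul1r. Qed.

Lemma opnormDZ_le (T : X -> Y) w : bounded_operator T -> unit_scalars K w ->
  opnorm k (G + w *: T) <= 1 + opnorm k T.
Proof.
move=> bT w1; apply: opnorm_le => x x1; rewrite !fctE.
rewrite (le_trans (rnormD _ _ _)) // rnorm_unitZ // lerD ?opnorm_ball //.
exact: le_trans (contraction x) x1.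
Qed.

(** Let x0 nearly norm T and let y be the direction of T x0. Lushness for x0 and y gives F;
    separating the convex set G (conv F) + y from a ball gives f with f y and all f (G v), v in F,
    nearly 1. Since x0 is close to aconv F and f (T x0) is nearly the norm of T, some v in F has |f
    (T v)| nearly that large; then T is rotated to align f (T v) with f (G v). *)
Theorem lush_spear_operator : lush k G -> spear_operator k G.
Proof.
move=> lushG T bT; have lG := bG.1; have lT := bT.1.
apply: sup_near => [_ [w w1 <-]|e e0]; first exact: opnormDZ_le.
set N := opnorm k T; have N0 : 0 <= N by exact: opnorm_ge0.
have [NE|Npos] := eqVneq N 0.
  exists (opnorm k (G + 1 *: T)); first by exists 1 => //; exact: unit_scalar1.
  have [x x1 Gx] := opnorm_near k bG e0.
  apply: lt_le_trans (opnorm_ball (bounded_operatorDZ k 1 bG bT) x1).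
  have -> : (G + 1 *: T) x = G x.
    rewrite !fctE scale1r (@rnorm0_eq0 _ _ k _ (T x)) ?addr0 //.
    apply/eqP; rewrite eq_le rnorm_ge0 andbT.
    by apply: le_trans (opnorm_bound k x bT) _; rewrite -/N NE mul0r.
  by rewrite NE addr0 -nG.
have {}N0 : 0 < N by rewrite lt_neqAle eq_sym Npos.
(* The last term keeps the total loss 2 d (1 + N) below e; d < N makes T x0 nonzero. *)
pose d := Num.min 2^-1 (Num.min (N / 2) (e / (2 * (1 + N)))).
have d0 : 0 < d by rewrite !lt_min invr_gt0 ltr0n !divr_gt0 // mulr_gt0 // addr_gt0.
have d1 : d <= 2^-1 by rewrite ge_min lexx.
have dN : d < N.
  have : d <= N / 2 by rewrite /d ge_min ge_min lexx /= orbT.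
  lra.
have de : 2 * d * (1 + N) <= e.
  rewrite mulrAC -ler_pdivlMl ?mulr_gt0 ?addr_gt0 // mulrC.
  by rewrite /d ge_min ge_min lexx !orbT.
have [x0 x01 Tx0] := opnorm_near k bT d0.
have Tx0_gt0 : 0 < rn (T x0) by rewrite (lt_trans _ Tx0) // subr_gt0.
pose y := rs (rn (T x0))^-1 *: T x0.
have y1 : unit_sphere k Y y by apply: rnorm_normalize; rewrite -(rnorm_gt0 k).
have [F [FB Fconv /ereal_inf_lt[_ [u Fu <-]]]] := lushG x0 d y x01 d0 y1.
rewrite lte_fin => x0u.
have [f [/dual_ball_re[lf fn] fW]] :
    exists f, dual_ball k Y f /\
      forall w, [set G x + y | x in conv F] w -> 2 - d <= re (f w).
  apply: separation; first lra.
    move=> _ _ t [u1 Fu1 <-] [u2 Fu2 <-] t01.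
    exists (rs t *: u1 + rs (1 - t) *: u2); first exact: conv_convex.
    rewrite (linear_add lG) !(linear_scale lG) !scalerDr addrACA; congr (_ + _).
    by rewrite -scalerDl -rmorphD addrC subrK rmorph1 scale1r.
  by move=> _ [v /Fconv[_ /ltW ?] <-].
have fn1 v : unit_ball k Y v -> re (f v) <= 1 by move=> v1; apply: le_trans v1.
have fGy v : F v -> 1 - d <= re (f (G v)) /\ 1 - d <= re (f y).
  move=> Fv; have := fW (G v + y); rewrite (linear_add lf) raddfD => h.
  have {}h : 2 - d <= re (f (G v)) + re (f y).
    by apply: h; exists v => //; exact: sub_conv.
  have := fn1 y; rewrite /unit_ball /= y1 => /(_ (lexx _)).
  have := fn1 (G v) (le_trans (contraction v) (FB _ Fv)); lra.
(* The first product bounds re f (T x0) from below; passing from x0 to the point u of aconv F costs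
   at most N d. *)
pose c := (N - d) * (1 - d) - N * d.
have [v [Fv fTv]] : exists v, F v /\ c <= rabs (f (T v)).
  apply: contrapT => noF.
  have lfT : linear (f \o T : X -> K^o).
    by move=> a x x' /=; rewrite lT lf.
  have Fne : F !=set0.
    apply/set0P/eqP => F0.
    (* If F were empty, even the bound -1 would hold vacuously on F, hence for a modulus at u. *)
    have := @aconv_bound _ _ k _ F (f \o T) (-1) lfT _ u Fu.
    rewrite F0 => /(_ (fun _ => @False_ind _)).
    by have := rabs_ge0 k ((f \o T) u : K); lra.
  have [v0 Fv0] := Fne.
  have [_ fy] := fGy _ Fv0.
  have cu : rabs (f (T u)) <= c.
    apply: (@aconv_bound _ _ k _ F (f \o T) c lfT _ u Fu) => x Fx.
    by rewrite leNgt; apply/negP => /ltW h; apply: noF; exists x.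
  have fTx0 : re (f (T x0)) = rn (T x0) * re (f y).
    rewrite /y (linear_scale lf) /GRing.scale /= scalar_reZ mulVKf //.
    by rewrite gt_eqF.
  have dist : re (f (T (x0 - u))) <= N * d.
    rewrite (le_trans (fn _)) // (le_trans (opnorm_bound k _ bT)) //.
    by rewrite ler_wpM2l ?ltW.
  rewrite (linear_sub lT) (linear_sub lf) raddfB /= fTx0 in dist.
  have := le_trans (scalar_re_le k (f (T u) : K)) cu; rewrite /c.
  have := mulr_ge0 (ltW Tx0_gt0) (_ : 0 <= re (f y) - (1 - d)).
  rewrite subr_ge0 => /(_ fy).
  have : 0 < (rn (T x0) - (N - d)) * (1 - d).
    by rewrite mulr_gt0 // subr_gt0 //; lra.
  lra.
have [w w1 wE] := unit_scalar_align (f (T v) : K).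
exists (opnorm k (G + w *: T)); first by exists w.
apply: lt_le_trans (opnorm_ball (bounded_operatorDZ k w bG bT) (FB _ Fv)).
apply: lt_le_trans (fn _); rewrite !fctE (linear_add lf) (linear_scale lf).
rewrite raddfD /= /GRing.scale /= wE.
have [fGv _] := fGy v Fv; apply: lt_le_trans (lerD fGv fTv).
have := mulr_gt0 d0 d0; rewrite /c; lra.
Qed.

End SpearOperators.

Section MoreHulls.
Variables (R : realType) (K : numFieldType) (k : real_or_complex R K).

Lemma conv_mono (V : lmodType K) (A B : set V) : A `<=` B -> conv A `<=` conv B.
Proof.
by move=> AB _ [n [a [x [a0 a1 Ax ->]]]]; exists n, a, x; split=> // i; exact: AB.
Qed.

Lemma closed_conv_mono (V : normedModType K) (A B : set V) :
  A `<=` B -> closed_conv A `<=` closed_conv B.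
Proof. by move=> AB; apply: closure_subset; apply: conv_mono. Qed.

Lemma diameter_ge (V : normedModType K) (A : set V) x y :
  A `<=` unit_ball k V -> A x -> A y -> rnorm k (x - y) <= diameter k A.
Proof.
move=> AB Ax Ay; apply: sup_upper_bound; last by exists x => //; exists y.
split; first by exists (rnorm k (x - y)), x => //; exists y.
exists 2 => _ [u /AB u1] [v /AB v1] <-; rewrite (le_trans (rnormB _ _ _)) //.
exact: lerD.
Qed.

Lemma slice_sub (V : normedModType K) (A : set V) f a : slice k A f a `<=` A.
Proof. by move=> x []. Qed.

End MoreHulls.

(** * Images of denting points, and from hulls of spear sets to lushness *)

Section Daugavet.
Variables (R : realType) (K : numFieldType) (k : real_or_complex R K).
Local Notation rs := (scalar_of_real k).
Local Notation re := (scalar_re k).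
Local Notation rabs a := (scalar_re k `|(a : K)|).
Local Notation rn := (rnorm k).
Variables (X Y : normedModType K) (G : X -> Y).
Hypothesis bG : bounded_operator G.
Hypothesis nG : opnorm k G = 1.

Lemma re_has_sup (f : X -> K^o) : bounded_operator f ->
  has_sup [set re (f z) | z in unit_ball k X].
Proof.
move=> bf; split.
  by exists (re (f 0)), 0 => //; rewrite /unit_ball /= rnorm0.
exists (opnorm k f) => _ [z z1 <-].
exact: le_trans (scalar_re_le _ _) (opnorm_ball bf z1).
Qed.

Lemma nontrivial_ball : exists2 x : X, unit_ball k X x & 2^-1 < rn x.
Proof.
have h0 : (0 : R) < 2^-1 by rewrite invr_gt0.
have [x x1] := opnorm_near k bG h0; rewrite nG => Gx; exists x => //.
apply: lt_le_trans (contraction bG nG x); lra.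
Qed.

(** Rank-one operators only test nonzero y. That G z has norm 1 is recovered by testing a nonzero
    value of G. *)
Lemma near_norming_is_spear z : rn z <= 1 ->
  (forall y (e : R), y != 0 -> 0 < e ->
     exists2 w, unit_scalars K w & 1 + rn y - e < rn (G z + w *: y)) ->
  spear_vector k (G z).
Proof.
move=> z1 h.
have [x _ Gx] := opnorm_near k bG (@ltr01 R).
have Gx0 : G x != 0 by rewrite -(rnorm_gt0 k); move: Gx; rewrite nG subrr.
have Gz1 : rn (G z) <= 1 by exact: le_trans (contraction bG nG z) z1.
have {}Gz1 : rn (G z) = 1.
  apply/eqP; rewrite eq_le Gz1; apply/ler_addgt0Pr => e e0.
  have [w w1] := h (G x) e Gx0 e0.
  have := rnormD k (G z) (w *: G x); rewrite (rnorm_unitZ k _ w1); lra.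
split=> // y; apply: sup_near => [_ [w w1 <-]|e e0].
  by rewrite (le_trans (rnormD _ _ _)) // Gz1 rnorm_unitZ.
have [->|y0] := eqVneq y 0.
  exists (rn (G z + 1 *: 0)); first by exists 1 => //; exact: unit_scalar1.
  by rewrite scaler0 addr0 Gz1 rnorm0 addr0 gtrBl.
by have [w w1 wy] := h y e y0 e0; exists (rn (G z + w *: y)) => //; exists w.
Qed.

(** Let f define a small slice S around z, M be its supremum on the ball and T = (f / M) y. If x
    nearly norms G + w T, then c = |f x| / M is nearly 1, so a rotation th x lies in S and G (th x)
    is close to G z. As f (th x) = c M, also T (th x) = c y is close to y, so |G z + w y| is nearly
    1 + |y|. *)
Theorem daugavet_denting_spear z : alternative_daugavet k G ->
  denting_point k z -> spear_vector k (G z).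
Proof.
move=> adp [z1 dent]; have lG := bG.1.
apply: near_norming_is_spear => // y e y0 e0.
have ny : 0 < rn y by rewrite rnorm_gt0.
(* The bound e / 2 enters the final estimate; the bound 1 excludes M <= 0, where f = 0 and the slice
   is the whole ball, of diameter larger than 1. *)
pose d := Num.min 1 (e / 2); have d0 : 0 < d by rewrite lt_min ltr01 divr_gt0.
have [f [a [bf a0 zS diamS]]] := dent d d0.
have lf := bf.1.
set S := slice _ _ _ _ in zS diamS.
have SB : S `<=` unit_ball k X by exact: slice_sub.
set M := sup [set re (f x) | x in unit_ball k X].
have leM x : unit_ball k X x -> re (f x) <= M.
  by move=> x1; apply: sup_upper_bound; [exact: re_has_sup | exists x].
have ball_unit w x : unit_scalars K w -> unit_ball k X x -> unit_ball k X (w *: x).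
  by move=> w1; rewrite /unit_ball /= rnorm_unitZ.
have rabsM_le x : unit_ball k X x -> rabs (f x) <= M.
  move=> x1; have [w w1 wE] := unit_scalar_align (f x : K).
  have := leM _ (ball_unit _ _ w1 x1).
  by rewrite (linear_scale lf) /GRing.scale /= wE.
have M0 : 0 < M.
  rewrite ltNge; apply/negP => M0.
  have [x x1 x2] := nontrivial_ball.
  have inS u : unit_ball k X u -> S u.
    move=> u1; split=> //; rewrite -/M.
    have -> : f u = 0.
      apply: (@rnorm0_eq0 _ _ k K^o); apply/eqP; rewrite eq_le rnorm_ge0 andbT.
      exact: le_trans (rabsM_le u u1) M0.
    by rewrite raddf0 subr_lt0 (le_lt_trans M0).
  have x1' : unit_ball k X (- x) by rewrite /unit_ball /= rnormN.
  have := diameter_ge SB (inS _ x1) (inS _ x1').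
  rewrite opprK -[x]scale1r -scalerDl -[1]/(1%:R : K) -natrD -(rmorph_nat rs).
  rewrite rnorm_realZ normr_nat.
  have : d <= 1 by rewrite ge_min lexx.
  move: diamS x2; lra.
pose T x := (f x * rs M^-1) *: y.
have nT x : rn (T x) = rabs (f x) / M * rn y.
  by rewrite rnormZ rabsM rabs_real normfV (gtr0_norm M0).
have bT : bounded_operator T.
  apply/(bounded_operatorP k); split=> [b u v|].
    rewrite /T lf mulrDl scalerDl (scalerA b); congr (_ *: _ + _).
    by rewrite /GRing.scale /= mulrA.
  exists (opnorm k f / M * rn y) => [|v].
    by rewrite !mulr_ge0 ?rnorm_ge0 ?opnorm_ge0 // invr_ge0 ltW.
  have -> : opnorm k f / M * rn y * rn v = opnorm k f * rn v / M * rn y by ring.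
  rewrite nT ler_wpM2r ?rnorm_ge0 // ler_wpM2r ?invr_ge0 ?(ltW M0) //.
  exact: opnorm_bound bf.
have NT : rn y <= opnorm k T.
  have -> : opnorm k T = M * opnorm k T / M by rewrite mulrAC divff ?mul1r ?gt_eqF.
  rewrite ler_pdivlMr // mulrC -ler_pdivlMr //; apply: ge_sup.
    by case: (re_has_sup bf).
  move=> _ [x x1 <-]; rewrite ler_pdivlMr //.
  have := opnorm_ball bT x1; rewrite nT => h.
  have := scalar_re_le k (f x : K) => h'.
  rewrite (le_trans (ler_wpM2r (ltW ny) h')) //.
  rewrite -ler_pdivrMl //; apply: le_trans h.
  by rewrite mulrAC (mulrC _ M^-1).
have rT : rank_one T.
  exists y; split=> //; have [x x1 fx] : exists2 x, unit_ball k X x & 0 < re (f x).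
    have [_ [x x1 <-] h] := sup_adherent M0 (re_has_sup bf).
    by exists x => //; move: h; rewrite -/M subrr.
  have fx0 : f x != 0 by apply: contraTneq fx => ->; rewrite raddf0 ltxx.
  apply/seteqP; split=> [_ [u _ <-]|_ [b _ <-]]; first by exists (f u * rs M^-1).
  exists ((b * rs M / (f x : K)) *: x) => //.
  rewrite /T (linear_scale lf) /GRing.scale /= mulfVK // -mulrA -rmorphM.
  by rewrite divff ?gt_eqF // rmorph1 mulr1.
(* The second term puts th x into the slice of width a; the first is spent twice in the final
   estimate. *)
pose g := Num.min (e / 4) (a * rn y / M).
have g0 : 0 < g by rewrite lt_min !divr_gt0 // mulr_gt0.
have supE : has_sup [set opnorm k (G + w *: T) | w in unit_scalars K].
  split; first by exists (opnorm k (G + 1 *: T)), 1 => //; exact: unit_scalar1.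
  by exists (1 + opnorm k T) => _ [w w1 <-]; exact: opnormDZ_le.
have g20 : 0 < g / 2 by rewrite divr_gt0.
have [_ [w w1 <-]] := sup_adherent g20 supE.
rewrite (adp T bT rT) => wh.
have [x x1] := opnorm_near k (bounded_operatorDZ k w bG bT) g20.
rewrite !fctE => hx.
have {}hx : 1 + rn y - g < rn (G x + w *: T x) by lra.
have [th th1 thE] := unit_scalar_align (f x : K).
have Gx1 : rn (G x) <= 1 by exact: le_trans (contraction bG nG x) x1.
set c := rabs (f x) / M.
have c1 : c <= 1 by rewrite ler_pdivrMr // mul1r rabsM_le.
have cy : rn y - g < c * rn y.
  have := rnormD k (G x) (w *: T x); rewrite rnorm_unitZ // nT -/c; lra.
have xS : S (th *: x).
  split; first exact: ball_unit.
  rewrite -/M (linear_scale lf) {1}/GRing.scale /= thE.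
  have gM : g * M <= a * rn y by rewrite -ler_pdivlMr // ge_min lexx orbT.
  have cM : c * M = rabs (f x) by rewrite mulfVK ?gt_eqF.
  rewrite -(ltr_pM2r ny) -cM.
  have h := cy; rewrite -(ltr_pM2r M0) in h; lra.
have xz := diameter_ge SB xS zS.
exists w => //.
have Gxz : rn (G (th *: x) - G z) <= d.
  rewrite -(linear_sub lG) (le_trans (contraction bG nG _)) //.
  exact: le_trans xz (ltW diamS).
have dec : th *: (G x + w *: T x) =
    (G z + w *: y) + ((G (th *: x) - G z) + (w * rs (c - 1)) *: y).
  rewrite scalerDr -(linear_scale lG) addrACA (addrC (G z)) subrK; congr (_ + _).
  rewrite /T !scalerA -scalerDl; congr (_ *: _).
  rewrite -[X in X + _]mulr1 -mulrDr rmorphB rmorph1 addrC subrK rmorphM /=.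
  by rewrite rabsK -thE mulrA mulrA (mulrA w) (mulrC w th).
move: hx; rewrite -(rnorm_unitZ k (G x + w *: T x) th1) dec => hx.
have h1 := rnormD k (G z + w *: y) ((G (th *: x) - G z) + (w * rs (c - 1)) *: y).
have h2 := rnormD k (G (th *: x) - G z) ((w * rs (c - 1)) *: y).
have h3 : rn ((w * rs (c - 1)) *: y) = (1 - c) * rn y.
  rewrite rnormZ rabsM rabs_real (rabs_unit k w1) mul1r distrC ger0_norm //.
  by rewrite subr_ge0.
have gd : g <= e / 4 by rewrite ge_min lexx.
have dd : d <= e / 2 by rewrite ge_min lexx orbT.
rewrite h3 in h2; lra.
Qed.

Lemma spear_set_extreme : [set x | unit_ball k X x /\ spear_vector k (G x)] =
  [set x | unit_ball k X x /\
     forall f : Y -> K^o, extreme_points (dual_ball k Y) f -> `|f (G x)| = 1].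
Proof.
apply/seteqP; split=> x /= [x1 h]; split=> //.
  by move=> f; exact: spear_extreme.
by apply: extreme_spear => //; exact: le_trans (contraction bG nG x) x1.
Qed.

Lemma extreme_set_bigcap :
  [set x | unit_ball k X x /\
     forall f : Y -> K^o, extreme_points (dual_ball k Y) f -> `|f (G x)| = 1] =
  \bigcap_(f in extreme_points (dual_ball k Y))
    [set w *: x | w in unit_scalars K
                & x in [set x | unit_sphere k X x /\ re (f (G x)) = 1]].
Proof.
have bound f x : extreme_points (dual_ball k Y) f -> rabs (f (G x)) <= rn x.
  move=> [/dual_ballP[_ fn] _].
  exact: le_trans (fn _) (contraction bG nG x).
have lin f : extreme_points (dual_ball k Y) f -> linear f.
  by move=> [/dual_ballP[]].
apply/seteqP; split=> x /=.
  move=> [x1 h] f ef; have := h f ef => /(rabs_unit k) fx1.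
  have [w w1 wE] := unit_scalar_align (f (G x) : K).
  exists w^-1; first exact: unit_scalarV.
  exists (w *: x); last by rewrite scalerA mulVf ?unit_scalar_neq0 // scale1r.
  split; last first.
    by rewrite (linear_scale bG.1) (linear_scale (lin _ ef)) /GRing.scale /= wE.
  rewrite /unit_sphere /= rnorm_unitZ //; apply/eqP.
  by rewrite eq_le [_ <= _]x1 -fx1 bound.
move=> h; split.
  (* Some extreme functional must exist: an intersection over an empty family would be the whole
     space. *)
  have [f ef _] := extreme_attains k (0 : Y).
  have [w w1 [u [u1 _] <-]] := h f ef.
  by rewrite /unit_ball /= rnorm_unitZ // (u1 : rn u = 1).
move=> f ef; have [w w1 [u [u1 fu] <-]] := h f ef.
rewrite (linear_scale bG.1) (linear_scale (lin _ ef)) /GRing.scale /=.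
apply: (@rabs_eq1 _ _ k); rewrite rabsM (rabs_unit k w1) mul1r.
apply/eqP; rewrite eq_le -{1}(u1 : rn u = 1) bound //= -{1}fu.
exact: scalar_re_le.
Qed.

(** For an extreme f norming y, F is the face of the ball where re f (G x) = 1. On conv F, re f (G x
    + y) = 2; and every point of the given set can be rotated into F, so aconv F is dense in the
    ball. *)
Theorem extreme_hull_lush : unit_ball k X `<=`
    closed_conv [set x | unit_ball k X x /\
      forall f : Y -> K^o, extreme_points (dual_ball k Y) f ->
        `|f (G x)| = 1] -> lush k G.
Proof.
move=> hull x0 e y x01 e0 y1.
have [f ef fy] := extreme_attains k y; rewrite (y1 : rn y = 1) in fy.
have /dual_ball_re[lf fn] := ef.1.
have lfG : linear (f \o G : X -> K^o) by move=> a u v /=; rewrite bG.1 lf.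
have rfG := re_linear k lfG.
pose F := [set z | unit_ball k X z /\ re (f (G z)) = 1].
exists F; split=> [z []//|x Fx|].
  split.
    apply: closed_conv_ball (_ : F `<=` _) _ _; first by move=> z [].
    exact: subset_closure.
  have h : - re (f (G x)) <= -1.
    apply: (conv_bound (k := k) (phi := fun x => - re (f (G x))) _ _ _ Fx).
    - by move=> u v; rewrite (rfG.1 u v) /= opprD.
    - by move=> r v _; rewrite (rfG.2 r v) /= mulrN.
    - by move=> u [_ ->].
  apply: lt_le_trans (fn _); rewrite (linear_add lf) raddfD /= fy; lra.
have /(closure_rnorm k)/(_ e e0)[u Su x0u] := hull x0 x01.
apply: (@le_lt_trans _ _ (rn (x0 - u))%:E); last by rewrite lte_fin.
apply: ereal_inf_lbound; exists u => //.
apply: conv_mono Su => x [x1 /(_ f ef) fx].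
have [w w1 wE] := unit_scalar_align (f (G x) : K).
exists w^-1; first exact: unit_scalarV.
exists (w *: x); last by rewrite scalerA mulVf ?unit_scalar_neq0 // scale1r.
split; first by rewrite /unit_ball /= rnorm_unitZ.
rewrite (linear_scale bG.1) (linear_scale lf) /GRing.scale /= wE.
by rewrite -(rmorph1 rs) in fx; rewrite fx scalar_reK.
Qed.

End Daugavet.

(** * Denting points from the absence of bushes *)

Section DyadicAverages.
Variables (R : realType) (K : numFieldType) (k : real_or_complex R K).
Local Notation rs := (scalar_of_real k).
Local Notation re := (scalar_re k).
Local Notation rn := (rnorm k).
Variable V : normedModType K.
Implicit Types (A : set V) (u v x : V) (a b : nat -> V) (p q : nat).

(** Equal weights match the later division of a cell into 2 ^ p cells of equal measure. *)
Definition dyadic_mean p a : V := rs (2 ^- p) *: \sum_(j < 2 ^ p) a j.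

Definition dyadic_means A p : set V :=
  [set dyadic_mean p a | a in [set a | forall j, A (a j)]].

Lemma dyadic_means0 A x : A x -> dyadic_means A 0 x.
Proof.
move=> Ax; exists (fun=> x) => //.
by rewrite /dyadic_mean big_ord1 expr0 invr1 rmorph1 scale1r.
Qed.

Lemma dyadic_means_midpoint A p u v : dyadic_means A p u -> dyadic_means A p v ->
  dyadic_means A p.+1 (rs 2^-1 *: u + rs 2^-1 *: v).
Proof.
move=> [a Aa <-] [b Ab <-].
exists (fun j => if (j < 2 ^ p)%N then a j else b (j - 2 ^ p)%N).
  by move=> j /=; case: ifP.
rewrite /dyadic_mean expnS mul2n -addnn big_split_ord /= scalerDr !scalerA.
rewrite -!rmorphM -!invfM -exprS; congr (_ *: _ + _ *: _); apply: eq_bigr => i _.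
  by rewrite ltn_ord.
by rewrite ltnNge leq_addr addKn.
Qed.

Lemma dyadic_means_mono A p q u : (p <= q)%N -> dyadic_means A p u ->
  dyadic_means A q u.
Proof.
move=> /subnK <-; elim: (q - p)%N => //= n IH /IH h; rewrite addSn.
have := dyadic_means_midpoint h h; rewrite -scalerDl -rmorphD.
by have -> : 2^-1 + 2^-1 = 1 :> R; [field | rewrite rmorph1 scale1r].
Qed.

Lemma dyadic_means_ball A p u : A `<=` unit_ball k V -> dyadic_means A p u ->
  rn u <= 1.
Proof.
move=> AB [a Aa <-]; rewrite rnorm_realZ ger0_norm ?invr_ge0 ?exprn_ge0 //.
rewrite mulrC ler_pdivrMr ?exprn_gt0 // mul1r (le_trans (rnorm_sum _ _ _ _)) //.
apply: (@le_trans _ _ (\sum_(j < 2 ^ p) 1)).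
  by apply: ler_sum => i _; apply: AB.
by rewrite sumr_const card_ord natrX.
Qed.

(** Induction on n: the weight m / 2 ^ n.+1 is the midpoint of the weights of denominator 2 ^ n
    whose numerators are m / 2 rounded down and up. *)
Lemma dyadic_means_combine A p u v n m : dyadic_means A p u ->
  dyadic_means A p v -> (m <= 2 ^ n)%N ->
  dyadic_means A (p + n) (rs (m%:R / 2 ^+ n) *: u + rs (1 - m%:R / 2 ^+ n) *: v).
Proof.
move=> Au Av; elim: n m => [|n IH] m mn.
  rewrite addn0 expr0 divr1; case: m mn => [|[|//]] _.
    by rewrite rmorph0 scale0r add0r subr0 rmorph1 scale1r.
  by rewrite rmorph1 scale1r subrr rmorph0 scale0r addr0.
have h1 : (m./2 <= 2 ^ n)%N.
  by rewrite -(doubleK (2 ^ n)%N) half_leq // -mul2n -expnS.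
have h2 : (uphalf m <= 2 ^ n)%N.
  by rewrite -(doubleK (2 ^ n)%N) leq_uphalf_double ?doubleK // -mul2n -expnS.
have := dyadic_means_midpoint (IH _ h1) (IH _ h2); rewrite addnS.
have mE : m%:R = (m./2)%:R + (uphalf m)%:R :> R.
  by rewrite -natrD uphalf_half addnCA addnn odd_double_half.
move=> h; apply: (eq_ind _ (dyadic_means A _) h).
rewrite !scalerDr !scalerA addrACA -!scalerDl -!rmorphM -!rmorphD mE exprS.
have : (2 : R) ^+ n != 0 by rewrite expf_neq0.
by move=> n0; congr (rs _ *: _ + rs _ *: _); field.
Qed.

(** Plays the role of the closed convex hull, with equal weights only. *)
Definition dyadic_closure A : set V :=
  [set x | forall e : R, 0 < e ->
     exists p, exists2 u, dyadic_means A p u & rn (x - u) < e].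

(** The weight t is replaced by a dyadic s with t - s <= 2 ^- n < e / 4; as the means lie in the
    unit ball, this costs less than e / 2. *)
Lemma dyadic_closure_convex A u v (t : R) : A `<=` unit_ball k V ->
  dyadic_closure A u -> dyadic_closure A v -> 0 <= t <= 1 ->
  dyadic_closure A (rs t *: u + rs (1 - t) *: v).
Proof.
move=> AB Au Av /andP[t0 t1] e e0.
have e4 : 0 < e / 4 by rewrite divr_gt0.
have [p1 [u' Au' uu']] := Au _ e4; have [p2 [v' Av' vv']] := Av _ e4.
have {}Au' := dyadic_means_mono (leq_maxl p1 p2) Au'.
have {}Av' := dyadic_means_mono (leq_maxr p1 p2) Av'.
pose n := Num.truncn (4 / e).
have n0 : 0 < 2 ^+ n :> R by rewrite exprn_gt0.
have ne : (2 ^+ n)^-1 < e / 4.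
  rewrite -invf_div ltf_pV2 ?posrE ?divr_gt0 //.
  apply: lt_le_trans (truncnS_gt _) _.
  by rewrite -natrX ler_nat ltn_expl.
pose m := Num.truncn (t * 2 ^+ n).
have tn : 0 <= t * 2 ^+ n by rewrite mulr_ge0 // ltW.
have /andP[lo hi] := truncn_itv tn; rewrite -/m in lo hi.
have mn : (m <= 2 ^ n)%N.
  rewrite -(ler_nat R) natrX (le_trans lo) // -[leRHS]mul1r.
  by rewrite ler_wpM2r // ltW.
exists (maxn p1 p2 + n)%N.
exists (rs (m%:R / 2 ^+ n) *: u' + rs (1 - m%:R / 2 ^+ n) *: v').
  exact: dyadic_means_combine.
set s := m%:R / 2 ^+ n.
have st : 0 <= t - s <= (2 ^+ n)^-1.
  rewrite subr_ge0 ler_pdivrMr // lo /= lerBlDl -[X in _ + X]mul1r -mulrDl ler_pdivlMr //.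
  by rewrite natr1 ltW.
have -> : rs t *: u + rs (1 - t) *: v - (rs s *: u' + rs (1 - s) *: v') =
    rs t *: (u - u') + rs (1 - t) *: (v - v') + rs (t - s) *: (u' - v').
  have e1 : rs t *: (u - u') + rs (t - s) *: u' = rs t *: u - rs s *: u'.
    by rewrite scalerBr rmorphB scalerBl addrA subrK.
  have e2 : rs (1 - t) *: (v - v') - rs (t - s) *: v' =
      rs (1 - t) *: v - rs (1 - s) *: v'.
    by rewrite scalerBr -addrA -opprD -scalerDl -rmorphD addrA subrK.
  by rewrite (scalerBr (rs (t - s))) addrACA e1 e2 addrACA opprD.
have h1 := rnormD k (rs t *: (u - u') + rs (1 - t) *: (v - v'))
  (rs (t - s) *: (u' - v')).
have h2 := rnormD k (rs t *: (u - u')) (rs (1 - t) *: (v - v')).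
rewrite !rnorm_realZ !ger0_norm ?subr_ge0 // in h1 h2; last first.
  by case/andP: st; rewrite subr_ge0.
have h3 : rn (u' - v') <= 2.
  rewrite (le_trans (rnormB _ _ _)) // (_ : 2 = 1 + 1) //.
  by rewrite lerD // ?(dyadic_means_ball AB Au') ?(dyadic_means_ball AB Av').
case/andP: st => st0 st1; have := rnorm_ge0 k (u' - v').
have : (t - s) * rn (u' - v') <= (2 ^+ n)^-1 * 2.
  exact: ler_pM st0 (rnorm_ge0 _ _) st1 h3.
have : t * rn (u - u') + (1 - t) * rn (v - v') <= e / 4.
  have -> : e / 4 = t * (e / 4) + (1 - t) * (e / 4) by ring.
  by rewrite lerD // ler_wpM2l ?subr_ge0 // ltW.
lra.
Qed.

Lemma sub_dyadic_closure A : A `<=` dyadic_closure A.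
Proof.
move=> x Ax e e0; exists 0, x; first exact: dyadic_means0.
by rewrite subrr rnorm0.
Qed.

Lemma dyadic_separation A x (r : R) : A `<=` unit_ball k V -> 0 < r ->
  (forall p u, dyadic_means A p u -> r <= rn (x - u)) ->
  exists2 f : V -> K^o, bounded_operator f &
    forall u, A u -> re (f u) + r <= re (f x).
Proof.
move=> AB r0 h.
pose W := [set x - u | u in dyadic_closure A].
have Wc u v (t : R) : W u -> W v -> 0 <= t <= 1 ->
    W (rs t *: u + rs (1 - t) *: v).
  move=> [{}u Au <-] [{}v Av <-] t01.
  exists (rs t *: u + rs (1 - t) *: v); first exact: dyadic_closure_convex.
  rewrite !scalerBr [RHS]addrACA -scalerDl -rmorphD (addrC t) subrK rmorph1.
  by rewrite scale1r opprD.
have Wr w : W w -> r <= rn w.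
  move=> [u Au <-]; apply/ler_addgt0Pr => e /Au[p [v /h rv uv]].
  have := rdist_triangle k u x v; lra.
have [f [[bf _] fW]] := separation (ltW r0) Wc Wr.
exists f => // u Au.
have := fW (x - u); rewrite (linear_sub bf.1) raddfB /= => H.
rewrite addrC -lerBrDr H //; exists u => //; exact: sub_dyadic_closure.
Qed.

End DyadicAverages.

(** * Small slices and denting points *)

Section Denting.
Variables (R : realType) (K : numFieldType) (k : real_or_complex R K).
Local Notation rs := (scalar_of_real k).
Local Notation re := (scalar_re k).
Local Notation rn := (rnorm k).

Lemma rnorm_complete (V : completeNormedModType K) (x : nat -> V) :
  (forall e : R, 0 < e -> exists N, forall n, (N <= n)%N -> rn (x n - x N) < e) ->
  exists l, forall e : R, 0 < e -> exists N, forall n, (N <= n)%N ->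
    rn (x n - l) < e.
Proof.
move=> h; have /cauchy_cvg/(cvg_rnorm k)xl : cauchy (x @ \oo).
  apply: cauchy_exP => e e0; have [N NP] := h _ (scalar_re_gt0 k e0).
  exists (x N), N => // n /= /NP; rewrite -ball_normE /ball_ /= distrC -(rnormK k).
  by move=> ?; rewrite -(scalar_of_reK k (ltW e0)) scalar_of_real_lt.
exists (lim (x @ \oo)) => e /xl[N _ NP]; exists N => n Nn; exact: NP.
Qed.

Definition far_points (V : normedModType K) (eps : R) (x : V) : set V :=
  [set y | unit_ball k V y /\ eps <= rn (y - x)].

(** The failure of dentability in a form from which a tree grows. The margin between a / 2 and a
    lets points close to x stay in the slice of width a. *)
Definition bush (V : normedModType K) (f : V -> K^o) (M a eps : R) :=
  forall x, unit_ball k V x -> M - a / 2 < re (f x) ->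
    dyadic_closure k (far_points eps x) x.

Variable V : completeNormedModType K.
Hypothesis no_bush : forall (f : V -> K^o) (M a eps : R) (x0 : V),
  bounded_operator f -> (forall x, unit_ball k V x -> re (f x) <= M) ->
  0 < a -> 0 < eps -> unit_ball k V x0 -> M - a / 4 < re (f x0) ->
  ~ bush f M a eps.

(** As there is no bush, some x in the half-width slice is at positive distance from the means of
    the points eps-far from it. A functional g separating x from those far points has a slice
    containing x and only points within eps of x. *)
Lemma small_slice (f : V -> K^o) (a e : R) : bounded_operator f -> 0 < a ->
  0 < e -> exists (g : V -> K^o) (b : R),
  [/\ bounded_operator g, 0 < b, slice k (unit_ball k V) g b !=set0,
      slice k (unit_ball k V) g b `<=` slice k (unit_ball k V) f a &
      forall u v, slice k (unit_ball k V) g b u ->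
        slice k (unit_ball k V) g b v -> rn (u - v) <= e].
Proof.
move=> bf a0 e0; have lf := bf.1; apply: contrapT => nosmall.
set M := sup [set re (f z) | z in unit_ball k V].
have L0 := opnorm_ge0 k bf; set L := opnorm k f in L0.
(* The first term gives diameter at most e; the second changes re f by at most a / 4, so that the
   new slice stays in the old one. *)
pose eps := Num.min (e / 2) (a / (4 * (L + 1))).
have L1 : 0 < L + 1 by rewrite ltr_wpDl.
have eps0 : 0 < eps by rewrite lt_min !divr_gt0 // mulr_gt0.
have epsL : L * eps <= a / 4.
  have : eps <= a / (4 * (L + 1)) by rewrite ge_min lexx orbT.
  by rewrite ler_pdivlMr ?mulr_gt0 //; nra.
have epse : eps <= e / 2 by rewrite ge_min lexx.
have a40 : 0 < a / 4 by rewrite divr_gt0.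
have [_ [x0 x01 <-] x0M] := sup_adherent a40 (re_has_sup k bf).
rewrite -/M in x0M; apply: (no_bush bf _ a0 eps0 x01 x0M) => [x x1|x x1 fx].
  by apply: sup_upper_bound; [exact: re_has_sup | exists x].
apply: contrapT => xfar; apply: nosmall.
have [r [r0 hr]] : exists r : R, 0 < r /\ forall p u,
    dyadic_means k (far_points eps x) p u -> r <= rn (x - u).
  apply: contrapT => nor; apply: xfar => r r0.
  apply: contrapT => h; apply: nor; exists r; split=> // p u Apu.
  by rewrite leNgt; apply/negP => ux; apply: h; exists p, u.
have farB : far_points eps x `<=` unit_ball k V by move=> y [].
have [g bg gfar] := dyadic_separation farB r0 hr.
set N := sup [set re (g z) | z in unit_ball k V].
have leN u : unit_ball k V u -> re (g u) <= N.
  by move=> u1; apply: sup_upper_bound; [exact: re_has_sup | exists u].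
(* The bounding hyperplane is at re g x - r / 2, strictly between x and the far points. *)
have near u : slice k (unit_ball k V) g (N - re (g x) + r / 2) u ->
    rn (u - x) < eps.
  move=> [u1]; rewrite -/N => gu; rewrite ltNge; apply/negP => ux.
  have := gfar u (conj u1 ux); lra.
exists g, (N - re (g x) + r / 2); split=> //.
- have := leN x x1; lra.
- by exists x; split=> //; rewrite -/N; lra.
- move=> u Su; have ux := near _ Su; split; first by case: Su.
  rewrite -/M; have := scalar_re_le k (f (x - u) : K).
  rewrite (linear_sub lf) raddfB /= => h1.
  have := opnorm_bound k (x - u) bf; rewrite rnorm_scalar (linear_sub lf) -/L.
  rewrite (rdistC k x u) => h2; have := le_trans h1 h2.
  have := ler_wpM2l L0 (ltW ux); lra.
- move=> u v /near ux /near vx; have := rdist_triangle k x u v.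
  rewrite (rdistC k x v); lra.
Qed.

(** Slices are bundled with their proofs so that a nested sequence can be defined by recursion. *)
Record slice_data := SliceData {
  slice_fun : V -> K^o; slice_width : R;
  slice_bounded : bounded_operator slice_fun; slice_width_gt0 : 0 < slice_width }.

(** Cantor's intersection argument on slices of diameter at most 2 ^- n. Each slice is taken inside
    the half-width slice [H] of its predecessor, because slices are defined by a strict inequality
    that could be lost in the limit. *)
Lemma denting_in_slice (f : V -> K^o) (a : R) : bounded_operator f -> 0 < a ->
  exists2 x, denting_point k x & slice k (unit_ball k V) f a x.
Proof.
move=> bf a0.
pose S (s : slice_data) := slice k (unit_ball k V) (slice_fun s) (slice_width s).
pose H (s : slice_data) :=
  slice k (unit_ball k V) (slice_fun s) (slice_width s / 2).
have /choice[next nextP] (ns : nat * slice_data) : exists s,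
    [/\ S s !=set0, S s `<=` H ns.2 &
        forall u v, S s u -> S s v -> rn (u - v) <= 2 ^- ns.1].
  case: ns => n [g b bg b0] /=.
  have b20 : 0 < b / 2 by rewrite divr_gt0.
  have n0 : 0 < 2 ^- n :> R by rewrite invr_gt0 exprn_gt0.
  have [h [c [bh c0 Sne Ssub Ssmall]]] := small_slice bg b20 n0.
  by exists (SliceData bh c0).
pose st := fix st n := if n is m.+1 then next (m, st m) else SliceData bf a0.
have stP n : [/\ S (st n.+1) !=set0, S (st n.+1) `<=` H (st n) &
    forall u v, S (st n.+1) u -> S (st n.+1) v -> rn (u - v) <= 2 ^- n].
  exact: nextP (n, st n).
have HS s : H s `<=` S s.
  move=> u [u1 hu]; split=> //; apply: le_lt_trans hu.
  by have := slice_width_gt0 s; lra.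
have /choice[x xP] n : exists x, S (st n.+1) x by case: (stP n).
have mono m n : (n <= m)%N -> S (st m) `<=` S (st n).
  move=> /subnK <-; elim: (m - n)%N => // i IH; rewrite addSn => u Su.
  by apply: IH; apply: HS; case: (stP (i + n)%N) => _ + _; apply.
have small (e : R) : 0 < e -> exists n, 2 ^- n < e.
  move=> e0; exists (Num.truncn e^-1); rewrite invf_plt ?posrE ?exprn_gt0 //.
  apply: lt_le_trans (truncnS_gt _) _.
  by rewrite -natrX ler_nat ltn_expl.
have [l xl] : exists l, forall e : R, 0 < e -> exists N, forall n, (N <= n)%N ->
    rn (x n - l) < e.
  apply: rnorm_complete => e /small[N Ne]; exists N => n Nn.
  apply: le_lt_trans Ne; case: (stP N) => _ _; apply; last exact: xP.
  by apply: (mono n.+1); rewrite ?ltnS //; exact: xP.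
have l1 : unit_ball k V l.
  apply/ler_addgt0Pr => e /xl[N /(_ N (leqnn _)) xNl].
  have [xN1 _] := xP N; have := rnormD k (l - x N) (x N).
  rewrite subrK rdistC; move: xN1; rewrite /unit_ball /=; lra.
have Sl n : S (st n) l.
  split=> //; have w0 := slice_width_gt0 (st n).
  have := slice_bounded (st n); set g := slice_fun _ => bg; set w := slice_width _ in w0 *.
  set M := sup _.
  have gl : M - w / 2 <= re (g l).
    apply/ler_addgt0Pr => e e0; have L0 := opnorm_ge0 k bg.
    have L1 : 0 < opnorm k g + 1 by rewrite ltr_wpDl.
    have [N NP] := xl _ (divr_gt0 e0 L1).
    have := NP _ (leq_maxl N n); set m := maxn N n; rewrite ltr_pdivlMr // => ml.
    have Sm : H (st n) (x m).
      case: (stP n) => _ + _; apply; apply: (mono m.+1); last exact: xP.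
      by rewrite ltnS leq_maxr.
    have := Sm.2; rewrite -/g -/w -/M => gm.
    have := scalar_re_le k (g (x m - l) : K).
    rewrite (linear_sub bg.1) raddfB /= => h1.
    have := opnorm_bound k (x m - l) bg; rewrite rnorm_scalar (linear_sub bg.1).
    move=> /(le_trans h1); have := rnorm_ge0 k (x m - l); lra.
  lra.
exists l; last exact: (Sl 0).
split=> // e /small[n ne]; exists (slice_fun (st n.+1)), (slice_width (st n.+1)).
split; [exact: slice_bounded | exact: slice_width_gt0 | exact: Sl |].
apply: le_lt_trans ne; apply: ge_sup.
  by exists (rn (l - l)), l; [exact: (Sl n.+1) | exists l; [exact: (Sl n.+1)|]].
by move=> _ [u Su [v Sv <-]]; case: (stP n) => _ _; apply.
Qed.

(** A point outside the closed hull would be separated from it, and the slice beyond the hyperplane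
    would still contain a denting point. *)
Theorem ball_denting_hull :
  unit_ball k V = closed_conv [set x | denting_point k x].
Proof.
apply/seteqP; split; last first.
  by apply: closed_conv_ball => x [].
move=> x x1; apply: contrapT => xD.
have [r [r0 hr]] : exists r : R, 0 < r /\
    forall u, conv [set x | denting_point k x] u -> r <= rn (x - u).
  apply: contrapT => nor; apply: xD; apply/(closure_rnorm k) => r r0.
  apply: contrapT => h; apply: nor; exists r; split=> // u cu.
  by rewrite leNgt; apply/negP => ux; apply: h; exists u.
pose W := [set x - u | u in conv [set x | denting_point k x]].
have Wc u v (t : R) : W u -> W v -> 0 <= t <= 1 ->
    W (rs t *: u + rs (1 - t) *: v).
  move=> [{}u Au <-] [{}v Av <-] t01.
  exists (rs t *: u + rs (1 - t) *: v); first exact: conv_convex.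
  rewrite !scalerBr [RHS]addrACA -scalerDl -rmorphD (addrC t) subrK rmorph1.
  by rewrite scale1r opprD.
have Wr w : W w -> r <= rn w by move=> [u Au <-]; exact: hr.
have [f [[bf _] fW]] := separation (ltW r0) Wc Wr.
set M := sup [set re (f z) | z in unit_ball k V].
have Mx : re (f x) <= M.
  by apply: sup_upper_bound; [exact: re_has_sup | exists x].
have a0 : 0 < M - re (f x) + r / 2 by lra.
have [z dz [_]] := denting_in_slice bf a0; rewrite -/M => fz.
have : r <= re (f (x - z)) by apply: fW; exists z => //; exact: sub_conv.
rewrite (linear_sub bf.1) raddfB /=; lra.
Qed.

End Denting.

(** * Bochner integrals *)

Section FiniteMeasure.
Variables (R : realType) (d : measure_display) (T : measurableType d).
Variable mu : {finite_measure set T -> \bar R}.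
Implicit Types A B C E : set T.

Definition fmeasure E : R := fine (mu E).

Lemma fmeasureE E : measurable E -> mu E = (fmeasure E)%:E.
Proof. by move=> mE; rewrite fineK // fin_num_measure. Qed.

Lemma fmeasure_ge0 E : 0 <= fmeasure E.
Proof. exact: fine_ge0. Qed.

Lemma fmeasure_le A B : measurable A -> measurable B -> A `<=` B ->
  fmeasure A <= fmeasure B.
Proof.
by move=> mA mB AB; rewrite -lee_fin -!fmeasureE // le_measure ?inE.
Qed.

Lemma fmeasureU A B : measurable A -> measurable B -> A `&` B = set0 ->
  fmeasure (A `|` B) = fmeasure A + fmeasure B.
Proof.
move=> mA mB AB; apply: EFin_inj; rewrite EFinD -!fmeasureE //.
  exact: measureU.
exact: measurableU.
Qed.

Lemma fmeasure_subU A B : measurable A -> measurable B ->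
  fmeasure (A `|` B) <= fmeasure A + fmeasure B.
Proof.
move=> mA mB; rewrite -lee_fin EFinD -!fmeasureE ?measureU2 //.
exact: measurableU.
Qed.

Lemma measurableY A B : measurable A -> measurable B -> measurable (A `+` B).
Proof. by move=> mA mB; apply: measurableU; apply: measurableD. Qed.

Lemma fmeasureY_triangle A B C : measurable A -> measurable B -> measurable C ->
  fmeasure (A `+` C) <= fmeasure (A `+` B) + fmeasure (B `+` C).
Proof.
move=> mA mB mC; have mAB := measurableY mA mB; have mBC := measurableY mB mC.
apply: le_trans (fmeasure_subU mAB mBC); apply: fmeasure_le.
- exact: measurableY.
- exact: measurableU.
by move=> t; rewrite /setY /=; case: (pselect (B t)); tauto.
Qed.

Lemma fmeasure_bigcup_tail (E : (set T)^nat) (e : R) :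
  (forall n, measurable (E n)) -> 0 < e -> exists N, forall n, (N <= n)%N ->
    fmeasure (\bigcup_n E n `\` \big[setU/set0]_(i < n) E i) < e.
Proof.
move=> mE' e0; pose F n := \big[setU/set0]_(i < n) E i.
have EF : \bigcup_n E n = \bigcup_n F n.
  apply/seteqP; split=> t [n _ h].
    by exists n.+1 => //; rewrite /F -bigcup_mkord; exists n => /=.
  by move: h; rewrite /F -bigcup_mkord => -[i _ Ei]; exists i.
have mE : measurable (\bigcup_n E n) by exact: bigcup_measurable.
have ndF : nondecreasing_seq F.
  move=> m n mn; apply/subsetPset => t; rewrite /F -!bigcup_mkord => -[i im Ei].
  by exists i => //; exact: leq_trans im mn.
have mF n : measurable (F n) by exact: bigsetU_measurable.
have Fcvg : mu \o F @ \oo --> mu (\bigcup_n F n).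
  by apply: nondecreasing_cvg_mu => //; rewrite -EF.
rewrite -EF in Fcvg.
have [N _ NP] : \forall n \near \oo,
    ((fmeasure (\bigcup_n E n) - e)%:E < (mu \o F) n)%E.
  apply: (Fcvg [set y | ((fmeasure (\bigcup_n E n) - e)%:E < y)%E]).
  apply: open_nbhs_nbhs; split; first exact: open_ereal_gt_ereal.
  by rewrite /= (fmeasureE mE) lte_fin gtrBl.
exists N => n /NP /=; rewrite (fmeasureE (mF n)) lte_fin => h.
have FN : F n `<=` \bigcup_n E n by rewrite EF => t Ft; exists n.
have := fmeasureU (mF n) (measurableD mE (mF n)).
by rewrite setDUK // setDIK => /(_ erefl); lra.
Qed.

Lemma fmeasure_sum_le n (E : 'I_n -> set T) (A : set T) :
  (forall i, measurable (E i)) -> trivIset setT E -> measurable A ->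
  (forall i, E i `<=` A) -> \sum_(i < n) fmeasure (E i) <= fmeasure A.
Proof.
move=> mE tE mA EA; rewrite -lee_fin -sumEFin.
have -> : (\sum_(i < n) (fmeasure (E i))%:E =
    mu (\big[setU/set0]_(i < n) E i))%E.
  rewrite (measure_bigsetU_ord mu xpredT mE tE); apply: eq_bigr => i _.
  by rewrite -fmeasureE.
rewrite -(fmeasureE mA); apply: le_measure; rewrite ?inE //.
  exact: bigsetU_measurable.
move=> t; elim/big_ind: _ => [//|B C hB hC [/hB|/hC]//|i _]; exact: EA.
Qed.

Lemma trivIset_ord (E : nat -> set T) n : trivIset setT E ->
  trivIset setT (fun i : 'I_n => E i).
Proof. by move=> tE i j _ _ /(tE _ _ I I)/val_inj. Qed.

End FiniteMeasure.

Section SimpleFunctions.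
Variables (R : realType) (K : numFieldType) (k : real_or_complex R K).
Variable V : normedModType K.
Variables (d : measure_display) (T : measurableType d).
Variable mu : {finite_measure set T -> \bar R}.
Local Notation rs := (scalar_of_real k).
Local Notation rn := (rnorm k).
Implicit Types (s : seq (set T * V)) (v : V) (J A : set T).

Lemma simple_data_cons A v s : simple_data ((A, v) :: s) ->
  measurable A /\ simple_data s.
Proof.
move=> h; split; first by apply: (h (A, v)); rewrite mem_head.
by move=> p ps; apply: h; rewrite inE ps orbT.
Qed.

Lemma simple_val_cons A v s t :
  simple_val ((A, v) :: s) t = (if t \in A then v else 0) + simple_val s t.
Proof.
rewrite /simple_val big_cons indicE /=; congr (_ + _).
by case: (t \in A); rewrite ?scale1r ?scale0r.
Qed.

Lemma simple_integral_cons A v s J : simple_integral k mu ((A, v) :: s) J =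
  rs (fmeasure mu (A `&` J)) *: v + simple_integral k mu s J.
Proof. by rewrite /simple_integral big_cons. Qed.

Lemma measurable_rnorm_simple s v : simple_data s ->
  measurable_fun setT (fun t => rn (v + simple_val s t)).
Proof.
elim: s v => [|[A w] s IH] v.
  move=> _; rewrite (_ : (fun t => _) = cst (rn v)) //.
  by apply/funext => t; rewrite /simple_val big_nil addr0.
move=> /simple_data_cons[mA ds].
have -> : (fun t => rn (v + simple_val ((A, w) :: s) t)) =
    (fun t => if t \in A then rn ((v + w) + simple_val s t)
              else rn (v + simple_val s t)).
  apply/funext => t; rewrite simple_val_cons addrA.
  by case: (t \in A); rewrite ?addr0.
apply: measurable_fun_ifT; [|exact: IH..].
apply: (measurable_fun_bool true) => //; rewrite setTI.
rewrite (_ : _ @^-1` _ = A) //; apply/seteqP.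
by split=> t /= => [/set_mem|/mem_set].
Qed.

Lemma simple_integral_split s A J : simple_data s -> measurable A ->
  measurable J -> simple_integral k mu s J =
  simple_integral k mu s (J `&` A) + simple_integral k mu s (J `\` A).
Proof.
move=> + mA mJ; elim: s => [|[B w] s IH].
  by rewrite /simple_integral !big_nil addr0.
move=> /simple_data_cons[mB ds]; rewrite !simple_integral_cons IH // addrACA.
congr (_ + _); rewrite -scalerDl -rmorphD -fmeasureU.
- by rewrite -setIUr setUIDK.
- by apply: measurableI => //; exact: measurableI.
- by apply: measurableI => //; exact: measurableD.
- by rewrite -subset0 => t [[_ [_ ?]] [_ [_ ?]]].
Qed.

(** The constant v makes the induction on the list work: J is split along the head set A, and on J
    within A the head value w is absorbed into v. *)
Lemma simple_integral_bound s v J : simple_data s -> measurable J ->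
  ((rn (rs (fmeasure mu J) *: v + simple_integral k mu s J))%:E <=
   \int[mu]_(t in J) (rn (v + simple_val s t))%:E)%E.
Proof.
elim: s v J => [|[A w] s IH] v J.
  move=> _ mJ; rewrite /simple_integral big_nil addr0.
  rewrite (eq_integral (cst (rn v)%:E)); last first.
    by move=> t _; rewrite /simple_val big_nil addr0.
  rewrite integral_cst // [X in (_ * X)%E](fmeasureE mu mJ) -EFinM lee_fin rnorm_realZ.
  by rewrite ger0_norm ?fmeasure_ge0 // mulrC.
move=> dAs mJ; have [mA ds] := simple_data_cons dAs.
have mJA : measurable (J `&` A) by exact: measurableI.
have mJDA : measurable (J `\` A) by exact: measurableD.
have JE : J = (J `&` A) `|` (J `\` A) by rewrite setUIDK.
have JA0 : (J `&` A) `&` (J `\` A) = set0.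
  by rewrite -subset0 => t [[_ ?] [_ ?]].
have mf := measurable_rnorm_simple v dAs.
rewrite [X in (_ <= \int[_]_(_ in X) _)%E]JE ge0_integral_setU //; last 3 first.
- by apply/measurable_EFinP; apply: measurable_funS mf.
- by move=> t _; rewrite lee_fin rnorm_ge0.
- exact/disj_set2P.
have h1 := IH (v + w) _ ds mJA; have h2 := IH v _ ds mJDA.
rewrite (eq_integral (fun t => (rn (v + w + simple_val s t))%:E)); last first.
  by move=> t; rewrite inE => -[_ At]; rewrite simple_val_cons mem_set // addrA.
rewrite [X in (_ <= _ + X)%E](eq_integral (fun t => (rn (v + simple_val s t))%:E));
    last first.
  by move=> t; rewrite inE => -[_ At]; rewrite simple_val_cons memNset // add0r.
apply: le_trans (leeD h1 h2); rewrite -EFinD lee_fin.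
apply: le_trans (rnormD _ _ _); rewrite le_eqVlt; apply/orP; left; apply/eqP.
congr rn.
rewrite simple_integral_cons (simple_integral_split ds mA mJ) (setIC A).
rewrite [fmeasure mu J](_ : _ = fmeasure mu (J `&` A) + fmeasure mu (J `\` A)).
  rewrite rmorphD /= scalerDl scalerDr -!addrA; congr (_ + _).
  by rewrite [in RHS](addrCA (simple_integral _ _ _ _)) [RHS]addrCA.
by rewrite -fmeasureU // -JE.
Qed.

End SimpleFunctions.

Section BochnerBounds.
Variables (R : realType) (K : numFieldType) (k : real_or_complex R K).
Variable V : normedModType K.
Variables (d : measure_display) (T : measurableType d).
Variable mu : {finite_measure set T -> \bar R}.
Local Notation rs := (scalar_of_real k).
Local Notation rn := (rnorm k).
Implicit Types (s : seq (set T * V)) (v : V) (J A : set T).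

Definition opp_data s := [seq (p.1, - p.2) | p <- s].

Lemma simple_data_cat s s' : simple_data s -> simple_data s' ->
  simple_data (s ++ s').
Proof. by move=> ds ds' p; rewrite mem_cat => /orP[/ds|/ds']. Qed.

Lemma simple_data_opp s : simple_data s -> simple_data (opp_data s).
Proof. by move=> ds _ /mapP[p /ds mp ->]. Qed.

Lemma simple_val_sub s s' t :
  simple_val (s ++ opp_data s') t = simple_val s t - simple_val s' t.
Proof.
rewrite /simple_val big_cat big_map -sumrN; congr (_ + _).
by apply: eq_bigr => p _; rewrite scalerN.
Qed.

Lemma simple_integral_sub s s' J : simple_integral k mu (s ++ opp_data s') J =
  simple_integral k mu s J - simple_integral k mu s' J.
Proof.
rewrite /simple_integral big_cat big_map -sumrN; congr (_ + _).
by apply: eq_bigr => p _; rewrite scalerN.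
Qed.

Lemma simple_integral_dist s s' J : simple_data s -> simple_data s' ->
  measurable J ->
  ((rn (simple_integral k mu s J - simple_integral k mu s' J))%:E <=
   \int[mu]_(t in J) (rn (simple_val s t - simple_val s' t))%:E)%E.
Proof.
move=> ds ds' mJ.
have := simple_integral_bound k mu 0
  (simple_data_cat ds (simple_data_opp ds')) mJ.
rewrite scaler0 add0r simple_integral_sub.
by under eq_integral do rewrite add0r simple_val_sub.
Qed.

Lemma measurable_rnorm_sub (g : T -> V) s : strongly_measurable g ->
  simple_data s -> measurable_fun setT (fun t => rn (g t - simple_val s t)).
Proof.
move=> [h [dh hg]] ds.
apply: (measurable_fun_cvg
  (h := fun n t => rn (simple_val (h n) t - simple_val s t))) => [n|t _].
  have := measurable_rnorm_simple k 0
    (simple_data_cat (dh n) (simple_data_opp ds)).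
  by under eq_fun do rewrite add0r simple_val_sub.
apply/cvgrPdist_lt => e e0; near=> n.
have h1 := rdist_triangle k (simple_val (h n) t) (g t) (simple_val s t).
have h2 := rdist_triangle k (g t) (simple_val (h n) t) (simple_val s t).
have : rn (simple_val (h n) t - g t) < e.
  by near: n; apply: ((cvg_rnorm k _ _).2 (hg t)).
rewrite (rdistC k (g t) (simple_val (h n) t)) in h1.
by move=> ?; rewrite ltr_norml; apply/andP; split; lra.
Unshelve. all: by end_near. Qed.

Lemma measurable_norm_integrand (g : T -> V) s J : strongly_measurable g ->
  simple_data s ->
  measurable_fun J (fun t => (rn (g t - simple_val s t))%:E).
Proof.
move=> mg ds; apply/measurable_EFinP.
by apply: measurable_funS (measurable_rnorm_sub mg ds).
Qed.

Lemma bochner_integral_dist (g : T -> V) s J v : strongly_measurable g ->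
  simple_data s -> measurable J -> bochner_integral k mu g J v ->
  ((rn (v - simple_integral k mu s J))%:E <=
   \int[mu]_(t in J) (rn (g t - simple_val s t))%:E)%E.
Proof.
move=> mg ds mJ [s' [[ds' s'g] s'v]]; apply/lee_addgt0Pr => e e0.
have e20 : 0 < e / 2 by rewrite divr_gt0.
have [N1 _ h1] := (cvg_rnorm k _ _).2 s'v _ e20.
have [N2 _ h2] : \forall n \near \oo,
    (\int[mu]_t (rn (g t - simple_val (s' n) t))%:E < (e / 2)%:E)%E.
  apply: (s'g [set y | (y < (e / 2)%:E)%E]); apply: open_nbhs_nbhs.
  by split; [exact: open_ereal_lt_ereal | rewrite /= lte_fin].
pose n := maxn N1 N2.
have {}h1 := h1 n (leq_maxl _ _); have {}h2 := h2 n (leq_maxr _ _).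
have h3 := simple_integral_dist (ds' n) ds mJ.
have h4 : (\int[mu]_(t in J) (rn (simple_val (s' n) t - simple_val s t))%:E <=
    \int[mu]_(t in J) (rn (g t - simple_val s t))%:E +
    \int[mu]_(t in J) (rn (g t - simple_val (s' n) t))%:E)%E.
  rewrite -ge0_integralD //; last 4 first.
  - by move=> t _; rewrite lee_fin rnorm_ge0.
  - exact: measurable_norm_integrand.
  - by move=> t _; rewrite lee_fin rnorm_ge0.
  - exact: measurable_norm_integrand.
  apply: ge0_le_integral => //.
  - by move=> t _; rewrite lee_fin rnorm_ge0.
  - have := measurable_norm_integrand (g := simple_val (s' n)) (J := J) _ ds.
    apply; exists (fun=> s' n); split=> // t; exact: cvg_cst.
  - by apply: emeasurable_funD; exact: measurable_norm_integrand.
  - move=> t _; rewrite -EFinD lee_fin [leRHS]addrC.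
    rewrite (rdistC k (g t) (simple_val (s' n) t)); exact: rdist_triangle.
have h5 : (\int[mu]_(t in J) (rn (g t - simple_val (s' n) t))%:E <= (e / 2)%:E)%E.
  apply: le_trans (ltW h2); apply: ge0_subset_integral => //.
  - exact: measurable_norm_integrand.
  - by move=> t _; rewrite lee_fin rnorm_ge0.
have h6 : rn (v - simple_integral k mu s J) <=
    e / 2 + rn (simple_integral k mu (s' n) J - simple_integral k mu s J).
  apply: le_trans (rdist_triangle k (simple_integral k mu (s' n) J) _ _) _.
  by rewrite lerD2r rdistC ltW.
rewrite -lee_fin in h6; apply: le_trans h6 _; rewrite EFinD.
rewrite [e in leRHS](splitr e) EFinD addeA addeC leeD2r //.
apply: le_trans h3 _; apply: le_trans h4 _; exact: leeD2l.
Qed.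

(** As the sets are disjoint, the errors add up to at most one integral over the whole space,
    whatever their number. *)
Lemma bochner_integral_sum (g : T -> V) s (F : set T -> V) (J : nat -> set T)
    (n : nat) : strongly_measurable g -> simple_data s ->
  (forall i, measurable (J i)) -> trivIset setT J ->
  (forall i, bochner_integral k mu g (J i) (F (J i))) ->
  ((\sum_(i < n) rn (F (J i) - simple_integral k mu s (J i)))%:E <=
   \int[mu]_t (rn (g t - simple_val s t))%:E)%E.
Proof.
move=> mg ds mJ tJ bJ.
have -> : \sum_(i < n) rn (F (J i) - simple_integral k mu s (J i)) =
    \sum_(i <- index_iota 0 n) rn (F (J i) - simple_integral k mu s (J i)).
  by rewrite big_mkord.
apply: (@le_trans _ _ (\sum_(i <- index_iota 0 n)
  \int[mu]_(t in J i) (rn (g t - simple_val s t))%:E)%E).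
  rewrite -sumEFin; apply: lee_sum => i _; exact: bochner_integral_dist.
rewrite -ge0_integral_bigsetU //.
- apply: ge0_subset_integral => //.
  + by apply: bigsetU_measurable.
  + exact: measurable_norm_integrand.
  + by move=> t _; rewrite lee_fin rnorm_ge0.
- exact: iota_uniq.
- exact: sub_trivIset tJ.
- exact: measurable_norm_integrand.
- by move=> t _; rewrite lee_fin rnorm_ge0.
Qed.

End BochnerBounds.

(** * Dyadic cells *)

Section Cells.
Variables (R : realType) (d : measure_display) (T : measurableType d).
Variable mu : {finite_measure set T -> \bar R}.

(* c p i is the i-th of 2 ^ p cells of measure 2 ^- p; the cells of index     *)
(* i >= 2 ^ p play no role.                                                   *)
Record dyadic_cells (c : nat -> nat -> set T) : Prop := DyadicCells {
  cell_measurable : forall p i, measurable (c p i);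
  cell_disjoint : forall p i j t, c p i t -> c p j t -> i = j;
  cell_child : forall p q l t, c (p + q)%N l t -> c p (l %/ 2 ^ q)%N t;
  cell_parent : forall p q i t, c p i t ->
    exists2 l, (l %/ 2 ^ q)%N = i & c (p + q)%N l t;
  cell_measure : forall p i, (i < 2 ^ p)%N -> fmeasure mu (c p i) = 2 ^- p }.

Variable c : nat -> nat -> set T.
Hypothesis hc : dyadic_cells c.

Definition cell_union p (S : pred nat) : set T :=
  [set t | exists i, [/\ (i < 2 ^ p)%N, S i & c p i t]].

Lemma cell_trivIset p : trivIset setT (c p).
Proof. by move=> i j _ _ [t [ci cj]]; apply: cell_disjoint hc p i j t ci cj. Qed.

Lemma cell_union_measurable p S : measurable (cell_union p S).
Proof.
have -> : cell_union p S = \bigcup_(i in [set i | (i < 2 ^ p)%N /\ S i]) c p i.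
  by apply/seteqP; split=> [t [i [? ? ?]]|t [i [? ?] ?]]; exists i.
by apply: bigcup_measurable => i _; exact: cell_measurable.
Qed.

Lemma index_lt p q l : ((l %/ 2 ^ q < 2 ^ p) = (l < 2 ^ (p + q)))%N.
Proof. by rewrite ltn_divLR ?expn_gt0 // expnD. Qed.

Lemma cell_union_refine p q S :
  cell_union p S = cell_union (p + q) (fun l => S (l %/ 2 ^ q)%N).
Proof.
apply/seteqP; split=> t [i [ip Si ci]].
  have [l li cl] := cell_parent hc q ci; exists l; split=> //; last by rewrite li.
  by rewrite -index_lt li.
exists (i %/ 2 ^ q)%N; split=> //; first by rewrite index_lt.
exact: (cell_child hc).
Qed.

Lemma fmeasure_cell_union p q S l : (l < 2 ^ (p + q))%N ->
  fmeasure mu (cell_union p S `&` c (p + q) l) =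
  (if S (l %/ 2 ^ q)%N then 2 ^- (p + q) else 0).
Proof.
move=> lp; case: ifP => Sl.
  rewrite (_ : _ `&` _ = c (p + q) l) ?(cell_measure hc) //.
  apply/seteqP; split=> [t []//|t ct]; split=> //.
  exists (l %/ 2 ^ q)%N; split=> //; first by rewrite index_lt.
  exact: (cell_child hc).
rewrite (_ : _ `&` _ = set0) /fmeasure ?measure0 //.
rewrite -subset0 => t [[i [ip Si ci]] /(cell_child hc) cl].
by move: Sl; rewrite -(cell_disjoint hc ci cl) Si.
Qed.

Variables (K : numFieldType) (k : real_or_complex R K) (V : normedModType K).
Local Notation rs := (scalar_of_real k).
Local Notation rn := (rnorm k).

Definition cells_dense := forall (E : set T) (e : R), measurable E -> 0 < e ->
  exists p S, fmeasure mu (E `+` cell_union p S) < e.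
Hypothesis cdense : cells_dense.

Lemma fmeasureI_dist A B J : measurable A -> measurable B -> measurable J ->
  `|fmeasure mu (A `&` J) - fmeasure mu (B `&` J)| <=
  fmeasure mu ((A `+` B) `&` J).
Proof.
move=> mA mB mJ.
have h A' B' : measurable A' -> measurable B' ->
    fmeasure mu (A' `&` J) <=
    fmeasure mu (B' `&` J) + fmeasure mu ((A' `+` B') `&` J).
  move=> mA' mB'; have mY := measurableY mA' mB'.
  have mBJ : measurable (B' `&` J) by exact: measurableI.
  have mYJ : measurable ((A' `+` B') `&` J) by exact: measurableI.
  apply: le_trans (fmeasure_subU mu mBJ mYJ); apply: fmeasure_le.
  - exact: measurableI.
  - exact: measurableU.
  - by move=> t [? ?]; rewrite /setY /=; case: (pselect (B' t)); tauto.
have h1 := h _ _ mA mB; have h2 := h _ _ mB mA; rewrite setYC in h2.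
rewrite ler_norml; apply/andP; split; lra.
Qed.

(** Each set of the list is replaced by a union of cells, so that the simple function becomes
    constant on the cells of some level p; l %/ 2 ^ q is the index of the ancestor of l at that
    level. The error is controlled by measures of symmetric differences, hence uniformly in q. *)
Lemma simple_integral_cells s (e : R) : @simple_data K V d T s -> 0 < e ->
  exists p (y : nat -> V), forall q,
    \sum_(l < 2 ^ (p + q)) rn (simple_integral k mu s (c (p + q) l) -
      rs (2 ^- (p + q)) *: y (l %/ 2 ^ q)%N) <= e.
Proof.
elim: s e => [|[A v] s IH] e.
  move=> _ e0; exists 0, (fun=> 0) => q; rewrite big1 ?ltW // => i _.
  by rewrite /simple_integral big_nil scaler0 subrr rnorm0.
move=> /simple_data_cons[mA ds] e0.
have e20 : 0 < e / 2 by rewrite divr_gt0.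
have [p1 [y1 h1]] := IH _ ds e20.
(* Dividing by |v| + 1 covers v = 0. *)
have v1 : 0 < rn v + 1 by rewrite ltr_wpDl ?rnorm_ge0.
have [p2 [S AS]] := cdense mA (divr_gt0 e20 v1).
have mU := cell_union_measurable p2 S.
have AS' : fmeasure mu (A `+` cell_union p2 S) * rn v <= e / 2.
  rewrite ltr_pdivlMr // in AS; have := fmeasure_ge0 mu (A `+` cell_union p2 S).
  lra.
pose p := maxn p1 p2; pose q1 := (p - p1)%N; pose q2 := (p - p2)%N.
have p1E : p = (p1 + q1)%N by rewrite subnKC // leq_maxl.
have p2E : p = (p2 + q2)%N by rewrite subnKC // leq_maxr.
exists p, (fun l => (if S (l %/ 2 ^ q2)%N then v else 0) + y1 (l %/ 2 ^ q1)%N) => q.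
have pq1 : (p + q = p1 + (q1 + q))%N by rewrite addnA -p1E.
have pq2 : (p + q = p2 + (q2 + q))%N by rewrite addnA -p2E.
have h1q := h1 (q1 + q)%N; rewrite -pq1 in h1q.
have Asum : \sum_(l < 2 ^ (p + q))
    fmeasure mu ((A `+` cell_union p2 S) `&` c (p + q) l) <=
    fmeasure mu (A `+` cell_union p2 S).
  apply: (@fmeasure_sum_le _ _ _ mu _
    (fun l => (A `+` cell_union p2 S) `&` c (p + q) l)).
  - move=> i; apply: measurableI; [exact: measurableY | exact: cell_measurable].
  - by apply: trivIset_setIl; apply: trivIset_ord; exact: cell_trivIset.
  - exact: measurableY.
  - by move=> i t [].
apply: (@le_trans _ _ (\sum_(l < 2 ^ (p + q))
  (fmeasure mu ((A `+` cell_union p2 S) `&` c (p + q) l) * rn v +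
   rn (simple_integral k mu s (c (p + q) l) -
     rs (2 ^- (p + q)) *: y1 (l %/ 2 ^ (q1 + q))%N)))); last first.
  rewrite big_split /= -mulr_suml.
  have := ler_wpM2r (rnorm_ge0 k v) Asum; lra.
apply: ler_sum => l _; have mJ := cell_measurable hc (p + q) l.
rewrite simple_integral_cons -!divnMA -!expnD (addnC q) (addnC q) scalerDr.
rewrite opprD addrACA (le_trans (rnormD _ _ _)) // lerD2r.
have UE := fmeasure_cell_union (p := p2) (q := (q2 + q)%N) S (l := l).
rewrite -pq2 in UE; have {}UE := UE (ltn_ord l).
have -> : rs (2 ^- (p + q)) *: (if S (l %/ 2 ^ (q2 + q))%N then v else 0) =
    rs (fmeasure mu (cell_union p2 S `&` c (p + q) l)) *: v.
  by rewrite UE; case: ifP => _; rewrite ?scaler0 ?rmorph0 ?scale0r.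
rewrite -scalerBl -rmorphB rnorm_realZ ler_wpM2r ?rnorm_ge0 //.
exact: fmeasureI_dist.
Qed.

(** The density is close in mean to a simple function, hence to one constant on cells of a fixed
    level; the estimate persists on all finer levels. *)
Lemma bochner_integral_cells (g : T -> V) (F : set T -> V) (e : R) :
  bochner_integrable k mu g ->
  (forall E, measurable E -> bochner_integral k mu g E (F E)) -> 0 < e ->
  exists p (y : nat -> V), forall q,
    \sum_(l < 2 ^ (p + q))
      rn (F (c (p + q) l) - rs (2 ^- (p + q)) *: y (l %/ 2 ^ q)%N) <= e.
Proof.
move=> [mg [s [ds sg]]] bF e0.
have e20 : 0 < e / 2 by rewrite divr_gt0.
have [N _ /(_ N (leqnn N)) gN] : \forall n \near \oo,
    (\int[mu]_t (rn (g t - simple_val (s n) t))%:E < (e / 2)%:E)%E.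
  apply: (sg [set y | (y < (e / 2)%:E)%E]); apply: open_nbhs_nbhs.
  by split; [exact: open_ereal_lt_ereal | rewrite /= lte_fin].
have [p [y hy]] := simple_integral_cells (ds N) e20.
exists p, y => q.
have := bochner_integral_sum (F := F) (J := c (p + q)) (2 ^ (p + q)) mg (ds N)
  (cell_measurable hc (p + q)) (@cell_trivIset _)
  (fun i => bF _ (cell_measurable hc (p + q) i)).
move=> /le_lt_trans/(_ gN); rewrite lte_fin => /ltW h.
rewrite [e]splitr; apply: le_trans (lerD h (hy q)); rewrite -big_split /=.
by apply: ler_sum => l _; apply: rdist_triangle.
Qed.

End Cells.

(** * Approximation of measurable sets by unions of cells *)

Section DenseCells.
Variables (R : realType) (d : measure_display) (T : measurableType d).
Variable mu : {finite_measure set T -> \bar R}.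
Variable c : nat -> nat -> set T.
Hypothesis hc : dyadic_cells mu c.
Hypothesis cover : forall p, fmeasure mu (~` cell_union c p xpredT) = 0.

Definition approximable (E : set T) := measurable E /\
  forall e : R, 0 < e -> exists p S, fmeasure mu (E `+` cell_union c p S) < e.

Let mU p S : measurable (cell_union c p S).
Proof. exact: cell_union_measurable hc p S. Qed.

(** Among the cells, the complement of a union is the union of the remaining ones; what lies outside
    all cells is null by [cover]. *)
Lemma approximableC E : approximable E -> approximable (~` E).
Proof.
move=> [mE h]; split; first exact: measurableC.
move=> e /h[p [S ES]]; exists p, (predC S); apply: le_lt_trans ES.
rewrite -[leRHS]addr0 -(cover p).
have mEU := measurableY mE (mU p S); have mC := measurableC (mU p xpredT).
apply: le_trans (fmeasure_subU mu mEU mC); apply: fmeasure_le.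
- by apply: measurableY => //; exact: measurableC.
- exact: measurableU.
move=> t; rewrite /setY /=.
case: (pselect (cell_union c p xpredT t)) => [[i [ip _ ci]]|nt]; last by right.
have US (S' : pred nat) : cell_union c p S' t <-> S' i.
  split=> [[j [jp Sj cj]]|Si]; last by exists i.
  by rewrite (cell_disjoint hc ci cj).
rewrite !US /=; case: (S i) => /=; case: (pselect (E t)); intuition.
Qed.

Lemma approximableU E F : approximable E -> approximable F ->
  approximable (E `|` F).
Proof.
move=> [mE hE] [mF hF]; split; first exact: measurableU.
move=> e e0; have e20 : 0 < e / 2 by rewrite divr_gt0.
have [p1 [S1 ES1]] := hE _ e20; have [p2 [S2 FS2]] := hF _ e20.
pose p := maxn p1 p2; pose q1 := (p - p1)%N; pose q2 := (p - p2)%N.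
have p1E : p = (p1 + q1)%N by rewrite subnKC // leq_maxl.
have p2E : p = (p2 + q2)%N by rewrite subnKC // leq_maxr.
rewrite (cell_union_refine hc p1 q1) -p1E in ES1.
rewrite (cell_union_refine hc p2 q2) -p2E in FS2.
set S1' := (fun _ => _) in ES1; set S2' := (fun _ => _) in FS2.
exists p, (predU S1' S2'); rewrite [e]splitr; apply: le_lt_trans (ltrD ES1 FS2).
have mE1 := measurableY mE (mU p S1'); have mF2 := measurableY mF (mU p S2').
apply: le_trans (fmeasure_subU mu mE1 mF2); apply: fmeasure_le.
- by apply: measurableY => //; exact: measurableU.
- exact: measurableU.
have -> : cell_union c p (predU S1' S2') =
    cell_union c p S1' `|` cell_union c p S2'.
  apply/seteqP; split=> [t [i [ip /orP[Si|Si] ci]]|t [|] [i [ip Si ci]]].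
  - by left; exists i.
  - by right; exists i.
  - by exists i; split=> //=; rewrite Si.
  - by exists i; split=> //=; rewrite Si orbT.
by move=> t; rewrite /setY /=; tauto.
Qed.

Lemma approximable0 : approximable set0.
Proof.
split=> // e e0; exists 0, xpred0.
rewrite (_ : _ `+` _ = set0) /fmeasure ?measure0 //.
by rewrite -subset0 => t [[]|[[i []]]].
Qed.

Lemma approximable_bigcup (E : (set T)^nat) : (forall n, approximable (E n)) ->
  approximable (\bigcup_n E n).
Proof.
move=> aE; pose F n := \big[setU/set0]_(i < n) E i.
have aF n : approximable (F n).
  rewrite /F; elim/big_ind: _ => [|A B|i _]; first exact: approximable0.
    exact: approximableU.
  exact: aE.
have mE : measurable (\bigcup_n E n).
  by apply: bigcup_measurable => n _; case: (aE n).
split=> // e e0; have e20 : 0 < e / 2 by rewrite divr_gt0.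
have mF n : measurable (F n) by case: (aF n).
have [N /(_ N (leqnn N)) NP] :=
  fmeasure_bigcup_tail mu (fun n => (aE n).1) e20.
have [p [S FS]] := (aF N).2 _ e20; exists p, S.
rewrite [e]splitr.
apply: le_lt_trans (fmeasureY_triangle mu mE (mF N) (mU p S)) _.
apply: ltr_leD (ltW FS) => //.
have FN : F N `<=` \bigcup_n E n.
  by rewrite /F -bigcup_mkord => t [i _ Ei]; exists i.
by rewrite /setY (_ : F N `\` _ = set0) ?setU0 ?(ltW NP) // setD_eq0.
Qed.

(** The approximable sets form a sigma-algebra, so it suffices to treat generators. *)
Lemma cells_dense_generated (G : set (set T)) :
  measurable = <<s G >> -> (forall E, G E -> approximable E) ->
  cells_dense mu c.
Proof.
move=> mG aG E e mE e0.
suff [_ /(_ e e0)//] : approximable E.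
move: mE; rewrite mG; apply; split=> //; split.
- exact: approximable0.
- by move=> A aA; rewrite setTD; exact: approximableC.
- by move=> A aA; exact: approximable_bigcup.
Qed.

End DenseCells.

(** * Dyadic subintervals of [0, 1[ *)

Section UnitInterval.
Variable R : realType.

Let D : set R := `[0, 1[%classic.

Let mD : measurable (D : set (measurableTypeR R)).
Proof. exact: measurable_itv. Qed.

Let Doo : (@lebesgue_measure R D < +oo)%E.
Proof. by rewrite /D lebesgue_measure_itv /= lte_fin ltr01 ltry. Qed.

Definition unit_measure : {finite_measure set (measurableTypeR R) -> \bar R} :=
  mfrestr mD Doo.

Definition unit_cell (p i : nat) : set (measurableTypeR R) :=
  `[i%:R / 2 ^+ p, i.+1%:R / 2 ^+ p[%classic.

Let pow2_gt0 p : 0 < 2 ^+ p :> R. Proof. exact: exprn_gt0. Qed.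

Lemma unit_cellE p i (t : R) : unit_cell p i t <->
  i%:R <= t * 2 ^+ p /\ t * 2 ^+ p < i.+1%:R.
Proof.
rewrite /unit_cell /= in_itv /= ler_pdivrMr // ltr_pdivlMr //.
by split=> [/andP|[-> ->]].
Qed.

Lemma unit_cell_inj p i j (t : R) : unit_cell p i t -> unit_cell p j t -> i = j.
Proof.
move=> /unit_cellE[i1 i2] /unit_cellE[j1 j2].
have := le_lt_trans i1 j2; have := le_lt_trans j1 i2; rewrite !ltr_nat !ltnS.
by move=> ij ji; apply/eqP; rewrite eqn_leq ij ji.
Qed.

Lemma unit_cell_truncn p (t : R) : 0 <= t -> unit_cell p (Num.truncn (t * 2 ^+ p)) t.
Proof.
move=> t0; apply/unit_cellE.
have /truncn_itv/andP[? ?] : 0 <= t * 2 ^+ p by rewrite mulr_ge0 // ltW.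
by [].
Qed.

Lemma unit_cell_child p q l (t : R) : unit_cell (p + q) l t ->
  unit_cell p (l %/ 2 ^ q) t.
Proof.
move=> /unit_cellE[l1 l2]; apply/unit_cellE.
rewrite -(ler_pM2r (pow2_gt0 q)) -(ltr_pM2r (pow2_gt0 q)) -mulrA -exprD.
rewrite -natrX -!natrM; split.
  by apply: le_trans l1; rewrite ler_nat leq_divM.
apply: lt_le_trans l2 _; rewrite ler_nat.
by rewrite -ltn_divLR ?expn_gt0.
Qed.

(** The inequality is kept for all indices because [unit_cells_dense] uses a cell that may lie
    outside [0, 1[. *)
Lemma fmeasure_unit_cell p i : fmeasure unit_measure (unit_cell p i) <= 2 ^- p /\
  ((i < 2 ^ p)%N -> fmeasure unit_measure (unit_cell p i) = 2 ^- p).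
Proof.
have mc : measurable (unit_cell p i) by exact: measurable_itv.
have cE : lebesgue_measure (unit_cell p i) = (2 ^- p)%:E.
  rewrite lebesgue_measure_itv /= lte_fin ltr_pM2r ?invr_gt0 // ltr_nat ltnSn.
  by rewrite -EFinB -mulrBl -natrB // subSnn mul1r.
have uE A : unit_measure A = lebesgue_measure (A `&` D) by [].
split.
  rewrite -lee_fin -(fmeasureE unit_measure mc) uE -cE.
  by apply: le_measure; rewrite ?inE //; do ?[exact: measurableI | exact: subIsetl].
move=> ip; rewrite /fmeasure uE (_ : _ `&` _ = unit_cell p i) ?cE //.
apply/setIidPl => t /unit_cellE[t1 t2]; rewrite /D /= in_itv /=.
rewrite -(pmulr_lge0 _ (pow2_gt0 p)) (le_trans _ t1) //=.
rewrite -(ltr_pM2r (pow2_gt0 p)) mul1r (lt_le_trans t2) //.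
by rewrite -natrX ler_nat.
Qed.

Lemma unit_dyadic_cells : dyadic_cells unit_measure unit_cell.
Proof.
split.
- by move=> p i; exact: measurable_itv.
- exact: unit_cell_inj.
- exact: unit_cell_child.
- move=> p q i t ct; have t0 : 0 <= t.
    move/unit_cellE: ct => [t1 _]; rewrite -(pmulr_lge0 _ (pow2_gt0 p)).
    exact: le_trans t1.
  exists (Num.truncn (t * 2 ^+ (p + q))); last exact: unit_cell_truncn.
  apply: (unit_cell_inj (p := p) (t := t)) => //.
  by apply: unit_cell_child; exact: unit_cell_truncn.
- by move=> p i; have [] := fmeasure_unit_cell p i.
Qed.

Lemma unit_cells_cover p :
  fmeasure unit_measure (~` cell_union unit_cell p xpredT) = 0.
Proof.
have uE A : unit_measure A = lebesgue_measure (A `&` D) by [].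
rewrite /fmeasure uE (_ : _ `&` _ = set0) ?measure0 //.
rewrite -subset0 => t [ct]; rewrite /D /= in_itv /= => /andP[t0 t1].
apply: ct; exists (Num.truncn (t * 2 ^+ p)); split=> //.
  rewrite -(ltr_nat R) natrX -[ltRHS]mul1r.
  have /truncn_itv/andP[h _] : 0 <= t * 2 ^+ p by rewrite mulr_ge0 // ltW.
  by rewrite (le_lt_trans h) // ltr_pM2r.
exact: unit_cell_truncn.
Qed.

(** A half-line from x is approximated by the cells whose left end is at least x: within [0, 1[, the
    error lies in a single cell. *)
Lemma unit_cells_dense : cells_dense unit_measure unit_cell.
Proof.
suff aG E : @RGenCInfty.G R E -> approximable unit_measure unit_cell E.
  exact: (cells_dense_generated unit_dyadic_cells unit_cells_cover
    (RGenCInfty.measurableE R) aG).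
move=> [x ->]; split; first exact: measurable_itv.
move=> e e0; pose p := Num.truncn e^-1.
have pe : 2 ^- p < e.
  rewrite invf_plt ?posrE //; apply: lt_le_trans (truncnS_gt _) _.
  by rewrite -natrX ler_nat ltn_expl.
pose S : pred nat := fun i => x <= i%:R / 2 ^+ p.
exists p, S; apply: le_lt_trans pe.
have [h _] := fmeasure_unit_cell p (Num.truncn (x * 2 ^+ p)).
apply: le_trans h.
have mU := cell_union_measurable unit_dyadic_cells p S.
have mx : measurable (`[x, +oo[%classic : set (measurableTypeR R)).
  exact: measurable_itv.
have uE A : unit_measure A = lebesgue_measure (A `&` D) by [].
have mY := measurableY mx mU.
have mc : measurable (unit_cell p (Num.truncn (x * 2 ^+ p))).
  exact: measurable_itv.
rewrite -lee_fin -!(fmeasureE unit_measure) // !uE; apply: le_measure.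
- by rewrite inE; exact: measurableI.
- by rewrite inE; exact: measurableI.
move=> t [xUt Dt]; split=> //; case: xUt => [[tx ntU]|[[i [ip Si]]]].
  have xt : x <= t by move: tx; rewrite /= in_itv /= andbT.
  have [t0 t1] : 0 <= t /\ t < 1 by move: Dt; rewrite /D /= in_itv /= => /andP.
  set i := Num.truncn (t * 2 ^+ p).
  have ci : unit_cell p i t by exact: unit_cell_truncn.
  have /unit_cellE[it ti] := ci.
  have ip : (i < 2 ^ p)%N.
    by rewrite -(ltr_nat R) natrX (le_lt_trans it) // gtr_pMl.
  have ix : i%:R / 2 ^+ p < x.
    by rewrite ltNge; apply/negP => Si; apply: ntU; exists i.
  have x0 : 0 <= x by rewrite (le_trans _ (ltW ix)) // divr_ge0 // ltW.
  have cx : unit_cell p i x.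
    apply/unit_cellE; split; first by rewrite -ler_pdivrMr // ltW.
    by apply: le_lt_trans ti; rewrite ler_pM2r.
  by rewrite (unit_cell_inj (unit_cell_truncn p x0) cx).
move=> /unit_cellE[it _]; rewrite /= in_itv /= andbT => /negP; rewrite -ltNge => tx.
have := lt_le_trans tx Si; rewrite ltr_pdivlMr // => /lt_le_trans/(_ it).
by rewrite ltxx.
Qed.

End UnitInterval.

(** * The vector measure of a dyadic tree *)

Lemma big_ord_mul (V : nmodType) n m (g : nat -> V) :
  \sum_(l < n * m) g l = \sum_(i < n) \sum_(j < m) g (i * m + j)%N.
Proof.
elim: n => [|n IH]; first by rewrite mul0n !big_ord0.
by rewrite mulSnr big_split_ord big_ord_recr /= IH.
Qed.

Section DyadicTree.
Variables (R : realType) (K : numFieldType) (k : real_or_complex R K).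
Local Notation rs := (scalar_of_real k).
Local Notation re := (scalar_re k).
Local Notation rn := (rnorm k).
Variable V : normedModType K.

(* Level n has 2 ^ P n nodes with values X n i; the children of node i are    *)
(* the nodes i * 2 ^ Q n + j, whose mean is delta n-close to X n i.           *)
Record dyadic_tree (P Q : nat -> nat) (X : nat -> nat -> V) (delta : nat -> R) :
    Prop := DyadicTree {
  tree_level : forall n, P n.+1 = (P n + Q n)%N;
  tree_branching : forall n, (0 < Q n)%N;
  tree_ball : forall n i, rn (X n i) <= 1;
  tree_mean : forall n i, (i < 2 ^ P n)%N ->
    rn (X n i - dyadic_mean k (Q n) (fun j => X n.+1 (i * 2 ^ Q n + j)%N)) <=
    delta n }.

(** Children of a node in the slice are far points whose mean is close to it; outside the slice the
    condition is vacuous and the node itself would do. All nodes of a level get equally many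
    children thanks to [dyadic_means_mono]. *)
Lemma bush_tree (f : V -> K^o) (M a eps : R) (x0 : V) (delta : nat -> R) :
  bush k f M a eps -> rn x0 <= 1 -> (forall n, 0 < delta n) ->
  exists P Q X, [/\ dyadic_tree P Q X delta, P 0 = 0, X 0 0 = x0 &
    forall n l, (l < 2 ^ P n.+1)%N ->
      M - a / 2 < re (f (X n (l %/ 2 ^ Q n)%N)) ->
      eps <= rn (X n.+1 l - X n (l %/ 2 ^ Q n)%N)].
Proof.
move=> hb x01 delta0.
pose A x : set V := [set y | rn y <= 1 /\
  (M - a / 2 < re (f x) -> eps <= rn (y - x))].
have Acl x : rn x <= 1 -> dyadic_closure k (A x) x.
  move=> x1; have [fx|fx] := ltP (M - a / 2) (re (f x)).
    move=> e e0; have [p [u [b bfar <-] ux]] := hb x x1 fx e e0.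
    exists p, (dyadic_mean k p b) => //; exists b => // j /=.
    by case: (bfar j) => ? ?; split.
  by apply: sub_dyadic_closure; split=> //; rewrite ltNge fx.
(* The ball condition is a premise, so that every state has a successor and [choice] applies. *)
pose good (s : nat * (nat * (nat -> V))) (t : nat * (nat -> V)) :=
  let: (n, (p, x)) := s in let: (q, y) := t in
  (forall i, rn (x i) <= 1) ->
  [/\ (0 < q)%N, forall i, rn (y i) <= 1 &
      forall i, (i < 2 ^ p)%N ->
        rn (x i - dyadic_mean k q (fun j => y (i * 2 ^ q + j)%N)) <= delta n /\
        forall j, (j < 2 ^ q)%N -> A (x i) (y (i * 2 ^ q + j)%N)].
have /choice[next nextP] s : exists t, good s t.
  case: s => n [p x]; have [x1|nx] := pselect (forall i, rn (x i) <= 1); last first.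
    by exists (0, x).
  have /choice[r rP] i : exists r, exists2 u, dyadic_means k (A (x i)) r u &
      rn (x i - u) < delta n.
    by have [r ?] := Acl (x i) (x1 i) _ (delta0 n); exists r.
  (* A common exponent for the level; the successor makes it positive. *)
  pose q := (\max_(i < 2 ^ p) r i).+1.
  have /choice[b bP] i : exists b : nat -> V, (forall j, rn (b j) <= 1) /\
      ((i < 2 ^ p)%N -> rn (x i - dyadic_mean k q b) <= delta n /\
        forall j, A (x i) (b j)).
    have [ip|ip] := ltnP i (2 ^ p); last by exists (fun=> x i); split.
    have [u ru ux] := rP i.
    have rq : (r i <= q)%N by rewrite /q leqW // (leq_bigmax (Ordinal ip)).
    have [b bA bu] := dyadic_means_mono rq ru.
    exists b; split=> [j|_]; first by case: (bA j).
    by split=> //; rewrite bu ltW.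
  exists (q, fun l => b (l %/ 2 ^ q)%N (l %% 2 ^ q)%N) => _; split=> // [i|i ip].
    by case: (bP (i %/ 2 ^ q)%N).
  have [_ /(_ ip)[bi bA]] := bP i.
  have divE j : (j < 2 ^ q)%N -> ((i * 2 ^ q + j) %/ 2 ^ q)%N = i.
    by move=> jq; rewrite divnMDl ?expn_gt0 // divn_small // addn0.
  have modE j : (j < 2 ^ q)%N -> ((i * 2 ^ q + j) %% 2 ^ q)%N = j.
    by move=> jq; rewrite modnMDl modn_small.
  split; last by move=> j jq; rewrite divE // modE.
  rewrite (_ : dyadic_mean _ _ _ = dyadic_mean k q (b i)) //.
  by rewrite /dyadic_mean; congr (_ *: _); apply: eq_bigr => j _; rewrite divE // modE.
pose st := fix st n : nat * (nat -> V) := if n is m.+1 then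
  let t := next (m, st m) in ((st m).1 + t.1, t.2)%N else (0, fun=> x0).
have stball n i : rn ((st n).2 i) <= 1.
  elim: n i => [//|n IH] i /=; have := nextP (n, st n).
  rewrite /good; case: (st n) IH => p x IH; case: (next _) => q y /(_ IH)[_ h _].
  exact: h.
pose Q n := (next (n, st n)).1.
have stP n : [/\ (0 < Q n)%N, forall i, rn ((st n.+1).2 i) <= 1 &
    forall i, (i < 2 ^ (st n).1)%N ->
      rn ((st n).2 i -
        dyadic_mean k (Q n) (fun j => (st n.+1).2 (i * 2 ^ Q n + j)%N)) <=
        delta n /\
      forall j, (j < 2 ^ Q n)%N ->
        A ((st n).2 i) ((st n.+1).2 (i * 2 ^ Q n + j)%N)].
  have := nextP (n, st n); rewrite /Q /= /good; move: (stball n).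
  by case: (st n) => p x x1; case: (next _) => q y /(_ x1).
exists (fun n => (st n).1), Q, (fun n => (st n).2); split=> //.
  split=> //.
  - by move=> n; case: (stP n).
  - by move=> n i ip; case: (stP n) => _ _ /(_ i ip)[].
move=> n l; rewrite [(st n.+1).1]/= -/(Q n) => lP act.
have lq : (l %/ 2 ^ Q n < 2 ^ (st n).1)%N by rewrite index_lt.
have lm : (l %% 2 ^ Q n < 2 ^ Q n)%N by rewrite ltn_mod expn_gt0.
have [_ _ /(_ _ lq)[_ /(_ _ lm)]] := stP n.
by rewrite -divn_eq => -[_]; apply.
Qed.

End DyadicTree.

(** * Limit of the integrals along the levels of a tree *)

Section TreeMeasure.
Variables (R : realType) (K : numFieldType) (k : real_or_complex R K).
Local Notation rs := (scalar_of_real k).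
Local Notation re := (scalar_re k).
Local Notation rn := (rnorm k).
Variable V : completeNormedModType K.
Variables (d : measure_display) (T : measurableType d).
Variable mu : {finite_measure set T -> \bar R}.
Variable c : nat -> nat -> set T.
Hypothesis hc : dyadic_cells mu c.
Hypothesis cdense : cells_dense mu c.
Variables (P Q : nat -> nat) (X : nat -> nat -> V) (d0 : R).
Hypothesis d0_gt0 : 0 < d0.
Hypothesis hX : dyadic_tree k P Q X (fun n => d0 * 2 ^- n.+1).
Local Notation m := (fmeasure mu).
Implicit Types E : set T.

Let mc p i : measurable (c p i). Proof. exact: cell_measurable hc p i. Qed.

Let mcU p S : measurable (cell_union c p S).
Proof. exact: cell_union_measurable hc p S. Qed.

(** The integral over E of the step function with value X n i on the i-th cell of level P n. *)
Definition tree_integral n E : V :=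
  \sum_(i < 2 ^ P n) rs (m (E `&` c (P n) i)) *: X n i.

Lemma tree_integral_dist n E E' : measurable E -> measurable E' ->
  rn (tree_integral n E - tree_integral n E') <= m (E `+` E').
Proof.
move=> mE mE'; rewrite /tree_integral -sumrB.
apply: le_trans (rnorm_sum _ _ _ _) _.
apply: (@le_trans _ _ (\sum_(i < 2 ^ P n) m ((E `+` E') `&` c (P n) i))).
  apply: ler_sum => i _; rewrite -scalerBl -rmorphB rnorm_realZ.
  apply: le_trans (fmeasureI_dist mu mE mE' (mc _ _)).
  by rewrite -[leRHS]mulr1 ler_wpM2l // (tree_ball hX).
have mY := measurableY mE mE'.
apply: (@fmeasure_sum_le _ _ _ mu _ (fun i => (E `+` E') `&` c (P n) i)) => //.
  by move=> i; apply: measurableI.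
by apply: trivIset_setIl; apply: trivIset_ord; exact: cell_trivIset hc _.
Qed.

Lemma tree_integral0 n : tree_integral n set0 = 0.
Proof.
rewrite /tree_integral big1 // => i _.
by rewrite set0I /fmeasure measure0 rmorph0 scale0r.
Qed.

Lemma tree_integralU n E E' : measurable E -> measurable E' ->
  E `&` E' = set0 ->
  tree_integral n (E `|` E') = tree_integral n E + tree_integral n E'.
Proof.
move=> mE mE' EE'; rewrite /tree_integral -big_split /=; apply: eq_bigr => i _.
rewrite -scalerDl -rmorphD setIUl fmeasureU //.
all: try exact: measurableI.
by rewrite setIACA EE' set0I.
Qed.

Lemma tree_integral_union n S : tree_integral n (cell_union c (P n) S) =
  \sum_(i < 2 ^ P n) rs (if S i then 2 ^- P n else 0) *: X n i.
Proof.
apply: eq_bigr => i _; have := fmeasure_cell_union hc (p := P n) (q := 0) S.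
by rewrite addn0 => -> //; rewrite expn0 divn1.
Qed.

Lemma tree_integral_next n S :
  tree_integral n.+1 (cell_union c (P n) S) =
  \sum_(i < 2 ^ P n) rs (if S i then 2 ^- P n else 0) *:
    dyadic_mean k (Q n) (fun j => X n.+1 (i * 2 ^ Q n + j)%N).
Proof.
rewrite /tree_integral (tree_level hX) expnD.
rewrite (@big_ord_mul _ _ _ (fun l => rs (m (cell_union c (P n) S `&`
  c (P n + Q n) l)) *: X n.+1 l)).
apply: eq_bigr => i _; rewrite /dyadic_mean scalerA -rmorphM scaler_sumr.
apply: eq_bigr => j _; congr (rs _ *: _).
have il : (i * 2 ^ Q n + j < 2 ^ (P n + Q n))%N.
  rewrite -index_lt divnMDl ?expn_gt0 // divn_small ?ltn_ord // addn0.
  exact: ltn_ord.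
rewrite (fmeasure_cell_union hc S il) divnMDl ?expn_gt0 // divn_small ?ltn_ord //.
by rewrite addn0; case: ifP => _; rewrite ?mul0r // exprD invfM.
Qed.

Lemma fmeasure_union_ge p (S : pred nat) :
  \sum_(i < 2 ^ p) (if S i then 2 ^- p else 0) <= m (cell_union c p S).
Proof.
apply: (@le_trans _ _ (\sum_(i < 2 ^ p) m (cell_union c p S `&` c p i))).
  apply: ler_sum => i _; have := fmeasure_cell_union hc (p := p) (q := 0) S.
  by rewrite addn0 => -> //; rewrite expn0 divn1.
apply: (@fmeasure_sum_le _ _ _ mu _ (fun i => cell_union c p S `&` c p i)) => //.
  by move=> i; apply: measurableI.
by apply: trivIset_setIl; apply: trivIset_ord; exact: cell_trivIset hc _.
Qed.

(** On unions of cells of level P n, going down one level replaces each node by the mean of its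
    children. *)
Lemma tree_integral_step n S :
  rn (tree_integral n.+1 (cell_union c (P n) S) -
      tree_integral n (cell_union c (P n) S)) <=
  d0 * 2 ^- n.+1 * m (cell_union c (P n) S).
Proof.
rewrite tree_integral_next tree_integral_union -sumrB.
apply: le_trans (rnorm_sum _ _ _ _) _.
have dn : 0 <= d0 * 2 ^- n.+1 by rewrite mulr_ge0 ?ltW // invr_ge0 exprn_ge0.
apply: le_trans (ler_wpM2l dn (fmeasure_union_ge (P n) S)).
rewrite mulr_sumr; apply: ler_sum => i _.
rewrite -scalerBr rnorm_realZ ger0_norm; last first.
  by case: ifP => // _; rewrite invr_ge0 exprn_ge0.
rewrite mulrC ler_wpM2r //; first by case: ifP => // _; rewrite invr_ge0 exprn_ge0.
by rewrite rdistC (tree_mean hX).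
Qed.

Lemma tree_level_leq n N : (N <= n)%N -> (P N <= P n)%N.
Proof.
move=> /subnK <-; elim: (n - N)%N => // i IH.
by rewrite addSn (tree_level hX) (leq_trans IH) // leq_addr.
Qed.

Lemma tree_level_ge n : (n <= P n)%N.
Proof.
elim: n => // n IH; rewrite (tree_level hX) -addn1 leq_add //.
exact: tree_branching hX n.
Qed.

(** Telescoping: the perturbations d0 2 ^- j.+1 for N <= j < n sum to d0 (2 ^- N - 2 ^- n). *)
Lemma tree_integral_tail N n S : (N <= n)%N ->
  rn (tree_integral n (cell_union c (P N) S) -
      tree_integral N (cell_union c (P N) S)) <=
  d0 * (2 ^- N - 2 ^- n) * m (cell_union c (P N) S).
Proof.
set U := cell_union _ _ _.
move=> /subnK <-; elim: (n - N)%N => [|i IH].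
  by rewrite !subrr rnorm0 mulr0 mul0r.
apply: le_trans (rdist_triangle k (tree_integral (i + N) U) _ _) _.
have PN : (P N <= P (i + N))%N by apply: tree_level_leq; rewrite leq_addl.
have UE : U = cell_union c (P (i + N))
    (fun l => S (l %/ 2 ^ (P (i + N) - P N))%N).
  by rewrite /U (cell_union_refine hc _ (P (i + N) - P N)) subnKC.
have := tree_integral_step (i + N) (fun l => S (l %/ 2 ^ (P (i + N) - P N))%N).
rewrite -UE => h.
have -> : 2 ^- N - 2 ^- (i.+1 + N) =
    2 ^- (i + N).+1 + (2 ^- N - 2 ^- (i + N)) :> R.
  by rewrite addSn exprS invfM; lra.
by rewrite mulrDr mulrDl; apply: lerD.
Qed.

Lemma pow2_small (C e : R) : 0 < e -> exists N, forall n, (N <= n)%N ->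
  C * 2 ^- n < e.
Proof.
move=> e0; exists (Num.truncn (C / e)) => n Nn.
rewrite ltr_pdivrMr ?exprn_gt0 // mulrC -ltr_pdivrMr //.
apply: lt_le_trans (truncnS_gt _) _.
rewrite -natrX ler_nat; apply: leq_trans (ltn_expl n _) => //.
Qed.

(** On a union of cells approximating E the integrals are Cauchy by [tree_integral_tail]; replacing
    E by this union costs little, uniformly in n, by [tree_integral_dist]. *)
Lemma tree_integral_cvg E : measurable E ->
  exists l, forall e, 0 < e -> exists N, forall n, (N <= n)%N ->
    rn (tree_integral n E - l) < e.
Proof.
move=> mE; apply: rnorm_complete => e e0.
have e40 : 0 < e / 4 by rewrite divr_gt0.
have [p [S ES]] := cdense mE e40.
have [N1 hN1] := pow2_small (d0 * m setT) e40.
pose N := maxn N1 p; exists N => n Nn.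
set U := cell_union c p S in ES.
have pN : (p <= P N)%N by apply: leq_trans (tree_level_ge N); rewrite leq_maxr.
have mU : measurable U by exact: mcU.
have h1 : rn (tree_integral n U - tree_integral N U) <= e / 4.
  have UE : U = cell_union c (P N) (fun l => S (l %/ 2 ^ (P N - p))%N).
    by rewrite /U (cell_union_refine hc _ (P N - p)) subnKC.
  have := tree_integral_tail (fun l => S (l %/ 2 ^ (P N - p))%N) Nn.
  rewrite -UE => /le_trans; apply; apply: le_trans (ltW (hN1 N (leq_maxl _ _))).
  rewrite mulrAC ler_pM ?mulr_ge0 ?fmeasure_ge0 ?(ltW d0_gt0) //.
  - by rewrite subr_ge0 lef_pV2 ?posrE ?exprn_gt0 // ler_eXn2l // ltr1n.
  - by rewrite ler_wpM2l ?(ltW d0_gt0) // fmeasure_le.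
  - by rewrite gerBl invr_ge0 exprn_ge0.
have h2 := tree_integral_dist n mE mU; have h3 := tree_integral_dist N mE mU.
have h4 := rdist_triangle k (tree_integral n U) (tree_integral n E)
  (tree_integral N E).
have h5 := rdist_triangle k (tree_integral N U) (tree_integral n U)
  (tree_integral N E).
rewrite (rdistC k (tree_integral N U) (tree_integral N E)) in h5; lra.
Qed.

Lemma tree_measure : exists F : set T -> V, forall E, measurable E ->
  forall e : R, 0 < e -> exists N, forall n, (N <= n)%N ->
    rn (tree_integral n E - F E) < e.
Proof.
have /choice[F FP] E : exists l, measurable E ->
    forall e : R, 0 < e -> exists N, forall n, (N <= n)%N ->
    rn (tree_integral n E - l) < e.
  have [mE|nE] := pselect (measurable E); last by exists 0.
  by have [l lP] := tree_integral_cvg mE; exists l.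
by exists F.
Qed.

Section Limit.
Variable F : set T -> V.
Hypothesis Flim : forall E, measurable E -> forall e : R, 0 < e ->
  exists N, forall n, (N <= n)%N -> rn (tree_integral n E - F E) < e.

(** This domination gives bounded variation and absolute continuity, and turns finite additivity
    into countable additivity. *)
Lemma tree_measure_bound E : measurable E -> rn (F E) <= m E.
Proof.
move=> mE; apply/ler_addgt0Pr => e /(Flim mE)[N /(_ N (leqnn N)) h].
have := tree_integral_dist N mE measurable0.
rewrite tree_integral0 subr0 /setY setD0 set0D setU0.
have := rdist_triangle k (tree_integral N E) (F E) 0.
rewrite !subr0 rdistC; lra.
Qed.

Lemma tree_measureU E E' : measurable E -> measurable E' ->
  E `&` E' = set0 -> F (E `|` E') = F E + F E'.
Proof.
move=> mE mE' EE'; apply/eqP; rewrite -subr_eq0; apply/eqP.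
apply: (@rnorm0_eq0 _ _ k); apply/eqP; rewrite eq_le rnorm_ge0 andbT.
apply/ler_addgt0Pr => e e0; rewrite add0r.
have e30 : 0 < e / 3 by rewrite divr_gt0.
have [N1 h1] := Flim mE e30; have [N2 h2] := Flim mE' e30.
have [N3 h3] := Flim (measurableU _ _ mE mE') e30.
pose N := maxn N1 (maxn N2 N3).
have {}h1 := h1 N (leq_maxl _ _).
have {}h2 := h2 N (leq_trans (leq_maxl N2 N3) (leq_maxr _ _)).
have {}h3 := h3 N (leq_trans (leq_maxr N2 N3) (leq_maxr _ _)).
have h4 := rdist_triangle k (tree_integral N (E `|` E')) (F (E `|` E')) (F E + F E').
have h5 := rnormD k (tree_integral N E - F E) (tree_integral N E' - F E').
rewrite addrACA -opprD -tree_integralU // in h5.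
rewrite (rdistC k (F (E `|` E')) (tree_integral N (E `|` E'))) in h4; lra.
Qed.

Lemma tree_vector_measure : vector_measure F.
Proof.
move=> E mE tE; apply/(cvg_rnorm k) => e e0.
have F0 : F set0 = 0.
  apply: (@rnorm0_eq0 _ _ k); apply/eqP; rewrite eq_le rnorm_ge0 andbT.
  by rewrite (le_trans (tree_measure_bound measurable0)) // /fmeasure measure0.
have Fsum n : F (\big[setU/set0]_(i < n) E i) = \sum_(0 <= i < n) F (E i).
  elim: n => [|n IH]; first by rewrite big_ord0 big_nil.
  rewrite big_ord_recr big_nat_recr //= tree_measureU ?IH //.
    exact: bigsetU_measurable.
  rewrite -subset0 => t; rewrite -bigcup_mkord => -[[i /= lt_in Ei] En].
  by have := tE i n I I (ex_intro _ t (conj Ei En)) => ein; rewrite ein ltnn in lt_in.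
have mU : measurable (\bigcup_n E n) by exact: bigcup_measurable.
have [N hN] := fmeasure_bigcup_tail mu mE e0.
exists N => // n /hN; apply: le_lt_trans.
have mB : measurable (\big[setU/set0]_(i < n) E i) by exact: bigsetU_measurable.
rewrite -Fsum rdistC; have sub : \big[setU/set0]_(i < n) E i `<=` \bigcup_n E n.
  by rewrite -bigcup_mkord => t [i _ Ei]; exists i.
have mD := measurableD mU mB.
rewrite -{1}(setDUK sub) tree_measureU ?setDIK // addrAC subrr add0r.
exact: tree_measure_bound.
Qed.

Lemma tree_bounded_variation : Defs.bounded_variation k F.
Proof.
exists (m setT) => n E mE tE.
apply: (@le_trans _ _ (\sum_(i < n) m (E i))).
  by apply: ler_sum => i _; exact: tree_measure_bound.
exact: fmeasure_sum_le.
Qed.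

Lemma tree_dominated : vector_dominates mu F.
Proof.
move=> E mE muE; apply: (@rnorm0_eq0 _ _ k); apply/eqP.
rewrite eq_le rnorm_ge0 andbT (le_trans (tree_measure_bound mE)) //.
by rewrite /fmeasure muE.
Qed.

(** The limit of [tree_integral_tail] on one cell: F recovers the node value up to the perturbations
    still to come. *)
Lemma tree_measure_cell n i : (i < 2 ^ P n)%N ->
  rn (F (c (P n) i) - rs (2 ^- P n) *: X n i) <= d0 * 2 ^- n * 2 ^- P n.
Proof.
move=> iP; apply/ler_addgt0Pr => e /(Flim (mc (P n) i))[N hN].
have {}hN := hN (maxn N n) (leq_maxl _ _).
have cE : c (P n) i = cell_union c (P n) (pred1 i).
  apply/seteqP; split=> [t ct|t [j [_ /eqP -> //]]].
  by exists i; split=> //=; rewrite eqxx.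
have := tree_integral_tail (pred1 i) (leq_maxr N n); rewrite -cE => h1.
have XE : tree_integral n (c (P n) i) = rs (2 ^- P n) *: X n i.
  rewrite {1}cE tree_integral_union (bigD1 (Ordinal iP)) //= eqxx.
  rewrite big1 ?addr0 // => j; rewrite -val_eqE /= => /negPf ->.
  by rewrite rmorph0 scale0r.
rewrite (cell_measure hc iP) XE in h1.
have := rdist_triangle k (tree_integral (maxn N n) (c (P n) i)) (F (c (P n) i))
  (rs (2 ^- P n) *: X n i).
rewrite (rdistC k (F _) (tree_integral _ _)) => h2.
have h3 : d0 * (2 ^- n - 2 ^- maxn N n) * 2 ^- P n <= d0 * 2 ^- n * 2 ^- P n.
  rewrite ler_wpM2r ?invr_ge0 ?exprn_ge0 // ler_wpM2l ?(ltW d0_gt0) //.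
  by rewrite gerBl invr_ge0 exprn_ge0.
lra.
Qed.

End Limit.

(** The L^1 distance between two consecutive step functions of the tree. *)
Definition mean_jump n : R :=
  \sum_(l < 2 ^ P n.+1) 2 ^- P n.+1 * rn (X n.+1 l - X n (l %/ 2 ^ Q n)%N).

(** A density of F is close in mean to a function y constant on the cells of a level p. By
    [tree_measure_cell], the step functions of two consecutive deep levels are then both within e /
    2 of y in mean. *)
Lemma radon_nikodym_tree (e : R) : radon_nikodym_property k V -> 0 < e ->
  exists n, mean_jump n <= e.
Proof.
move=> rnp e0; have [F Flim] := tree_measure.
have [g [bg hg]] := rnp _ _ mu F (tree_vector_measure Flim)
  (tree_bounded_variation Flim) (tree_dominated Flim).
have e40 : 0 < e / 4 by rewrite divr_gt0.
have [p [y hy]] := bochner_integral_cells hc cdense bg hg e40.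
have [N hN] := pow2_small d0 e40.
have near n : (p <= P n)%N -> (N <= n)%N ->
    \sum_(l < 2 ^ P n) 2 ^- P n * rn (X n l - y (l %/ 2 ^ (P n - p))%N) <= e / 2.
  move=> pn /hN Nn; have := hy (P n - p)%N; rewrite subnKC // => h.
  have h' : \sum_(l < 2 ^ P n) d0 * 2 ^- n * 2 ^- P n <= e / 4.
    rewrite sumr_const card_ord -[X in X <= _]mulr_natr natrX -mulrA mulVf.
      by rewrite mulr1 ltW.
    by rewrite expf_neq0.
  have -> : e / 2 = e / 4 + e / 4 by field.
  apply: le_trans (lerD h h'); rewrite -big_split /=; apply: ler_sum => l _.
  apply: le_trans (lerD (lexx _) (tree_measure_cell Flim (ltn_ord l))).
  have := rdist_triangle k (F (c (P n) l)) (rs (2 ^- P n) *: X n l)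
    (rs (2 ^- P n) *: y (l %/ 2 ^ (P n - p))%N).
  rewrite -scalerBr rnorm_realZ ger0_norm ?invr_ge0 ?exprn_ge0 //.
  by rewrite (rdistC k (rs _ *: X n l)) [leRHS]addrC.
pose n := maxn N p; exists n.
have pn : (p <= P n)%N by apply: leq_trans (tree_level_ge n); rewrite leq_maxr.
have h1 := near n pn (leq_maxl _ _).
have h2 := near n.+1 (leq_trans pn (tree_level_leq (leqnSn n)))
  (leq_trans (leq_maxl _ _) (leqnSn n)).
have PQ := tree_level hX n.
have h1' : \sum_(l < 2 ^ P n.+1) 2 ^- P n.+1 *
    rn (X n (l %/ 2 ^ Q n)%N - y (l %/ 2 ^ (P n.+1 - p))%N) <= e / 2.
  apply: le_trans h1; rewrite PQ expnD.
  rewrite (@big_ord_mul _ _ _ (fun l => 2 ^- (P n + Q n) *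
    rn (X n (l %/ 2 ^ Q n)%N - y (l %/ 2 ^ (P n + Q n - p))%N))).
  apply: ler_sum => i _; rewrite (eq_bigr (fun _ => 2 ^- (P n + Q n) *
    rn (X n i - y (i %/ 2 ^ (P n - p))%N))).
    rewrite sumr_const card_ord -[X in X <= _]mulr_natr natrX mulrAC exprD.
    by rewrite invfM mulfVK // expf_neq0.
  move=> j _; have -> : (P n + Q n - p = Q n + (P n - p))%N.
    by rewrite addnC -addnBA.
  rewrite expnD divnMA divnMDl ?expn_gt0 // divn_small ?ltn_ord //.
  by rewrite addn0.
rewrite /mean_jump [e]splitr; apply: le_trans (lerD h2 h1').
rewrite -big_split /=; apply: ler_sum => l _.
rewrite -mulrDr ler_wpM2l ?invr_ge0 ?exprn_ge0 //.
rewrite (rdistC k (X n _)); exact: rdist_triangle.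
Qed.

End TreeMeasure.

(** * The Radon-Nikodym property excludes bushes *)

Section RadonNikodymDenting.
Variables (R : realType) (K : numFieldType) (k : real_or_complex R K).
Local Notation rs := (scalar_of_real k).
Local Notation re := (scalar_re k).
Local Notation rn := (rnorm k).
Variable V : completeNormedModType K.

Lemma sum_const_pow2 p (r : R) : \sum_(i < 2 ^ p) 2 ^- p * r = r.
Proof.
rewrite sumr_const card_ord -[LHS]mulr_natr natrX mulrAC mulVf ?mul1r //.
Qed.

(* The mean of re f over a level decreases slowly, so at least a quarter of   *)
(* the nodes of each level stay in the slice, and their children are far.     *)
Theorem radon_nikodym_no_bush : radon_nikodym_property k V ->
  forall (f : V -> K^o) (M a eps : R) (x0 : V),
  bounded_operator f -> (forall x, unit_ball k V x -> re (f x) <= M) ->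
  0 < a -> 0 < eps -> unit_ball k V x0 -> M - a / 4 < re (f x0) ->
  ~ bush k f M a eps.
Proof.
move=> rnp f M a eps x0 bf fM a0 eps0 x01 fx0 hbush.
have lf := bf.1; have L0 := opnorm_ge0 k bf; set L := opnorm k f in L0.
have L1 : 0 < L + 1 by rewrite ltr_wpDl.
(* All perturbations together lower the mean of re f by at most L d0 <= a / 8. *)
pose d0 := a / (8 * (L + 1)).
have d0_gt0 : 0 < d0 by rewrite divr_gt0 // mulr_gt0.
have Ld0 : L * d0 <= a / 8.
  have : d0 * (8 * (L + 1)) = a by rewrite mulfVK // gt_eqF // mulr_gt0.
  lra.
have dpos n : 0 < d0 * 2 ^- n.+1 by rewrite mulr_gt0 // invr_gt0 exprn_gt0.
have [P [Q [X [hX P0 X0 far]]]] := bush_tree hbush x01 dpos.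
have PQ := tree_level hX.
pose h n := \sum_(i < 2 ^ P n) 2 ^- P n * re (f (X n i)).
have split_level n (u : nat -> R) :
    \sum_(l < 2 ^ P n.+1) 2 ^- P n.+1 * u l =
    \sum_(i < 2 ^ P n) 2 ^- P n *
      \sum_(j < 2 ^ Q n) 2 ^- Q n * u (i * 2 ^ Q n + j)%N.
  rewrite PQ expnD (@big_ord_mul _ _ _ (fun l => 2 ^- (P n + Q n) * u l)).
  apply: eq_bigr => i _; rewrite mulr_sumr; apply: eq_bigr => j _.
  by rewrite exprD invfM mulrA.
have hstep n : h n - L * (d0 * 2 ^- n.+1) <= h n.+1.
  rewrite /h (split_level n (fun l => re (f (X n.+1 l)))).
  rewrite -{1}(sum_const_pow2 (P n) (L * (d0 * 2 ^- n.+1))).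
  rewrite -sumrB; apply: ler_sum => i _.
  rewrite -mulrBr ler_wpM2l ?invr_ge0 ?exprn_ge0 //.
  have fmean : \sum_(j < 2 ^ Q n) 2 ^- Q n * re (f (X n.+1 (i * 2 ^ Q n + j)%N)) =
      re (f (dyadic_mean k (Q n) (fun j => X n.+1 (i * 2 ^ Q n + j)%N))).
    rewrite -mulr_sumr (re_linear k lf).2; congr (_ * _).
    by rewrite (big_morph f (linear_add lf) (linear_zero lf)) raddf_sum.
  rewrite fmean lerBlDl -lerBlDr -raddfB -(linear_sub lf).
  apply: le_trans (scalar_re_le k _) _; apply: le_trans (opnorm_bound k _ bf) _.
  by rewrite ler_wpM2l // (tree_mean hX).
have hlow n : re (f x0) - L * (d0 * (1 - 2 ^- n)) <= h n.
  elim: n => [|n IH].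
    rewrite /h P0 big_ord1 X0 expr0 invr1 mul1r subrr !mulr0 subr0 //.
  apply: le_trans (hstep n); rewrite exprS invfM; lra.
pose act n i := M - a / 2 < re (f (X n i)).
pose ac n : R := \sum_(i < 2 ^ P n) 2 ^- P n * (if act n i then 1 else 0).
(* Nodes in the slice count for at most M, the others for at most M - a / 2. *)
have hup n : h n <= M - a / 2 + a / 2 * ac n.
  rewrite -{1}(sum_const_pow2 (P n) (M - a / 2)) mulr_sumr -big_split /=.
  apply: ler_sum => i _; rewrite mulrCA -mulrDr.
  rewrite ler_wpM2l ?invr_ge0 ?exprn_ge0 //; rewrite /act; case: ltP => h1.
    by have := fM _ (tree_ball hX n i); lra.
  by rewrite mulr0 addr0.
(* The mean h n exceeds M - a / 4 - a / 8, which leaves a / 8 for a / 2 times [ac n]. *)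
have ac4 n : 4^-1 <= ac n.
  have := hlow n; have := hup n.
  have : L * (d0 * (1 - 2 ^- n)) <= a / 8.
    by apply: le_trans Ld0; rewrite ler_wpM2l // ger_pMr.
  move=> h1 h2 h3; have : a * 4^-1 <= a * ac n by lra.
  by rewrite ler_pM2l.
(* A quarter of the nodes have all their children at distance at least eps, so every mean jump is at
   least eps / 4; the property yields one below eps / 8. *)
have eps8 : 0 < eps / 8 by rewrite divr_gt0.
have [n] := radon_nikodym_tree (@unit_dyadic_cells R) (@unit_cells_dense R)
  d0_gt0 hX rnp eps8.
rewrite /mean_jump (split_level n
  (fun l => rn (X n.+1 l - X n (l %/ 2 ^ Q n)%N))) => jump.
have : eps * ac n <= eps / 8.
  apply: le_trans jump; rewrite mulr_sumr; apply: ler_sum => i _.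
  rewrite mulrCA ler_wpM2l ?invr_ge0 ?exprn_ge0 //.
  rewrite -(sum_const_pow2 (Q n) (eps * _)); apply: ler_sum => j _.
  rewrite ler_wpM2l ?invr_ge0 ?exprn_ge0 //.
  case: ifP => acti; last by rewrite mulr0 rnorm_ge0.
  have ij : ((i * 2 ^ Q n + j) %/ 2 ^ Q n)%N = i.
    by rewrite divnMDl ?expn_gt0 // divn_small ?ltn_ord // addn0.
  rewrite mulr1; apply: far; last by rewrite ij.
  by rewrite PQ -index_lt ij ltn_ord.
have := ler_wpM2l (ltW eps0) (ac4 n); lra.
Qed.

Corollary radon_nikodym_denting_hull : radon_nikodym_property k V ->
  unit_ball k V = closed_conv [set x | denting_point k x].
Proof. by move=> /radon_nikodym_no_bush; exact: ball_denting_hull. Qed.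

End RadonNikodymDenting.

(** * The equivalences *)

Theorem proposition5p2 (R : realType) (K : numFieldType)
    (k : real_or_complex R K) (X Y : completeNormedModType K)
    (G : X -> Y) (RNP_X : radon_nikodym_property k X)
    (bounded_G : bounded_operator G) (norm_G : opnorm k G = 1) :
  [<-> lush k G;
       spear_operator k G;
       alternative_daugavet k G;
       forall (f : Y -> K^o) (x : X),
         extreme_points (dual_ball k Y) f -> denting_point k x ->
         `|f (G x)| = 1;
       unit_ball k X =
         closed_conv [set x | unit_ball k X x /\ spear_vector k (G x)];
       unit_ball k X =
         closed_conv [set x | unit_ball k X x /\
           forall f : Y -> K^o, extreme_points (dual_ball k Y) f ->
             `|f (G x)| = 1];
       unit_ball k X =
         closed_conv
           (\bigcap_(f in extreme_points (dual_ball k Y))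
              [set w *: x | w in unit_scalars K
                          & x in [set x | unit_sphere k X x /\
                                          scalar_re k (f (G x)) = 1]])].
Proof.
have spearE := spear_set_extreme bounded_G norm_G.
have extE := extreme_set_bigcap bounded_G norm_G.
tfae.
- exact: lush_spear_operator.
- by move=> sG T bT _; exact: sG.
- move=> adp f x ef dx.
  exact: spear_extreme (daugavet_denting_spear bounded_G norm_G adp dx) ef.
- move=> h; rewrite spearE; apply/seteqP; split; last first.
    by apply: closed_conv_ball => x [].
  (* By (iv) the denting points, whose closed hull is the ball, belong to the set. *)
  rewrite {1}(radon_nikodym_denting_hull RNP_X); apply: closed_conv_mono.
  by move=> x dx; split=> [|f ef]; [case: dx | exact: h].
- by rewrite spearE.
- by rewrite extE.
- rewrite -extE => h; apply: (extreme_hull_lush bounded_G).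
  by rewrite -h.
Qed.
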